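(* Let $\{a_n\}_{n=1}^\infty$ be positive numbers and $\{b_n\}_{n=1}^\infty$ real numbers, put $c_n:=a_n-\sqrt n$, and suppose that $$c_n=o(\sqrt n)\ \text{ as } n\to\infty\quad\text{and}\quad \sum_{n=1}^{\infty}\left(\frac{|c_n|}{n}+\frac{|c_{n+1}-c_n|+|b_n|}{\sqrt n}\right)<\infty .$$ Let $\mathcal J$ be the Jacobi operator defined by $\{a_n\},\{b_n\}$ and $P_n(\lambda)$ its polynomials of the first kind. Then the spectrum of $\mathcal J$ is purely absolutely continuous and for almost all $\lambda\in\mathbb{R}$ the spectral density equals $$\rho'(\lambda)=\frac1{\pi}\lim_{n\to\infty}\frac{1}{\sqrt n\,\bigl(P_n^2(\lambda)+P_{n+1}^2(\lambda)\bigr)},$$ the right-hand side being finite and non-zero for every $\lambda\in\mathbb{R}$.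
   Context: Jacobi operator $\mathcal J$: the closure in $l^2(\mathbb N)$ of the operator defined on finitely supported sequences by $(\mathcal Ju)_n=a_{n-1}u_{n-1}+b_nu_n+a_nu_{n+1}$ for $n\ge2$ and $(\mathcal Ju)_1=b_1u_1+a_1u_2$. It is self-adjoint when $\sum_n 1/a_n=\infty$ (which holds under the hypotheses, since $a_n\sim\sqrt n$). The spectral measure is $d\rho:=(dE\,e_1,e_1)$, where $dE$ is the operator-valued spectral measure of $\mathcal J$ and $e_1$ is the first vector of the canonical basis; $\rho'$ (the spectral density) is its density with respect to Lebesgue measure. Polynomials of the first kind $P_n(\lambda)$: the solution of $a_{n-1}u_{n-1}+b_nu_n+a_nu_{n+1}=\lambda u_n$, $n\ge2$, with $P_1(\lambda)\equiv1$, $P_2(\lambda)=\frac{\lambda-b_1}{a_1}$. *)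

(* Defs.v *)
From HB Require Import structures.
From mathcomp Require Import all_boot all_order all_algebra.
From mathcomp Require Import complex ring.
From mathcomp Require Import all_classical all_reals all_analysis.

Set Implicit Arguments.
Unset Strict Implicit.
Unset Printing Implicit Defensive.

Import Order.TTheory GRing.Theory Num.Theory.
Import numFieldNormedType.Exports.

Local Open Scope classical_set_scope.
Local Open Scope ring_scope.
Local Open Scope complex_scope.

(* All sequences indexed by 1, 2, 3, ... are represented with a shift: the
   entry [n : nat] of a Rocq sequence is the entry of index n + 1 in the
   mathematical one.  In particular sqrt n becomes [Num.sqrt n.+1%:R]. *)

Section ell2.
Context {R : realType}.

Definition sqmod (z : R[i]) : R := complex.Re z ^+ 2 + complex.Im z ^+ 2.

Definition in_l2 : {pred nat -> R[i]} :=
  mem [set u : nat -> R[i] | (\sum_(0 <= n <oo) (sqmod (u n))%:E < +oo)%E].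

Lemma sqmod_ge0 z : 0 <= sqmod z.
Proof. by rewrite /sqmod addr_ge0// sqr_ge0. Qed.

Lemma sqmodMD k x y :
  sqmod (k * x + y) <= 2 * sqmod k * sqmod x + 2 * sqmod y.
Proof.
case: k x y => [a b] [c d] [e f]; rewrite /sqmod /=.
set p := a * c - b * d; set q := a * d + b * c.
have -> : 2 * (a ^+ 2 + b ^+ 2) * (c ^+ 2 + d ^+ 2) = 2 * p ^+ 2 + 2 * q ^+ 2.
  by rewrite /p /q; ring.
rewrite -subr_ge0.
have -> : 2 * p ^+ 2 + 2 * q ^+ 2 + 2 * (e ^+ 2 + f ^+ 2)
    - ((p + e) ^+ 2 + (q + f) ^+ 2) = (p - e) ^+ 2 + (q - f) ^+ 2 by ring.
by rewrite addr_ge0// sqr_ge0.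
Qed.

Lemma l2_submod_closed : submod_closed in_l2.
Proof.
split=> [|k u v]; rewrite !inE/=.
  rewrite eseries0 ?ltry// => n _ _.
  by rewrite /sqmod /= expr0n/= addr0.
move=> hu hv.
apply: (@le_lt_trans _ _ (\sum_(0 <= n <oo)
   ((2 * sqmod k)%:E * (sqmod (u n))%:E + 2%:E * (sqmod (v n))%:E))%E).
  apply: lee_nneseries => [n _ _|n _].
    by rewrite lee_fin sqmod_ge0.
  by rewrite -!EFinM -EFinD lee_fin sqmodMD.
have k0 : 0 <= 2 * sqmod k by rewrite mulr_ge0// sqmod_ge0.
rewrite nneseriesD; last 2 first.
- by move=> n _ _; rewrite -EFinM lee_fin mulr_ge0// sqmod_ge0.
- by move=> n _ _; rewrite -EFinM lee_fin mulr_ge0// sqmod_ge0.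
rewrite !nneseriesZl//; try by move=> n _; rewrite lee_fin sqmod_ge0.
by rewrite lte_add_pinfty// lte_mul_pinfty// lee_fin.
Qed.

HB.instance Definition _ := GRing.isSubmodClosed.Build _ _ in_l2
  l2_submod_closed.

Record l2 := L2 { l2val :> nat -> R[i]; l2valP : l2val \in in_l2 }.

HB.instance Definition _ := [isSub for l2val].
HB.instance Definition _ := [Choice of l2 by <:].
HB.instance Definition _ := [SubChoice_isSubLmodule of l2 by <:].

Definition l2norm (u : l2) : R :=
  Num.sqrt (limn (series (fun n => sqmod (u n)))).

(* (u, v) = \sum_n u_n * conj v_n *)
Definition l2dot (u v : l2) : R[i] :=
  limn (series (fun n => complex.Re (u n * (v n)^*))) +i*
  limn (series (fun n => complex.Im (u n * (v n)^*))).

Lemma l2_delta k : (fun n : nat => (n == k)%:R : R[i]) \in in_l2.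
Proof.
rewrite inE/= (@nneseries_split _ _ 0 k.+1) ?add0n; last first.
  by move=> n _; rewrite lee_fin sqmod_ge0.
rewrite [X in (_ + X)%E]eseries0 ?adde0; last first.
  move=> n kn _; rewrite (gtn_eqF kn) /sqmod /= expr0n/= addr0//.
by rewrite sumEFin ltry.
Qed.

Definition delta_l2 k : l2 := L2 (l2_delta k).

End ell2.

Arguments l2 : clear implicits.

Section operators.
Context {R : realType}.

(* Unbounded operators in l^2 are represented by their graphs; the closure of
   an operator has as graph the closure of the graph in l^2 x l^2. *)
Definition graph_closure (T : set (l2 R * l2 R)) : set (l2 R * l2 R) :=
  [set p : l2 R * l2 R | forall e : R, 0 < e -> exists2 q, T q &
     l2norm (p.1 - q.1) < e /\ l2norm (p.2 - q.2) < e].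

Definition adjoint_graph (T : set (l2 R * l2 R)) : set (l2 R * l2 R) :=
  [set p : l2 R * l2 R | forall q, T q -> l2dot q.2 p.1 = l2dot q.1 p.2].

Definition self_adjoint (T : set (l2 R * l2 R)) : Prop := T = adjoint_graph T.

Definition finitely_supported (u : nat -> R[i]) :=
  exists N, forall n, (N <= n)%N -> u n = 0.

Definition jacobi_expr (a b : nat -> R) (u : nat -> R[i]) (n : nat) : R[i] :=
  (if n is m.+1 then (a m)%:C * u m else 0) + (b n)%:C * u n
  + (a n)%:C * u n.+1.

Definition jacobi0 (a b : nat -> R) : set (l2 R * l2 R) :=
  [set p : l2 R * l2 R | finitely_supported p.1 /\ forall n, p.2 n = jacobi_expr a b p.1 n].

Definition jacobi (a b : nat -> R) : set (l2 R * l2 R) :=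
  graph_closure (jacobi0 a b).

(* Polynomials of the first kind: [jacobiP a b n x] is P_{n+1}(x). *)
Fixpoint jacobiP (a b : nat -> R) (n : nat) (x : R) {struct n} : R :=
  match n with
  | 0 => 1
  | 1 => (x - b 0%N) / a 0%N
  | (m.+1 as k).+1 =>
      ((x - b k) * jacobiP a b k x - a m * jacobiP a b m x) / a k
  end.

(* Projection-valued Borel measures on the line.  Countable additivity is
   required of the set functions B |-> (E(B) u, u), which by polarization is
   countable additivity of all the set functions B |-> (E(B) u, v).  The values
   on non-Borel sets are irrelevant; letting them be (arbitrary) orthogonal
   projections makes B |-> (E(B) u, u) nonnegative everywhere, as the type of
   measures demands. *)
Record pvm := PVM {
  pvm_fun :> set (measurableTypeR R) -> {linear l2 R -> l2 R};
  pvm_idem : forall B u, pvm_fun B (pvm_fun B u) = pvm_fun B u;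
  pvm_selfadjoint : forall B u v,
    l2dot (pvm_fun B u) v = l2dot u (pvm_fun B v);
  pvm_set0 : forall u, pvm_fun set0 u = 0;
  pvm_setT : forall u, pvm_fun setT u = u;
  pvm_setI : forall A B, measurable A -> measurable B ->
    forall u, pvm_fun (A `&` B) u = pvm_fun A (pvm_fun B u);
  pvm_sigma_additive : forall u,
    semi_sigma_additive (fun B => (complex.Re (l2dot (pvm_fun B u) u))%:E) }.

(* d(E u, u); the number (E(B) u, u) is real. *)
Definition pvm_measure (E : pvm) (u : l2 R) (B : set (measurableTypeR R)) :
  \bar R := (complex.Re (l2dot (E B u) u))%:E.

Section pvm_measure.
Variables (E : pvm) (u : l2 R).

Lemma Re_l2dot_ge0 (w : l2 R) : 0 <= complex.Re (l2dot w w).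
Proof.
rewrite /l2dot /=.
have := l2valP w; rewrite inE/= => w2.
have wE n : complex.Re (w n * (w n)^*) = sqmod (w n).
  by case: (w n) => x y; rewrite /sqmod /=; ring.
under [X in series X]eq_fun do rewrite wE.
apply: limr_ge.
  apply: nondecreasing_is_cvgn.
    by apply: nondecreasing_series => n _ _; exact: sqmod_ge0.
  exists (fine (\sum_(0 <= n <oo) (sqmod (w n))%:E)%E) => _ [n _ <-].
  rewrite -lee_fin fineK; last first.
    rewrite ge0_fin_numE//; apply: nneseries_ge0 => k _ _.
    by rewrite lee_fin sqmod_ge0.
  rewrite /series/= -sumEFin; apply: nneseries_lim_ge => k _.
  by rewrite lee_fin sqmod_ge0.
by apply: nearW => n; apply: sumr_ge0 => k _; exact: sqmod_ge0.
Qed.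

Let pvm_measure0 : pvm_measure E u set0 = 0%E.
Proof.
rewrite /pvm_measure pvm_set0 /l2dot /=.
under [X in series X]eq_fun do rewrite mul0r/=.
have -> : series (fun _ : nat => 0 : R) = (fun=> 0).
  by apply/funext => n; rewrite /series/= big1.
by rewrite lim_cst.
Qed.

Let pvm_measure_ge0 B : (0 <= pvm_measure E u B)%E.
Proof.
by rewrite lee_fin -pvm_idem pvm_selfadjoint Re_l2dot_ge0.
Qed.

HB.instance Definition _ := isMeasure.Build _ _ _ (pvm_measure E u)
  pvm_measure0 pvm_measure_ge0 (@pvm_sigma_additive E u).

Let pvm_measure_fin : fin_num_fun (pvm_measure E u).
Proof. by []. Qed.

HB.instance Definition _ := Measure_isFinite.Build _ _ _ (pvm_measure E u)
  pvm_measure_fin.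

End pvm_measure.

(* T = \int x dE(x): the domain of T is { u | \int x^2 d(E(x) u, u) < oo }, and
   (T u, u) = \int x d(E(x) u, u) on it; by polarization this is
   (T u, v) = \int x d(E(x) u, v).  For self-adjoint T, exactly one such E
   exists, by the spectral theorem. *)
Definition is_spectral_measure (T : set (l2 R * l2 R)) (E : pvm) : Prop :=
  (forall u, (exists v, T (u, v)) <->
     (\int[pvm_measure E u]_x (x ^+ 2)%:E < +oo)%E) /\
  (forall u v, T (u, v) ->
     l2dot v u = (Rintegral (pvm_measure E u) setT (fun x => x))%:C).

(* All of l^2 is the absolutely continuous subspace. *)
Definition purely_absolutely_continuous (E : pvm) : Prop :=
  forall u : l2 R, pvm_measure E u `<< @lebesgue_measure R.

Definition spectral_rho (E : pvm) : set (measurableTypeR R) -> \bar R :=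
  pvm_measure E (delta_l2 0).

HB.instance Definition _ (E : pvm) :=
  FiniteMeasure.copy (spectral_rho E) (pvm_measure E (delta_l2 0)).

Definition spectral_density (E : pvm) : R -> \bar R :=
  Radon_Nikodym (charge_of_finite_measure (spectral_rho E))
    (@lebesgue_measure R).

End operators.

Arguments pvm : clear implicits.

(* Main.v *)
Require Import Defs.
From HB Require Import structures.
From mathcomp Require Import all_boot all_order all_algebra.
From mathcomp Require Import complex ring lra zify.
From mathcomp Require Import all_classical all_reals all_analysis measurable_realfun.

Set Implicit Arguments.
Unset Strict Implicit.
Unset Printing Implicit Defensive.

Import Order.TTheory GRing.Theory Num.Theory.
Import numFieldNormedType.Exports.

Local Open Scope classical_set_scope.
Local Open Scope ring_scope.

(** Below P_n stands for [jacobiP a b n], the polynomial of degree n, a_n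
    for [a n], w_n(x) for the reciprocal of sqrt(n+1) (P_n(x)^2 +
    P_(n+1)(x)^2), J for the difference expression [jacobi_expr a b],
    delta_0 for the first basis vector, and rho for the spectral measure.

    The idea is to compare rho with the explicit probability measures nu_n
    of density f_n = 1 / (pi a_n (P_n^2 + P_(n+1)^2)), which equals w_n /
    pi up to the factor sqrt(n+1) / a_n that tends to 1. Two facts about
    them are combined. The density converges pointwise to W / pi > 0, and
    it is bounded on compact sets uniformly in large n. The measures
    converge to rho in the sense that their Poisson integrals converge to
    that of rho, for every point t + iy of the upper half-plane. Hence the
    Poisson integrals of rho and of W dx / pi coincide, and the Poisson
    integral determines a finite measure, so that rho = W dx / pi.

    Pointwise convergence ([weight_cvg], [weight_bounded]). The quadratic
    form V_n = (a_n + a_(n+1))/2 P_(n+1)^2 + (a_(n+1) + a_(n+2))/2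
    P_(n+2)^2 - x P_(n+1) P_(n+2) is equivalent to sqrt(n+2) (P_(n+1)^2 +
    P_(n+2)^2), and one step of the recurrence changes it by a factor 1 +
    O(eps_n), where eps_n is summable, locally uniformly in x: the
    differences of a_n and the coefficients b_n multiply products of
    neighbouring P_n, and the main term of the increment, of order
    n^(-1/2) (P_(n+1) + P_(n+3))^2, is small because the recurrence makes
    P_(n+1) + P_(n+3) small. So V_n has a positive limit.

    The measures nu_n ([integral_jacobiP_sqr]). The polynomials P_0, ...,
    P_n are orthonormal with respect to nu_n. Indeed P_n^2 + P_(n+1)^2 =
    |G|^2 with G = P_(n+1) + i P_n, a polynomial whose zeros all lie in
    the lower half-plane, and P_j P_k / |G|^2 is the imaginary part of a
    rational function with denominator G, so that its integral is read off
    from the leading coefficient of the numerator.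

    The operator. Since the reciprocals of a_n have an infinite sum
    ([carleman]), the closure of J is its maximal realization ([jacobiE]),
    which is self-adjoint. From the axioms of the spectral measure E alone
    one gets that E(B) commutes with the operator ([jacobi_max_proj]),
    that the squared norm of J w is the second moment of d(E w, w)
    ([second_moment]), and so that d(E v, v) = |x - z|^2 d(E w, w) for v =
    (J - z) w ([resolvent_density]).

    Comparison ([approx_poisson_cvg]). For nonreal z there is a finitely
    supported f with (J - z) f = delta_0 - r and the squared norm of r
    equal to the inverse of |P_0(z)|^2 + ... + |P_M(z)|^2, a sum that
    tends to infinity with M. If r were zero, the integral of |x - z|^(-2)
    against rho, or against any nu_n with n >= M, would be the squared
    norm of f; as it is, both are close to it, hence to each other, with
    an error controlled by r.

    Finally rho is absolutely continuous, and delta_0 is cyclic: a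
    projection E(B) that kills delta_0 kills every basis vector by the
    recurrence ([proj_eq0]). So the whole spectral measure is absolutely
    continuous. *)

(** * Principal values of rational functions *)

Section PrincipalValue.
Context {R : realType}.
Implicit Types (F f g : R -> R[i]) (z c : R[i]).
Local Notation Re := (@complex.Re R).
Local Notation Im := (@complex.Im R).

Definition cderiv F f := forall x : R,
  is_derive x 1 (fun t => Re (F t)) (Re (f x)) /\
  is_derive x 1 (fun t => Im (F t)) (Im (f x)).

(** The principal value of the integral of f over the line, phrased with a
    primitive so that no integrability is required: z is the limit of the
    integrals of f from -n to n. *)
Definition pv f z := exists F, [/\ cderiv F f,
  (fun n : nat => Re (F n%:R) - Re (F (- n%:R))) @ \oo --> Re z &
  (fun n : nat => Im (F n%:R) - Im (F (- n%:R))) @ \oo --> Im z].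

Lemma ReDc z c : Re (z + c) = Re z + Re c. Proof. by case: z c => [a b] []. Qed.
Lemma ImDc z c : Im (z + c) = Im z + Im c. Proof. by case: z c => [a b] []. Qed.
Lemma ReMc z c : Re (z * c) = Re z * Re c - Im z * Im c.
Proof. by case: z c => [a b] []. Qed.
Lemma ImMc z c : Im (z * c) = Re z * Im c + Im z * Re c.
Proof. by case: z c => [a b] []. Qed.
Lemma ReNc z : Re (- z) = - Re z. Proof. by case: z. Qed.
Lemma ImNc z : Im (- z) = - Im z. Proof. by case: z. Qed.

Lemma ReVc z : Re z^-1 = Re z / (Re z ^+ 2 + Im z ^+ 2).
Proof. by case: z. Qed.
Lemma ImVc z : Im z^-1 = - Im z / (Re z ^+ 2 + Im z ^+ 2).
Proof. by case: z => a b; rewrite mulNr. Qed.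

Lemma cderivD F f G g : cderiv F f -> cderiv G g ->
  cderiv (fun x => F x + G x) (fun x => f x + g x).
Proof.
move=> Ff Gg x; have [Fr Fi] := Ff x; have [Gr Gi] := Gg x.
rewrite ReDc ImDc; under eq_fun do rewrite ReDc.
by under [in X in _ /\ X]eq_fun do rewrite ImDc; split; exact: is_deriveD.
Qed.

Lemma cderivM F f G g : cderiv F f -> cderiv G g ->
  cderiv (fun x => F x * G x) (fun x => f x * G x + F x * g x).
Proof.
move=> Ff Gg x; have [Fr Fi] := Ff x; have [Gr Gi] := Gg x.
split.
  under eq_fun do rewrite ReMc.
  apply: is_derive_eq; rewrite ReDc !ReMc /GRing.scale/=; ring.
under eq_fun do rewrite ImMc.
apply: is_derive_eq; rewrite ImDc !ImMc /GRing.scale/=; ring.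
Qed.

Lemma cderivZ c F f : cderiv F f -> cderiv (fun x => c * F x) (fun x => c * f x).
Proof.
move=> Ff x; have [Fr Fi] := Ff x; split.
  under eq_fun do rewrite ReMc.
  apply: is_derive_eq; rewrite ReMc /GRing.scale/=; ring.
under eq_fun do rewrite ImMc.
apply: is_derive_eq; rewrite ImMc /GRing.scale/=; ring.
Qed.

Lemma eq_pv f g z : f =1 g -> pv f z -> pv g z.
Proof. by move/funext ->. Qed.

Lemma cvgr_eqfun (T : Type) (D : set_system T) (f g : T -> R) (l : R) :
  f =1 g -> f @ D --> l -> g @ D --> l.
Proof. by move=> /funext ->. Qed.

Lemma pvD f g z c : pv f z -> pv g c -> pv (fun x => f x + g x) (z + c).
Proof.
move=> [F [Ff Fr Fi]] [G [Gg Gr Gi]]; exists (fun x => F x + G x); split.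
- exact: cderivD.
- rewrite ReDc; refine (cvgr_eqfun _ (cvgD Fr Gr)) => x.
  by rewrite !fctE !ReDc; ring.
- rewrite ImDc; refine (cvgr_eqfun _ (cvgD Fi Gi)) => x.
  by rewrite !fctE !ImDc; ring.
Qed.

Lemma pvZ c f z : pv f z -> pv (fun x => c * f x) (c * z).
Proof.
move=> [F [Ff Fr Fi]]; exists (fun x => c * F x); split.
- exact: cderivZ.
- rewrite ReMc; refine (cvgr_eqfun _ (cvgB (cvgM (cvg_cst (Re c)) Fr) (cvgM (cvg_cst (Im c)) Fi))) => x.
  by rewrite !fctE !ReMc/=; ring.
- rewrite ImMc; refine (cvgr_eqfun _ (cvgD (cvgM (cvg_cst (Re c)) Fi) (cvgM (cvg_cst (Im c)) Fr))) => x.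
  by rewrite !fctE !ImMc/=; ring.
Qed.

Variable z0 : R[i].
Hypothesis z0_lt0 : Im z0 < 0.
Let xi (x : R) := (real_complex R x - z0)^-1.

Lemma Re_real_sub x : Re (real_complex R x - z0) = x - Re z0.
Proof. by case: z0. Qed.
Lemma Im_real_sub x : Im (real_complex R x - z0) = - Im z0.
Proof. by case: z0 => a b /=; rewrite add0r. Qed.

Lemma sqr_dist_gt0 x : 0 < (x - Re z0) ^+ 2 + Im z0 ^+ 2.
Proof. by rewrite ltr_wpDl ?sqr_ge0// exprn_even_gt0//= lt_eqF. Qed.

Lemma real_sub_neq0 x : real_complex R x - z0 != 0.
Proof.
apply/eqP => /(congr1 Im); rewrite Im_real_sub /= => /eqP.
by rewrite oppr_eq0 lt_eqF.
Qed.

Lemma Re_xi x : Re (xi x) = (x - Re z0) / ((x - Re z0) ^+ 2 + Im z0 ^+ 2).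
Proof. by rewrite /xi ReVc Re_real_sub Im_real_sub sqrrN. Qed.
Lemma Im_xi x : Im (xi x) = Im z0 / ((x - Re z0) ^+ 2 + Im z0 ^+ 2).
Proof. by rewrite /xi ImVc Re_real_sub Im_real_sub sqrrN opprK. Qed.

Lemma is_derive_sqr_dist (x : R) : is_derive x 1
  (fun x => (x - Re z0) ^+ 2 + Im z0 ^+ 2) (2 * (x - Re z0)).
Proof.
rewrite (_ : (fun _ => _) = (fun x : R => (x - Re z0) * (x - Re z0) + Im z0 ^+ 2)); last first.
  by apply/funext => y; rewrite expr2.
apply: is_derive_eq; rewrite /GRing.scale/=; ring.
Qed.

Lemma is_derive_sqr_distV (x : R) : is_derive x 1
  (fun x => ((x - Re z0) ^+ 2 + Im z0 ^+ 2)^-1)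
  (- ((x - Re z0) ^+ 2 + Im z0 ^+ 2) ^- 2 * (2 * (x - Re z0))).
Proof.
have := is_derive_sqr_dist x => dq; have qn0 := lt0r_neq0 (sqr_dist_gt0 x).
exact: is_derive_eq.
Qed.

Lemma cderiv_xi : cderiv xi (fun x => - xi x ^+ 2).
Proof.
move=> x; have q0 := sqr_dist_gt0 x; have qn0 := lt0r_neq0 q0.
have dq := is_derive_sqr_distV x.
split.
  under eq_fun do rewrite Re_xi.
  apply: is_derive_eq.
  rewrite ReNc expr2 ReMc Re_xi Im_xi /GRing.scale/=; field; exact: qn0.
under eq_fun do rewrite Im_xi.
apply: is_derive_eq.
rewrite ImNc expr2 ImMc Re_xi Im_xi /GRing.scale/=; field; exact: qn0.
Qed.

Lemma cderiv_xiX k :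
  cderiv (fun x => xi x ^+ k.+1) (fun x => - k.+1%:R * xi x ^+ k.+2).
Proof.
elim: k => [|k IH].
  rewrite (_ : (fun _ => _) = xi); last by apply/funext => x; rewrite expr1.
  rewrite [X in cderiv _ X](_ : _ = (fun x => - xi x ^+ 2)); first exact: cderiv_xi.
  by apply/funext => x; rewrite mulN1r.
have := cderivM cderiv_xi IH.
rewrite (_ : (fun x => _ * _) = (fun x => xi x ^+ k.+2)); last first.
  by apply/funext => x; rewrite [RHS]exprS.
rewrite [X in cderiv _ X -> _](_ : _ = (fun x => - k.+2%:R * xi x ^+ k.+3))//.
apply/funext => x; rewrite !exprS -[k.+2%:R]natr1; ring.
Qed.

Definition null_seq (u : nat -> R[i]) :=
  ((fun n => Re (u n)) @ \oo --> (0 : R)) /\ ((fun n => Im (u n)) @ \oo --> (0 : R)).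

Lemma null_seqM u v : null_seq u -> null_seq v -> null_seq (fun n => u n * v n).
Proof.
move=> [ur ui] [vr vi]; split.
  have -> : 0 = 0 * 0 - 0 * 0 :> R by rewrite mulr0 subrr.
  by under eq_fun do rewrite ReMc; apply: cvgB; apply: cvgM.
have -> : 0 = 0 * 0 + 0 * 0 :> R by rewrite mulr0 addr0.
by under eq_fun do rewrite ImMc; apply: cvgD; apply: cvgM.
Qed.

(** The bound |xi(h)|^2 <= |h - Re z0|^(-2) does the work. *)
Lemma null_seq_xi (h : nat -> R) : (fun n => `|h n - Re z0|) @ \oo --> +oo ->
  null_seq (fun n => xi (h n)).
Proof.
move=> /cvgryPge hoo.
have key (n : nat) e : 0 < e -> e^-1 <= `|h n - Re z0| ->
   `|Re (xi (h n))| <= e /\ `|Im (xi (h n))| <= e.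
  move=> e0 en; have q0 := sqr_dist_gt0 (h n).
  have bnd : Re (xi (h n)) ^+ 2 + Im (xi (h n)) ^+ 2 <= e ^+ 2.
    rewrite Re_xi Im_xi.
    rewrite (_ : _ + _ = ((h n - Re z0) ^+ 2 + Im z0 ^+ 2)^-1); last first.
      by field; exact: lt0r_neq0.
    rewrite -[leRHS]invrK lef_pV2 ?posrE ?invr_gt0 ?exprn_gt0//.
    rewrite -exprVn (@le_trans _ _ ((h n - Re z0) ^+ 2))// ?lerDl ?sqr_ge0//.
    rewrite -(real_normK (num_real (h n - Re z0))).
    by rewrite lerXn2r ?nnegrE ?invr_ge0// ltW.
  split; rewrite -(@ler_pXn2r _ 2) ?nnegrE ?(ltW e0)// real_normK ?num_real//;
    by apply: le_trans bnd; rewrite ?lerDl ?lerDr sqr_ge0.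
split; apply/cvgr0Pnorm_le => e e0; near=> n.
  have /(key n e e0)[] // : e^-1 <= `|h n - Re z0| by near: n; exact: hoo.
have /(key n e e0)[] // : e^-1 <= `|h n - Re z0| by near: n; exact: hoo.
Unshelve. all: end_near. Qed.

Lemma norm_natD_cvgy (t : R) : (fun n : nat => `|n%:R + t|) @ \oo --> +oo.
Proof.
apply/cvgryPge => A; near=> n; apply: le_trans (ler_norm _).
by rewrite -lerBlDr; near: n; exact: nbhs_infty_ger.
Unshelve. all: end_near. Qed.

Lemma null_seq_xi_nat : null_seq (fun n => xi n%:R).
Proof. exact/null_seq_xi/norm_natD_cvgy. Qed.

Lemma null_seq_xi_natN : null_seq (fun n => xi (- n%:R)).
Proof.
apply: null_seq_xi; under eq_fun do rewrite -opprD normrN.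
exact: norm_natD_cvgy.
Qed.

Lemma null_seqX u k : null_seq u -> null_seq (fun n => u n ^+ k.+1).
Proof.
move=> u0; elim: k => [|k IH]; first by under eq_fun do rewrite expr1.
by under eq_fun do rewrite exprS; exact: null_seqM.
Qed.

(** A power at least 2 of the kernel has a primitive that vanishes at
    infinity. *)
Lemma pv_xiX k : pv (fun x => xi x ^+ k.+2) 0.
Proof.
have kn0 : k.+1%:R != 0 :> R[i] by rewrite pnatr_eq0.
have [lr li] := null_seqX k null_seq_xi_nat; have [nr ni] := null_seqX k null_seq_xi_natN.
have H : pv (fun x => - k.+1%:R * xi x ^+ k.+2) 0.
  exists (fun x => xi x ^+ k.+1); split; first exact: cderiv_xiX.
    have -> : Re 0 = 0 - 0 by rewrite subr0.
    exact: (cvgB lr nr).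
  have -> : Im 0 = 0 - 0 by rewrite subr0.
  exact: (cvgB li ni).
have := pvZ (- k.+1%:R^-1) H; rewrite mulr0; apply: eq_pv => x.
by rewrite mulrA mulrNN mulVf ?mul1r.
Qed.

Lemma cvg_atan_aff (t c : R) : 0 < c ->
  (fun n : nat => atan ((n%:R + t) * c)) @ \oo --> pi / 2.
Proof.
move=> c_gt0; apply: (@cvg_comp _ _ _ (fun n : nat => (n%:R + t) * c) (@atan R) \oo +oo); last exact: cvgy_atan.
apply/cvgryPge => A; near=> n.
rewrite -ler_pdivrMr// -lerBlDr; near: n; exact: nbhs_infty_ger.
Unshelve. all: end_near. Qed.

(** The primitive is a branch of the logarithm of x - z0. Its real part is
    even at infinity and drops out; its imaginary part is an arctangent,
    decreasing by pi from one end of the line to the other since Im z0 <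
    0. *)
Lemma pv_xi : pv xi (Complex 0 (- pi)).
Proof.
pose L (x : R) := 2^-1 * ln ((x - Re z0) ^+ 2 + Im z0 ^+ 2).
pose A (x : R) := atan ((x - Re z0) / Im z0).
exists (fun x => Complex (L x) (A x)); split => /=.
- move=> x; have q0 := sqr_dist_gt0 x; have qn0 := lt0r_neq0 q0.
  have dq := is_derive_sqr_dist x; split => /=.
    apply: is_derive_eq.
      apply: is_deriveM; apply: is_derive1_comp; exact: is_derive1_ln.
    by rewrite Re_xi /GRing.scale/=; field.
  rewrite /A.
  apply: is_derive_eq.
  have zn0 : Im z0 != 0 by rewrite lt_eqF.
  rewrite Im_xi /GRing.scale/=; field.
  by rewrite qn0 zn0.
(* The quotient q n of the values at n and -n of |x - z0|^2, written with
   xi(-n) so that its limit 1 is visible. *)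
- pose q (n : nat) := 1 + 4 * Re z0 * Re (xi (- n%:R)) + 4 * Re z0 ^+ 2 / Im z0 * Im (xi (- n%:R)).
  have qE n : ((n%:R - Re z0) ^+ 2 + Im z0 ^+ 2) / ((- n%:R - Re z0) ^+ 2 + Im z0 ^+ 2) = q n.
    have q0 := lt0r_neq0 (sqr_dist_gt0 (- n%:R)).
    rewrite /q Re_xi Im_xi; field.
    by rewrite q0 lt_eqF.
  rewrite (_ : (fun _ => _) = (fun n => 2^-1 * ln (q n))); last first.
    apply/funext => n; rewrite -qE lnM ?posrE ?invr_gt0 ?sqr_dist_gt0//.
    by rewrite lnV ?posrE ?sqr_dist_gt0// /L; ring.
  have [nr ni] := null_seq_xi_natN.
  have q1 : q @ \oo --> (1 : R).
    rewrite -[X in _ --> X](_ : 1 + 4 * Re z0 * 0 + 4 * Re z0 ^+ 2 / Im z0 * 0 = _); last by rewrite !mulr0 !addr0.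
    apply: cvgD; last by apply: cvgM => //; exact: cvg_cst.
    apply: cvgD; [exact: cvg_cst|by apply: cvgM => //; exact: cvg_cst].
  rewrite -[X in _ --> X](_ : 2^-1 * ln 1 = _); last by rewrite ln1 mulr0.
  apply: cvgM; first exact: cvg_cst.
  by apply: continuous_cvg => //; exact: continuous_ln.
- have Ni : 0 < - (Im z0)^-1 by rewrite oppr_gt0 invr_lt0.
  have h1 := cvg_atan_aff (- Re z0) Ni; have h2 := cvg_atan_aff (Re z0) Ni.
  have -> : - pi = - (pi / 2 + pi / 2) :> R by rewrite -splitr.
  refine (cvgr_eqfun _ (cvgN (cvgD h1 h2))) => n.
  rewrite !fctE/= mulrN atanN /A opprD opprK; congr (_ - _).
  by congr atan; ring.
Qed.

End PrincipalValue.

(** * Partial fractions *)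

Section PartialFractions.
Context {R : realType}.
Local Notation Im := (@complex.Im R).
Implicit Types (s : seq R[i]) (N : {poly R[i]}).

Definition prodV s (x : R) : R[i] := \prod_(z <- s) (real_complex R x - z)^-1.

Lemma perm_prodV s t : perm_eq s t -> prodV s =1 prodV t.
Proof. by move=> st x; exact: perm_big. Qed.

Lemma pv0 : pv (fun _ : R => 0) 0.
Proof.
exists (fun=> 0); split => [x||].
- by split; exact: is_derive_cst.
- by rewrite subrr; exact: cvg_cst.
- by rewrite subrr; exact: cvg_cst.
Qed.

(** Only a single simple factor contributes, as the other products decay
    faster than 1/x. Two distinct factors are split by partial fractions,
    which lowers the number of factors; a product of equal factors is a
    power of the kernel. *)
Lemma pv_prodV s : (0 < size s)%N -> all (fun z => Im z < 0) s ->
  pv (prodV s) (if size s == 1%N then Complex 0 (- pi) else 0).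
Proof.
have [n] := ubnP (size s); elim: n => // n IH in s *.
case: s => [//|z s] /=; rewrite !ltnS => sn _ /andP[z0 s0].
have [zs|/allPn[w ws wz]] := boolP (all (pred1 z) s).
  have E : prodV (z :: s) =1 fun x => (real_complex R x - z)^-1 ^+ (size s).+1.
    move=> x; rewrite /prodV big_cons exprS; congr (_ * _).
    elim: s zs {s0 sn} => [|w s IHs] /=; first by rewrite big_nil expr0.
    by move=> /andP[/eqP -> zs]; rewrite big_cons exprS IHs.
  case: s {zs s0 sn} E => [|w s] /= E.
    apply: (eq_pv (fun x => esym (E x))).
    by under [in pv _]eq_fun do rewrite expr1; exact: pv_xi.
  by apply: (eq_pv (fun x => esym (E x))); exact: pv_xiX.
have wz0 : z - w != 0 by rewrite subr_eq0 eq_sym; apply: contraNneq wz => ->/=.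
have pe : perm_eq (z :: s) [:: z, w & rem w s].
  by rewrite perm_cons perm_to_rem.
have szs : (size s = (size (rem w s)).+1)%N.
  by rewrite size_rem// prednK//; case: (s) ws.
have w0 := allP s0 _ ws.
have r0 : all (fun z => Im z < 0) (rem w s).
  by apply/allP => u /mem_rem us; exact: (allP s0).
have E : prodV (z :: s) =1 fun x =>
    (z - w)^-1 * (prodV (z :: rem w s) x + (-1) * prodV (w :: rem w s) x).
  move=> x; rewrite (perm_prodV pe) /prodV !big_cons.
  have nz := real_sub_neq0 z0 x; have nw := real_sub_neq0 w0 x.
  by field; rewrite wz0 nz nw.
apply: (eq_pv (fun x => esym (E x))).
have H u : Im u < 0 -> pv (prodV (u :: rem w s))
    (if size s == 1%N then Complex 0 (- pi) else 0).
  by move=> u0; rewrite szs; apply: IH => /=; rewrite ?u0// -szs.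
have := pvZ (z - w)^-1 (pvD (H z z0) (pvZ (-1) (H w w0))).
rewrite mulN1r subrr mulr0.
by case: s ws {szs sn s0 pe r0 E H} => // a s; rewrite /= eqSS.
Qed.

(** The principal value only sees the coefficient of 1/x at infinity,
    which is the coefficient of order |s| - 1 in the numerator. The
    induction divides the numerator by X - z, with z the first root. *)
Lemma pv_frac s N : all (fun z => Im z < 0) s -> (size N <= size s)%N ->
  pv (fun x => N.[real_complex R x] * prodV s x)
     (Complex 0 (- pi) * N`_(size s).-1).
Proof.
elim: s N => [|z s IH] N /=.
  move=> _; rewrite leqn0 size_poly_eq0 => /eqP ->; rewrite coef0 mulr0.
  by apply: eq_pv pv0 => x; rewrite horner0 mul0r.
move=> /andP[z0 s0] sN.
have /factor_theorem[q qE] : root (N - N.[z]%:P) z.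
  by rewrite /root hornerD hornerN hornerC subrr.
have NE : N = q * ('X - z%:P) + N.[z]%:P by rewrite -qE subrK.
have sq : (size q <= size s)%N.
  have [->|q0] := eqVneq q 0; first by rewrite size_poly0.
  have sqN : ((size q).+1 <= maxn (size N) 1)%N.
    have -> : (size q).+1 = size (N - N.[z]%:P).
      by rewrite qE size_Mmonic ?monicXsubC// size_XsubC addn2.
    apply: leq_trans (size_polyD _ _) _; rewrite size_polyN geq_max leq_maxl/=.
    exact: leq_trans (size_polyC_leq1 _) (leq_maxr _ _).
  have := q0; rewrite -size_poly_gt0 => q1.
  move: sqN; rewrite leq_max => /orP[qN|]; last by rewrite ltnS leqNgt q1.
  by rewrite -ltnS; exact: leq_trans qN sN.
have E x : N.[real_complex R x] * prodV (z :: s) x =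
    q.[real_complex R x] * prodV s x + N.[z] * prodV (z :: s) x.
  rewrite [in LHS]NE hornerD hornerM hornerC hornerXsubC /prodV big_cons.
  by have nz := real_sub_neq0 z0 x; field.
apply: (eq_pv (fun x => esym (E x))).
have h : pv (prodV (z :: s)) (if (size s).+1 == 1%N then Complex 0 (- pi) else 0).
  by apply: pv_prodV => //=; rewrite z0.
have := pvD (IH q s0 sq) (pvZ N.[z] h).
case: s IH s0 sN sq E h => [|w s] /= IH s0 sN sq E h.
  move: sq; rewrite leqn0 size_poly_eq0 => /eqP q0.
  rewrite q0 coef0 mulr0 add0r mulrC.
  by rewrite [in N`_0]NE q0 mul0r add0r coefC.
by rewrite mulr0 addr0 [in N`_ _]NE coefD coefC addr0 mulrBr coefB coefMX coefMC/=
  (nth_default 0 sq) mul0r subr0.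
Qed.

End PartialFractions.

(** * Jacobi polynomials and their orthogonality on the line *)

Section JacobiPolynomials.
Context {R : realType}.
Variables a b : nat -> R.
Hypothesis a_gt0 : forall n, 0 < a n.
Local Notation Im := (@complex.Im R).
Local Notation "x %:C" := (real_complex R x).

Let an0 n : a n != 0. Proof. exact: lt0r_neq0. Qed.

(** [jacobiP] as formal polynomials, needed for evaluation at complex
    points. *)
Fixpoint jpoly (n : nat) : {poly R} :=
  match n with
  | 0 => 1
  | 1 => (a 0)^-1 *: ('X - (b 0)%:P)
  | (m.+1 as k).+1 =>
      (a k)^-1 *: (('X - (b k)%:P) * jpoly k - a m *: jpoly m)
  end.

Lemma jpolySS n : jpoly n.+2 =
  (a n.+1)^-1 *: (('X - (b n.+1)%:P) * jpoly n.+1 - a n *: jpoly n).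
Proof. by []. Qed.

Lemma nat_ind2 (P : nat -> Prop) : P 0%N -> P 1%N ->
  (forall n, P n -> P n.+1 -> P n.+2) -> forall n, P n.
Proof.
move=> P0 P1 PS n; suff [] : P n /\ P n.+1 by [].
by elim: n => // n [Pn Pn1]; split => //; exact: PS.
Qed.

Lemma horner_jpoly n x : (jpoly n).[x] = jacobiP a b n x.
Proof.
elim/nat_ind2: n => [||n IH IH1]; first by rewrite hornerC.
  by rewrite hornerZ hornerXsubC mulrC.
by rewrite jpolySS !(hornerZ, hornerD, hornerN, hornerM, hornerX, hornerC) IH IH1 mulrC.
Qed.

Definition jpolyC n : {poly R[i]} := map_poly (real_complex R) (jpoly n).

Lemma jpolyCSS n : (a n.+1)%:C *: jpolyC n.+2 =
  ('X - ((b n.+1)%:C)%:P) * jpolyC n.+1 - (a n)%:C *: jpolyC n.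
Proof.
rewrite /jpolyC jpolySS map_polyZ rmorphB rmorphM rmorphB/= map_polyX map_polyC map_polyZ/=.
by rewrite scalerA -rmorphM divff// rmorph1 scale1r.
Qed.

Lemma horner_jpolyC n x : (jpolyC n).[x%:C] = (jacobiP a b n x)%:C.
Proof. by rewrite horner_map/= horner_jpoly. Qed.

Lemma jacobi_expr_jpolyC z n :
  jacobi_expr a b (fun k => (jpolyC k).[z]) n = z * (jpolyC n).[z].
Proof.
have aC k : (a k)%:C != 0 by apply: contra_neq (an0 k) => /complexI.
case: n => [|n]; rewrite /jacobi_expr.
  rewrite add0r /jpolyC/= rmorph1 hornerC map_polyZ rmorphB/= map_polyX map_polyC.
  rewrite hornerZ hornerXsubC fmorphV/=.
  by field; exact: aC.
have := congr1 (fun p => p.[z]) (jpolyCSS n).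
rewrite !(hornerZ, hornerD, hornerN, hornerM, hornerX, hornerC) => ->.
ring.
Qed.

Lemma sqmodM (x y : R[i]) : sqmod (x * y) = sqmod x * sqmod y.
Proof. by rewrite /sqmod ReMc ImMc; ring. Qed.

Lemma sqmod_eq0 (x : R[i]) : (sqmod x == 0) = (x == 0).
Proof.
case: x => u v; rewrite /sqmod/= paddr_eq0 ?sqr_ge0// !sqrf_eq0.
by apply/idP/eqP => [/andP[/eqP -> /eqP ->]//|[-> ->]]; rewrite eqxx.
Qed.

Lemma sqmodJ (x : R[i]) : sqmod (conjc x) = sqmod x.
Proof. by case: x => u v; rewrite /sqmod/= sqrrN. Qed.

(** Each step of the recurrence adds the term Im z |u_n|^2 to the
    Wronskian of u and its conjugate. *)
Lemma jacobi_wronskian z (u : nat -> R[i]) :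
  (forall n, jacobi_expr a b u n = z * u n) -> forall n,
  Im z * \sum_(k < n.+1) sqmod (u k) = a n * Im (u n.+1 * conjc (u n)).
Proof.
move=> uE; elim=> [|n IH].
  rewrite big_ord1; have := uE 0%N; rewrite /jacobi_expr add0r => E.
  have : (a 0)%:C * u 1%N = (z - (b 0)%:C) * u 0%N by rewrite mulrBl -E; ring.
  move=> /(congr1 (fun w => Im (w * conjc (u 0%N)))).
  case: (u 1%N) (u 0%N) z {uE E} => [p q] [r s] [t y]/=; rewrite /sqmod/= => E.
  apply: etrans (_ : (a 0 * p - 0 * q) * - s + (a 0 * q + 0 * p) * r = _); last by ring.
  by rewrite E; ring.
rewrite big_ord_recr/= mulrDr IH.
have := uE n.+1; rewrite /jacobi_expr => E.
have : (a n.+1)%:C * u n.+2 = (z - (b n.+1)%:C) * u n.+1 - (a n)%:C * u n.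
  by rewrite mulrBl -E; ring.
move=> /(congr1 (fun w => Im (w * conjc (u n.+1)))).
case: (u n.+2) (u n.+1) (u n) z {uE E IH} => [p' q'] [p q] [r s] [t y]/=; rewrite /sqmod/= => E.
apply: etrans (_ : (a n.+1 * p' - 0 * q') * - q + (a n.+1 * q' + 0 * p') * p = _); last by ring.
by rewrite E; ring.
Qed.

Lemma jpolyC0 : jpolyC 0 = 1. Proof. by rewrite /jpolyC rmorph1. Qed.

(** Two consecutive zeros would propagate down to P_0 = 1. *)
Lemma jacobi_consecutive_zeros z n :
  (jpolyC n).[z] = 0 -> (jpolyC n.+1).[z] <> 0.
Proof.
elim: n => [|n IH]; first by rewrite jpolyC0 hornerC => /eqP; rewrite oner_eq0.
move=> n1 n2; apply: IH => //; have := jacobi_expr_jpolyC z n.+1.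
rewrite /jacobi_expr n1 n2 !mulr0 !addr0 => /eqP.
rewrite mulf_eq0 => /orP[|/eqP//] /eqP/complexI/eqP; by rewrite (negbTE (an0 n)).
Qed.

Variable n : nat.

(** On the real line its squared modulus is P_n^2 + P_(n+1)^2. *)
Definition boundary_poly : {poly R[i]} := jpolyC n.+1 + ('i)%C *: jpolyC n.

(** At a zero, P_(n+1) = - i P_n, and [jacobi_wronskian] turns this into
    Im z (|P_0|^2 + ... + |P_n|^2) = - a_n |P_n|^2. *)
Lemma boundary_poly_root z : root boundary_poly z -> Im z < 0.
Proof.
rewrite /root hornerD hornerZ addr_eq0 => /eqP G0.
have W := jacobi_wronskian (jacobi_expr_jpolyC z) n.
have n0 : (jpolyC n).[z] != 0.
  apply/eqP => n0; apply: (jacobi_consecutive_zeros n0).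
  by rewrite G0 n0 mulr0 oppr0.
have s0 : 0 < \sum_(k < n.+1) sqmod (jpolyC k).[z].
  rewrite big_ord_recr/=; apply: ltr_wpDl.
    by apply: sumr_ge0 => k _; exact: sqmod_ge0.
  by rewrite lt0r sqmod_eq0 n0 sqmod_ge0.
rewrite -(pmulr_llt0 _ s0) W pmulr_rlt0// G0.
have : 0 < sqmod (jpolyC n).[z] by rewrite lt0r sqmod_eq0 n0 sqmod_ge0.
rewrite /sqmod; case: (jpolyC n).[z] => u v /=; rewrite -oppr_lt0.
by congr (_ < _); ring.
Qed.

(** The solution of the recurrence run downwards from the index n + 1,
    with values - i at n + 1 and 1 at n; [backward i] is its value at n +
    1 - i, a polynomial of degree i - 1 for i > 0. *)
Fixpoint backward (i : nat) : {poly R[i]} :=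
  match i with
  | 0 => (- 'i%C)%:P
  | 1 => 1
  | (j.+1 as k).+1 => (a (n - k)%N)%:C^-1 *:
     (('X - ((b (n - j)%N)%:C)%:P) * backward k - (a (n - j)%N)%:C *: backward j)
  end.

Lemma backwardSS i : backward i.+2 = (a (n - i.+1)%N)%:C^-1 *:
  (('X - ((b (n - i)%N)%:C)%:P) * backward i.+1 - (a (n - i)%N)%:C *: backward i).
Proof. by []. Qed.

Definition sqden (x : R) := jacobiP a b n x ^+ 2 + jacobiP a b n.+1 x ^+ 2.

Lemma sqden_gt0 x : 0 < sqden x.
Proof.
rewrite lt0r addr_ge0 ?sqr_ge0// andbT /sqden paddr_eq0 ?sqr_ge0// !sqrf_eq0.
apply/negP => /andP[/eqP n0 /eqP n1].
by apply: (@jacobi_consecutive_zeros x%:C n); rewrite horner_jpolyC ?n0 ?n1.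
Qed.

Lemma horner_boundary_poly x : boundary_poly.[x%:C] =
  Complex (jacobiP a b n.+1 x) (jacobiP a b n x).
Proof.
rewrite hornerD hornerZ !horner_jpolyC.
by apply/eqP; rewrite eq_complex/=; apply/andP; split; apply/eqP; ring.
Qed.

Lemma jacobiP_SS m x : a m.+1 * jacobiP a b m.+2 x =
  (x - b m.+1) * jacobiP a b m.+1 x - a m * jacobiP a b m x.
Proof. by rewrite /= mulrC divfK. Qed.

(** The initial values - i and 1 are such that the claim holds at the two
    top indices, and both sides satisfy the same recurrence at real
    points. Dividing by |G|^2 exhibits P_k / |G|^2 as minus the imaginary
    part of S_k / G, where G is [boundary_poly] and S_k the value of
    [backward] at the index k. *)
Lemma Im_backward i x : (i <= n.+1)%N ->
  Im ((backward i).[x%:C] * conjc boundary_poly.[x%:C]) = - jacobiP a b (n.+1 - i)%N x.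
Proof.
rewrite horner_boundary_poly.
elim/nat_ind2: i => [_|_|i IH IH1 ilt].
- by rewrite hornerC subn0 /=; ring.
- by rewrite hornerC subn1 /=; ring.
have := IH (ltnW (ltnW ilt)); have := IH1 (ltnW ilt).
have [k kE] : exists k, n = (k + i.+1)%N by exists (n - i.+1)%N; rewrite subnK.
have -> : (n.+1 - i = k.+2)%N by rewrite kE; lia.
have -> : (n.+1 - i.+1 = k.+1)%N by rewrite kE; lia.
have -> : (n.+1 - i.+2 = k)%N by rewrite kE; lia.
rewrite backwardSS.
have -> : (n - i = k.+1)%N by rewrite kE; lia.
have -> : (n - i.+1 = k)%N by rewrite kE; lia.
rewrite !(hornerZ, hornerD, hornerN, hornerM, hornerX, hornerC).
have := jacobiP_SS k x.
move: (backward i.+1).[_] (backward i).[_] => z1 z0.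
move: (jacobiP a b k.+2 x) (jacobiP a b k.+1 x) (jacobiP a b k x) => P2 P1 P0 PE.
move: (conjc (Complex _ _)) => w E1 E0.
have -> : (a k)%:C^-1 * ((x%:C - (b k.+1)%:C) * z1 - (a k.+1)%:C * z0) * w =
  (a k)^-1%:C * ((x - b k.+1)%:C * (z1 * w) - (a k.+1)%:C * (z0 * w)).
  rewrite fmorphV rmorphB/=; ring.
have ImZ (c : R) (z : R[i]) : Im (c%:C * z) = c * Im z.
  by rewrite ImMc /= mul0r addr0.
rewrite ImZ ImDc ImNc !ImZ E0 E1; apply: (mulfI (an0 k)).
rewrite mulrA divff// mul1r !mulrN PE; ring.
Qed.

Definition rpv (f : R -> R) (l : R) := exists F : R -> R,
  (forall x : R, is_derive x 1 F (f x)) /\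
  (fun n : nat => F n%:R - F (- n%:R)) @ \oo --> l.

Lemma eq_rpv f g l : f =1 g -> rpv f l -> rpv g l.
Proof. by move=> /funext ->. Qed.

Lemma rpvD f g l m : rpv f l -> rpv g m -> rpv (fun x => f x + g x) (l + m).
Proof.
move=> [F [Ff Fl]] [G [Gg Gm]]; exists (fun x => F x + G x); split => [x|].
  exact: is_deriveD.
by refine (cvgr_eqfun _ (cvgD Fl Gm)) => k; rewrite !fctE/=; ring.
Qed.

Lemma rpvZ c f l : rpv f l -> rpv (fun x => c * f x) (c * l).
Proof.
move=> [F [Ff Fl]]; exists (fun x => c * F x); split => [x|].
  by have := Ff x => {}Ff; apply: is_derive_eq; rewrite /GRing.scale/=; ring.
by refine (cvgr_eqfun _ (cvgM (cvg_cst c) Fl)) => k; rewrite ?fctE/=; ring.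
Qed.

Lemma rpv_sum (I : Type) (r : seq I) (f : I -> R -> R) (l : I -> R) :
  (forall i, rpv (f i) (l i)) ->
  rpv (fun x => \sum_(i <- r) f i x) (\sum_(i <- r) l i).
Proof.
move=> fl; elim: r => [|i r IH].
  rewrite big_nil; apply: (@eq_rpv (fun=> 0)) => [x|]; first by rewrite big_nil.
  by exists (fun=> 0); split => [x|]; [exact: is_derive_cst|rewrite subrr; exact: cvg_cst].
rewrite big_cons; apply: (@eq_rpv (fun x => f i x + \sum_(j <- r) f j x)).
  by move=> x; rewrite big_cons.
exact: rpvD.
Qed.

Lemma size_lead_step (p q : {poly R[i]}) (u v w : R[i]) k :
  w != 0 -> size p = k.+1 -> (size q <= k.+1)%N ->
  size (w *: (('X - u%:P) * p - v *: q)) = k.+2 /\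
  lead_coef (w *: (('X - u%:P) * p - v *: q)) = w * lead_coef p.
Proof.
move=> w0 sp sq.
have p0 : p != 0 by rewrite -size_poly_gt0 sp.
have sX : size (('X - u%:P) * p) = k.+2.
  by rewrite size_monicM ?monicXsubC// size_XsubC sp.
have lt : (size (- (v *: q))%R < size (('X - u%:P) * p)%R)%N.
  by rewrite sX size_polyN (leq_ltn_trans (size_scale_leq _ _))// ltnS.
split; first by rewrite size_scale// size_polyDl.
by rewrite lead_coefZ lead_coefDl// lead_coefM lead_coefXsubC mul1r.
Qed.

Lemma aC_neq0 k : (a k)%:C != 0.
Proof. by apply: contra_neq (an0 k) => /complexI. Qed.

Lemma jpolyC1 : jpolyC 1 = (a 0)%:C^-1 *: (('X - ((b 0)%:C)%:P) * jpolyC 0 - 0 *: 0).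
Proof.
by rewrite scale0r subr0 jpolyC0 mulr1 /jpolyC map_polyZ rmorphB/= map_polyX map_polyC/= fmorphV.
Qed.

Lemma jpolyCSSV k : jpolyC k.+2 = (a k.+1)%:C^-1 *:
  (('X - ((b k.+1)%:C)%:P) * jpolyC k.+1 - (a k)%:C *: jpolyC k).
Proof. by rewrite -jpolyCSS scalerA mulVf ?scale1r// aC_neq0. Qed.

Lemma size_jpolyC k : size (jpolyC k) = k.+1.
Proof.
elim/nat_ind2: k => [||k IH IH1]; first by rewrite jpolyC0 size_poly1.
  rewrite jpolyC1; have /(_ _ _ _)[]// := @size_lead_step (jpolyC 0) 0 ((b 0)%:C) 0 (a 0)%:C^-1 0.
  - by rewrite invr_eq0 aC_neq0.
  - by rewrite jpolyC0 size_poly1.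
  - by rewrite size_poly0.
rewrite jpolyCSSV; have /(_ _ _ _)[]// :=
  @size_lead_step (jpolyC k.+1) (jpolyC k) ((b k.+1)%:C) (a k)%:C (a k.+1)%:C^-1 k.+1.
- by rewrite invr_eq0 aC_neq0.
- by rewrite IH.
Qed.

Lemma lead_coef_jpolyCS k :
  lead_coef (jpolyC k.+1) = (a k)%:C^-1 * lead_coef (jpolyC k).
Proof.
have w0 j : (a j)%:C^-1 != 0 by rewrite invr_eq0 aC_neq0.
case: k => [|k].
  by rewrite jpolyC1; have [] // := @size_lead_step (jpolyC 0) 0 ((b 0)%:C) 0 (a 0)%:C^-1 0 (w0 _) (size_jpolyC 0) (leq_trans (eq_leq (size_poly0 _)) (leq0n 1)).
rewrite jpolyCSSV.
by have [] := @size_lead_step (jpolyC k.+1) (jpolyC k) ((b k.+1)%:C) (a k)%:C (a k.+1)%:C^-1 k.+1 (w0 _) (size_jpolyC _) (leq_trans (eq_leq (size_jpolyC _)) (leqnSn _)).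
Qed.

(** Both recurrences divide by one a_k per step, so the leading
    coefficient of [backward] at the index k completes that of P_k to that
    of P_n. *)
Lemma backward_size_lead i : (i <= n)%N -> size (backward i.+1) = i.+1 /\
  lead_coef (backward i.+1) * lead_coef (jpolyC (n - i)) = lead_coef (jpolyC n).
Proof.
have w0 j : (a j)%:C^-1 != 0 by rewrite invr_eq0 aC_neq0.
elim/nat_ind2: i => [|n0|i IH IH1 ilt].
- by rewrite /= size_poly1 lead_coef1 mul1r subn0.
- have sB : size (backward 1) = 1%N by rewrite /= size_poly1.
  have [-> ->] := @size_lead_step (backward 1) (backward 0) ((b (n - 0)%N)%:C) (a (n - 0)%N)%:C (a (n - 1)%N)%:C^-1 0 (w0 _) sB (size_polyC_leq1 _).
  split => //; have -> : n = (n - 1).+1 by rewrite subn1 prednK.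
  by rewrite lead_coef_jpolyCS subn1/= lead_coef1 mulr1.
have [s0 _] := IH (ltnW (ltnW ilt)); have [s1 l1] := IH1 (ltnW ilt).
rewrite backwardSS.
have [-> ->] := @size_lead_step (backward i.+2) (backward i.+1) ((b (n - i.+1)%N)%:C) (a (n - i.+1)%N)%:C (a (n - i.+2)%N)%:C^-1 i.+1 (w0 _) s1 (leq_trans (eq_leq s0) (leqnSn _)).
split => //; rewrite -l1.
have -> : (n - i.+1 = (n - i.+2).+1)%N by lia.
by rewrite lead_coef_jpolyCS; ring.
Qed.

Lemma boundary_poly_size_lead : size boundary_poly = n.+2 /\
  lead_coef boundary_poly = (a n)%:C^-1 * lead_coef (jpolyC n).
Proof.
have lt : (size ('i%C *: jpolyC n) < size (jpolyC n.+1))%N.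
  by rewrite (leq_ltn_trans (size_scale_leq _ _))// !size_jpolyC.
by rewrite /boundary_poly size_polyDl// lead_coefDl// lead_coef_jpolyCS size_jpolyC.
Qed.

(** For j <= k the integrand is the imaginary part of - P_j S_k / G, see
    [Im_backward]. The numerator has degree j + n - k, which is n, one
    less than the degree of G, exactly when j = k; then [pv_frac] gives pi
    times the quotient of the leading coefficients, which is a_n. *)
Lemma rpv_jacobiP_mul j k : (j <= k <= n)%N ->
  rpv (fun x => jacobiP a b j x * jacobiP a b k x / sqden x)
      (pi * a n *+ (j == k)).
Proof.
move=> /andP[jk kn].
have [s sE] := closed_field_poly_normal boundary_poly.
have [sG lG] := boundary_poly_size_lead.
set L := lead_coef boundary_poly in sE lG.
have L0 : L != 0 by rewrite lead_coef_eq0 -size_poly_gt0 sG.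
have ss : size s = n.+1.
  by apply: succn_inj; rewrite -(size_prod_XsubC s id) -(size_scale _ L0) -sE sG.
have s0 : all (fun z => Im z < 0) s.
  apply/allP => z zs; apply: boundary_poly_root.
  by rewrite sE rootZ// root_prod_XsubC.
pose i := (n - k)%N.
have [sB lB] := @backward_size_lead i (leq_subr _ _).
rewrite subKn// in lB.
pose N := jpolyC j * backward i.+1.
have sN : size N = (j + i).+1.
  by rewrite size_mul -?size_poly_gt0 ?size_jpolyC ?sB// addSn addnS.
have sNn : (size N <= size s)%N by rewrite sN ss /i; lia.
have [F [Fd Fr Fi]] := pvZ L^-1 (pv_frac s0 sNn).
have -> : pi * a n *+ (j == k) = - Im (L^-1 * (Complex 0 (- pi) * N`_(size s).-1)).
  rewrite ss/=; case: eqVneq => [jkE|jkn].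
    have -> : N`_n = lead_coef N by rewrite /lead_coef sN/= jkE subnKC.
    rewrite lead_coefM jkE [_ (jpolyC _) * _]mulrC lB lG invfM invrK.
    have l0 : lead_coef (jpolyC n) != 0.
      by rewrite lead_coef_eq0 -size_poly_gt0 size_jpolyC.
    rewrite mulrACA mulVf// mulr1.
    by rewrite mulr1n ImMc/=; ring.
  have jlk : (j < k)%N by rewrite ltn_neqAle jkn.
  have -> : N`_n = 0 by rewrite nth_default// sN /i; lia.
  by rewrite !mulr0/= oppr0 mulr0n.
exists (fun x => - Im (F x)); split => [x|].
  have [_ d] := Fd x.
  apply: (is_derive_eq (is_deriveN d)).
  have d0 := sqden_gt0 x.
  have gE : L^-1 * (N.[x%:C] * prodV s x) = N.[x%:C] / boundary_poly.[x%:C].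
    rewrite sE hornerZ horner_prod invfM mulrCA; congr (_ * _).
    congr (_ * _); rewrite /prodV -prodfV; apply: eq_bigr => z _.
    by rewrite hornerXsubC.
  rewrite gE hornerM horner_jpolyC.
  have ile : (i.+1 <= n.+1)%N by rewrite ltnS leq_subr.
  have := Im_backward x ile.
  have -> : (n.+1 - i.+1 = k)%N by rewrite subSS subKn.
  rewrite horner_boundary_poly /sqden.
  have d0n := lt0r_neq0 d0; rewrite /sqden in d0n.
  move: (jacobiP a b n x) (jacobiP a b n.+1 x) (jacobiP a b j x) (jacobiP a b k x) d0n => P Q Pj Pk d0n.
  case: (backward i.+1).[_] => [p q]/= E.
  have -> : Pk = - (p * - P + q * Q) by rewrite E opprK.
  by rewrite /=; field.
by refine (cvgr_eqfun _ (cvgN Fi)) => m; rewrite ?fctE/=; ring.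
Qed.

Lemma rpv_jacobiP_sqr (f : 'I_n.+1 -> R) :
  rpv (fun x => (\sum_(j < n.+1) f j * jacobiP a b j x) ^+ 2 / sqden x)
      (pi * a n * \sum_(j < n.+1) f j ^+ 2).
Proof.
have H (j k : 'I_n.+1) : rpv (fun x => jacobiP a b j x * jacobiP a b k x / sqden x)
      (pi * a n *+ (j == k)).
  have [jk|kj] := leqP j k; first by apply: rpv_jacobiP_mul; rewrite jk -ltnS ltn_ord.
  rewrite eq_sym; apply: (@eq_rpv (fun x => jacobiP a b k x * jacobiP a b j x / sqden x)).
    by move=> x; rewrite [_ * jacobiP a b j x]mulrC.
  by apply: rpv_jacobiP_mul; rewrite ltnW//= -ltnS ltn_ord.
have := @rpv_sum _ (index_enum 'I_n.+1) _ _ (fun j =>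
  @rpv_sum _ (index_enum 'I_n.+1) _ _ (fun k => rpvZ (f j * f k) (H j k))).
rewrite (_ : \sum_j _ = pi * a n * \sum_(j < n.+1) f j ^+ 2); last first.
  rewrite mulr_sumr; apply: eq_bigr => j _.
  rewrite (bigD1 j)//= eqxx big1 ?addr0; last first.
    by move=> k kj; rewrite eq_sym (negbTE kj) mulr0.
  by rewrite mulr1n; ring.
apply: eq_rpv => x.
rewrite expr2 big_distrlr/= mulr_suml; apply: eq_bigr => j _.
by rewrite mulr_suml; apply: eq_bigr => k _; ring.
Qed.

(** For a nonnegative function the principal value is the Lebesgue
    integral, by monotone convergence. *)
Lemma integral_rpv (f : R -> R) (l : R) : (forall x, 0 <= f x) -> continuous f ->
  rpv f l -> (\int[lebesgue_measure]_x (f x)%:E = l%:E)%E.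
Proof.
move=> f0 cf [F [Ff Fl]].
pose I (k : nat) : set (measurableTypeR R) := `[- k%:R, k%:R]%classic.
have mf : measurable_fun [set: measurableTypeR R] (EFin \o f : measurableTypeR R -> \bar R).
  by apply/measurable_EFinP; exact: continuous_measurable_fun.
have UI : \bigcup_k I k = [set: measurableTypeR R].
  rewrite -subTset => x _; exists (Num.truncn `|x|).+1 => //=.
  by rewrite /I/= in_itv/= -ler_norml ltW// truncnS_gt.
have H := @ge0_nondecreasing_set_cvg_integral _ _ _ I (EFin \o f) (@lebesgue_measure R).
have {}H : (\int[lebesgue_measure]_(x in I k) (f x)%:E)%E @[k --> \oo] -->
   (\int[lebesgue_measure]_x (f x)%:E)%E.
  rewrite -UI; apply: H.
  - move=> k m km; apply/subsetPset => x; rewrite /I/= !in_itv/= => /andP[h1 h2].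
    by rewrite (le_trans _ h1) ?lerN2 ?(le_trans h2)// ler_nat.
  - by move=> k; exact: measurable_itv.
  - by move=> k; exact: measurable_funTS.
  - by move=> k x _; rewrite lee_fin.
apply: (cvg_unique _ H); first exact: ereal_hausdorff.
have : (F k%:R - F (- k%:R))%:E @[k --> \oo] --> l%:E by apply: cvg_EFin => //; exact: nearW.
apply: cvg_trans; apply: near_eq_cvg; near=> k.
have k0 : (0 < k)%N by near: k; exact: nbhs_infty_gt.
rewrite /I (@continuous_FTC2 _ f F)//.
- by rewrite -subr_gt0 opprK addr_gt0// ltr0n.
- exact: continuous_subspaceT.
- have dF x : derivable F x 1 by have [] := Ff x.
  split => //.
  + by apply: cvg_at_right_filter; apply: differentiable_continuous; apply/derivable1_diffP.
  + by apply: cvg_at_left_filter; apply: differentiable_continuous; apply/derivable1_diffP.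
- by move=> x _; rewrite derive1E; have [_ ->] := Ff x.
Unshelve. all: end_near. Qed.

Lemma continuous_jacobiP k : continuous (jacobiP a b k).
Proof.
rewrite (_ : jacobiP a b k = horner (jpoly k)); last first.
  by apply/funext => x; rewrite horner_jpoly.
exact: continuous_horner.
Qed.

Lemma continuous_sqden : continuous sqden.
Proof.
move=> x; apply: cvgD; under eq_fun do rewrite expr2.
  by apply: cvgM; exact: continuous_jacobiP.
by apply: cvgM; exact: continuous_jacobiP.
Qed.

(** Orthonormality of P_0, ..., P_n with respect to the probability
    density 1 / (pi a_n (P_n^2 + P_(n+1)^2)). *)
Lemma integral_jacobiP_sqr (f : 'I_n.+1 -> R) :
  (\int[lebesgue_measure]_x
     ((\sum_(j < n.+1) f j * jacobiP a b j x) ^+ 2 / (pi * a n * sqden x))%:E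
   = (\sum_(j < n.+1) f j ^+ 2)%:E)%E.
Proof.
have pa0 : pi * a n != 0 by rewrite mulf_neq0// lt0r_neq0// pi_gt0.
apply: integral_rpv.
- move=> x; rewrite mulr_ge0 ?sqr_ge0// invr_ge0 mulr_ge0 ?(ltW (sqden_gt0 x))//.
  by rewrite mulr_ge0 ?pi_ge0// ltW.
- move=> x; apply: cvgM.
    under eq_fun do rewrite expr2.
    have c : {for x, continuous (fun x => \sum_(j < n.+1) f j * jacobiP a b j x)}.
      rewrite (_ : (fun x => _) = horner (\sum_(j < n.+1) f j *: jpoly j)).
        exact: continuous_horner.
      apply/funext => y; rewrite horner_sum; apply: eq_bigr => j _.
      by rewrite hornerZ horner_jpoly.
    exact: cvgM.
  apply: cvgV; first by rewrite mulf_neq0// lt0r_neq0 ?sqden_gt0.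
  by apply: cvgM; [exact: cvg_cst|exact: continuous_sqden].
have := rpvZ (pi * a n)^-1 (rpv_jacobiP_sqr f).
rewrite mulrA mulVf// mul1r; apply: eq_rpv => x.
by rewrite [in RHS]invfM mulrCA mulrA.
Qed.

End JacobiPolynomials.

(** * Sequences with summable relative increments *)

Section SlowVariation.
Context {R : realType}.

Lemma cvg_series_le (f g : nat -> R) : (forall n, 0 <= f n <= g n) ->
  cvgn (series g) -> cvgn (series f).
Proof.
move=> fg cg; apply: series_le_cvg cg => n.
- by have /andP[] := fg n.
- by have /andP[f0] := fg n; exact: le_trans.
- by have /andP[] := fg n.
Qed.

Lemma cvg_series_bounded (u : nat -> R) (M : R) : (forall n, 0 <= u n) ->
  (forall n, series u n <= M) -> cvgn (series u).
Proof.
move=> u0 uM; apply: nondecreasing_is_cvgn.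
  by apply: nondecreasing_series => n _ _; exact: u0.
by exists M => _ [n _ <-].
Qed.

Lemma cvg_series_lty (u : nat -> R) : (forall n, 0 <= u n) ->
  (\sum_(0 <= n <oo) (u n)%:E < +oo)%E -> cvgn (series u).
Proof.
move=> u0 uoo; apply: (@cvg_series_bounded _ (fine (\sum_(0 <= n <oo) (u n)%:E)%E)) => // n.
rewrite -lee_fin fineK; last first.
  by rewrite ge0_fin_numE//; apply: nneseries_ge0 => k _ _; rewrite lee_fin.
by rewrite /series/= -sumEFin; apply: nneseries_lim_ge => k _; rewrite lee_fin.
Qed.

Lemma ln_ratio_bound (p q e : R) : 0 < p -> 0 < q -> 0 <= e <= 2^-1 ->
  `|q - p| <= e * p -> `|ln q - ln p| <= 2 * e.
Proof.
move=> p0 q0 /andP[perturb e1]; rewrite ler_norml => /andP[h1 h2].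
have lnE (x y : R) : 0 < x -> 0 < y -> ln x - ln y <= x / y - 1.
  move=> x0 y0; rewrite -ln_div ?posrE//.
  rewrite lerBrDr -[leLHS]addrC.
  by have := @expR_ge1Dx _ (ln (x / y)); rewrite lnK ?posrE ?divr_gt0.
have qp := lnE q p q0 p0; have pq := lnE p q p0 q0.
have A : q / p - 1 <= e by rewrite lerBlDr ler_pdivrMr//; lra.
have B : p / q - 1 <= 2 * e.
  rewrite lerBlDr ler_pdivrMr//.
  suff : 0 <= (1 + 2 * e) * q - p by lra.
  have : (1 + 2 * e) * ((1 - e) * p) <= (1 + 2 * e) * q by apply: ler_wpM2l; lra.
  suff : 0 <= e * (1 - 2 * e) * p by lra.
  by rewrite !mulr_ge0//; lra.
by rewrite ler_norml; apply/andP; split; lra.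
Qed.

(** The increments of ln V_n are dominated by 2 e_n, so ln V_n converges.
    The lower bound depends on V only through its value at N; that is what
    makes the later estimates uniform in the spectral parameter. *)
Lemma slow_variation (V e : nat -> R) N :
  (forall n, (N <= n)%N -> 0 < V n) ->
  (forall n, 0 <= e n) -> cvgn (series e) ->
  (forall n, (N <= n)%N -> e n <= 2^-1 /\ `|V n.+1 - V n| <= e n * V n) ->
  (exists2 L : R, 0 < L & V @ \oo --> L) /\
  forall n, (N <= n)%N -> V N * expR (- 2 * limn (series e)) <= V n.
Proof.
move=> V0 perturb ce H.
pose g k := ln (V (N + k)%N).
have gstep k : `|g k.+1 - g k| <= 2 * e (N + k)%N.
  have [h1 h2] := H (N + k)%N (leq_addr _ _).
  have p0 := V0 _ (leq_addr k N); have q0 := V0 _ (leq_addr k.+1 N).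
  by rewrite addnS in q0; rewrite /g addnS; apply: ln_ratio_bound => //; rewrite perturb.
have ceN : cvgn (series (fun k => 2 * e (N + k)%N)).
  have : cvgn (series (2 *: (fun k => e (N + k)%N))).
    apply: is_cvg_seriesZ.
    rewrite (_ : series _ = (fun k => series e (k + N)%N - series e N)).
      apply: is_cvgB; last exact: is_cvg_cst.
      by apply/cvg_ex; exists (limn (series e)); rewrite (cvg_shiftn N (series e)).
    apply/funext => k; rewrite sub_series leq_addl/=.
    by rewrite -{2}[N]add0n big_addn addnK; apply: eq_bigr => i _; rewrite addnC.
  by [].
have sg k : series (fun k => g k.+1 - g k) k = g k - g 0%N.
  rewrite /series/=; elim: k => [|k IH]; first by rewrite big_geq// subrr.
  by rewrite big_nat_recr//= IH; ring.
have cg : cvgn g.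
  have : cvgn (series (fun k => g k.+1 - g k)).
    apply: normed_cvg; apply: cvg_series_le ceN => k.
    by rewrite normr_ge0 gstep.
  rewrite (_ : series _ = g - cst (g 0%N)); last by apply/funext => k; rewrite sg.
  move=> c1; have -> : g = (g - cst (g 0%N)) + cst (g 0%N).
    by apply/funext => k /=; rewrite !fctE/= subrK.
  by apply: is_cvgD => //; exact: is_cvg_cst.
have VE k : expR (g k) = V (N + k)%N by rewrite /g lnK// posrE V0// leq_addr.
split.
  exists (expR (limn g)); first exact: expR_gt0.
  rewrite -(cvg_shiftn N).
  have : (expR \o g) @ \oo --> expR (limn g).
    by apply: continuous_cvg => //; exact: continuous_expR.
  by apply: cvg_trans; apply: near_eq_cvg; apply: nearW => k /=; rewrite VE addnC.
move=> n Nn; rewrite -(subnKC Nn) -VE -{1}[N]addn0 -VE -expRD ler_expR.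
have le_sum : `|g (n - N)%N - g 0%N| <= 2 * series e n.
  rewrite -sg /series/=; apply: le_trans (ler_norm_sum _ _ _) _.
  apply: (@le_trans _ _ (\sum_(0 <= k < n - N) 2 * e (N + k)%N)).
    by apply: ler_sum => k _; exact: gstep.
  rewrite -mulr_sumr ler_pM2l//.
  rewrite (@big_cat_nat _ _ _ N 0 n)//= -[leLHS]add0r lerD ?sumr_ge0//.
  have -> : \sum_(N <= i < n) e i = \sum_(0 <= i < n - N) e (i + N)%N.
    by rewrite -{1}[N]add0n big_addn.
  by apply: ler_sum => k _; rewrite addnC.
have : series e n <= limn (series e).
  by apply: nondecreasing_cvgn_le => //; apply: nondecreasing_series => k _ _; exact: perturb.
by move: le_sum; rewrite ler_norml => /andP[+ _]; lra.
Qed.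

End SlowVariation.

(** * One step of the recurrence *)

Section Increment.
Context {R : realType}.

(** The terms x u2 u3 and x u1 u2 are eliminated with the recurrence; the
    symmetric coefficients (a_k + a_(k+1)) / 2 are chosen so that only
    differences of the a_k survive. *)
Lemma increment_identity (a0 a1 a2 a3 x b u1 u2 u3 : R) :
  a2 * u3 = (x - b) * u2 - a1 * u1 ->
  ((a1 + a2) / 2 * u2 ^+ 2 + (a2 + a3) / 2 * u3 ^+ 2 - x * u2 * u3) -
  ((a0 + a1) / 2 * u1 ^+ 2 + (a1 + a2) / 2 * u2 ^+ 2 - x * u1 * u2) =
  (a3 - a2) / 2 * u3 ^+ 2 + (a1 - a0) / 2 * u1 ^+ 2 + (a2 - a1) * (u3 * u1)
  - b * u2 * (u3 - u1).
Proof.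
move=> E; have {E}: x * u2 = a2 * u3 + a1 * u1 + b * u2 by rewrite E; ring.
move=> E; rewrite -(mulrA x u2 u3).
have -> : x * (u2 * u3) = (a2 * u3 + a1 * u1 + b * u2) * u3 by rewrite -E; ring.
have -> : x * u1 * u2 = (a2 * u3 + a1 * u1 + b * u2) * u1 by rewrite -E; ring.
by field.
Qed.

Lemma next_sqr_bound (a1 a2 y u1 u2 u3 : R) : 0 < a2 -> 0 <= a1 <= 3 / 2 * a2 ->
  `|y| <= a2 -> a2 * u3 = y * u2 - a1 * u1 -> u3 ^+ 2 <= 8 * (u1 ^+ 2 + u2 ^+ 2).
Proof.
move=> a20 /andP[a10 a12] ya E.
have a22 : 0 < a2 ^+ 2 by rewrite exprn_gt0.
rewrite -(ler_pM2l a22) -exprMn E.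
have y2 : y ^+ 2 <= a2 ^+ 2 by rewrite -real_normK ?num_real// lerXn2r ?nnegrE// ltW.
have a1sq : a1 ^+ 2 <= 9 / 4 * a2 ^+ 2.
  rewrite (_ : 9 / 4 * a2 ^+ 2 = (3 / 2 * a2) ^+ 2); last by field.
  by rewrite lerXn2r ?nnegrE//; lra.
have := ler_wpM2r (sqr_ge0 u2) y2; have := ler_wpM2r (sqr_ge0 u1) a1sq.
have := sqr_ge0 (y * u2 + a1 * u1).
have := mulr_ge0 (ltW a22) (sqr_ge0 u1); have := mulr_ge0 (ltW a22) (sqr_ge0 u2).
rewrite !expr2; lra.
Qed.

(** The recurrence reads a2 (u3 + u1) = y u2 + (a2 - a1) u1, so u3 + u1 is
    small. In the square, one factor |y| / a2 is bounded by 1, which keeps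
    the estimate linear in |y| and |a2 - a1|. *)
Lemma alternating_sum_bound (a1 a2 y u1 u2 u3 : R) : 0 < a2 ->
  `|y| <= a2 -> `|a2 - a1| <= 2 * a2 -> a2 * u3 = y * u2 - a1 * u1 ->
  a2 * (u3 + u1) ^+ 2 <= 4 * (`|y| + `|a2 - a1|) * (u1 ^+ 2 + u2 ^+ 2).
Proof.
move=> a20 ya da E.
have Et : a2 * (u3 + u1) = y * u2 + (a2 - a1) * u1 by rewrite mulrDr E; ring.
rewrite -(ler_pM2l a20).
have -> : a2 * (a2 * (u3 + u1) ^+ 2) = (y * u2 + (a2 - a1) * u1) ^+ 2.
  by rewrite -Et; ring.
set d := a2 - a1 in da *.
have y2 : y ^+ 2 <= a2 * `|y| by rewrite -real_normK ?num_real// expr2 ler_wpM2r.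
have d2 : d ^+ 2 <= 2 * a2 * `|d| by rewrite -[d ^+ 2]real_normK ?num_real// expr2 ler_wpM2r.
have := ler_wpM2r (sqr_ge0 u2) y2; have := ler_wpM2r (sqr_ge0 u1) d2.
have := sqr_ge0 (y * u2 - d * u1).
have p1 := mulr_ge0 (mulr_ge0 (ltW a20) (normr_ge0 y)) (sqr_ge0 u1).
have p2 := mulr_ge0 (mulr_ge0 (ltW a20) (normr_ge0 y)) (sqr_ge0 u2).
have p3 := mulr_ge0 (mulr_ge0 (ltW a20) (normr_ge0 d)) (sqr_ge0 u1).
have p4 := mulr_ge0 (mulr_ge0 (ltW a20) (normr_ge0 d)) (sqr_ge0 u2).
move: p1 p2 p3 p4; rewrite !expr2; lra.
Qed.

(** Here a2 - a1 = g1 + d1 splits into the increment g1 of the square root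
    and a perturbation d1, and likewise for the neighbouring indices; s
    stands for the square root itself. The increments g0, g1, g2 are of
    order 1/s, too large for a termwise estimate. Up to their differences,
    which telescope, they only contribute g1 (u3 + u1)^2 / 2, and
    [alternating_sum_bound] gains on this term the further power of 1/s
    that makes it summable. *)
Lemma increment_bound (X s g0 g1 g2 d0 d1 d2 a1 a2 x b u1 u2 u3 : R) :
  let Q := u1 ^+ 2 + u2 ^+ 2 in
  1 <= s -> 0 <= X -> `|x| <= X ->
  0 <= g2 <= g1 -> g1 <= g0 -> g1 <= s^-1 ->
  a2 - a1 = g1 + d1 -> s <= 2 * a2 ->
  0 <= a1 <= 3 / 2 * a2 -> X + `|b| <= a2 ->
  a2 * u3 = (x - b) * u2 - a1 * u1 ->
  `|(g2 + d2) / 2 * u3 ^+ 2 + (g0 + d0) / 2 * u1 ^+ 2 + (g1 + d1) * (u3 * u1)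
    - b * u2 * (u3 - u1)| <=
  (20 * ((X + 1) / s ^+ 3 + (g0 - g2) + (`|d0| + `|d1| + `|d2| + `|b|) / s)) * (s * Q).
Proof.
move=> Q s1 X0 xX /andP[g20 g21] g10 g1s aE sa /andP[a10 a12] Xb E.
have s0 : 0 < s by lra.
have a20 : 0 < a2 by lra.
have yb : `|x - b| <= X + `|b| by apply: le_trans (ler_normB _ _) _; lra.
have ya : `|x - b| <= a2 by lra.
have da : `|a2 - a1| <= 2 * a2 by rewrite ler_norml; apply/andP; split; lra.
have q3 : u3 ^+ 2 <= 8 * Q by apply: (next_sqr_bound a20 _ ya E); apply/andP.
have tb := alternating_sum_bound a20 ya da E.
have Q0 : 0 <= Q by rewrite /Q addr_ge0 ?sqr_ge0.
have sV1 : s^-1 <= 1 by rewrite invf_le1.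
have g11 : g1 <= 1 by lra.
have u1Q : u1 ^+ 2 <= Q by rewrite /Q lerDl sqr_ge0.
have u2Q : u2 ^+ 2 <= Q by rewrite /Q lerDr sqr_ge0.
(* M bounds |x - b| + |a2 - a1|, the numerator in [alternating_sum_bound]. *)
pose M := X + 1 + `|b| + `|d1|.
have M0 : 0 <= M by rewrite /M; have := normr_ge0 b; have := normr_ge0 d1; lra.
have t1 : s * (u3 + u1) ^+ 2 <= 8 * M * Q.
  have h : a2 * (u3 + u1) ^+ 2 <= 4 * M * Q.
    apply: (le_trans tb); apply: ler_wpM2r => //; rewrite ler_pM2l//.
    have := ler_normD g1 d1; rewrite -aE /M.
    have : `|g1| <= 1 by rewrite ger0_norm//; lra.
    by lra.
  have : s * (u3 + u1) ^+ 2 <= 2 * a2 * (u3 + u1) ^+ 2 by rewrite ler_wpM2r ?sqr_ge0.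
  by lra.
have t2 : g1 * (u3 + u1) ^+ 2 <= 8 * (M / s ^+ 2) * Q.
  apply: (@le_trans _ _ (s^-1 * (u3 + u1) ^+ 2)); first by rewrite ler_wpM2r ?sqr_ge0.
  have s2 : 0 < s ^+ 2 by rewrite exprn_gt0.
  rewrite -(ler_pM2l s2).
  have -> : s ^+ 2 * (s^-1 * (u3 + u1) ^+ 2) = s * (u3 + u1) ^+ 2.
    by field; exact: lt0r_neq0.
  have -> // : s ^+ 2 * (8 * (M / s ^+ 2) * Q) = 8 * M * Q.
  by field; exact: lt0r_neq0.
have Ms : M / s ^+ 2 <= (X + 1) / s ^+ 2 + (`|b| + `|d1|).
  rewrite /M -addrA mulrDl lerD2l ler_pdivrMr ?exprn_gt0//.
  rewrite ler_peMr ?addr_ge0 ?normr_ge0// expr2.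
  by have := ler_wpM2l (ltW s0) s1; lra.
have MQ := ler_wpM2r Q0 Ms.
have t31 : `|u3 * u1| <= 9 / 2 * Q.
  have := sqr_ge0 (u3 - u1); have := sqr_ge0 (u3 + u1); rewrite !expr2 => h1 h2.
  by rewrite ler_norml; move: q3 u1Q; rewrite !expr2; clear -h1 h2 Q0 => h3 h4; apply/andP; split; lra.
have t2b : `|u2 * (u3 - u1)| <= 19 / 2 * Q.
  have h1 := sqr_ge0 (u3 - u1 + u2); have h2 := sqr_ge0 (u3 - u1 - u2).
  have h3 := sqr_ge0 (u3 + u1).
  move: h1 h2 h3 q3 u1Q u2Q; rewrite !expr2 ler_norml; clear -Q0 => h1 h2 h3 h4 h5 h6.
  by apply/andP; split; lra.
have -> : (g2 + d2) / 2 * u3 ^+ 2 + (g0 + d0) / 2 * u1 ^+ 2 + (g1 + d1) * (u3 * u1)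
    - b * u2 * (u3 - u1) = g1 * (u3 + u1) ^+ 2 / 2
    + ((g2 - g1) / 2 * u3 ^+ 2 + (g0 - g1) / 2 * u1 ^+ 2)
    + (d2 / 2 * u3 ^+ 2 + d0 / 2 * u1 ^+ 2) + d1 * (u3 * u1) - b * (u2 * (u3 - u1)).
  by field.
have -> : 20 * ((X + 1) / s ^+ 3 + (g0 - g2) + (`|d0| + `|d1| + `|d2| + `|b|) / s) * (s * Q) =
   20 * ((X + 1) / s ^+ 2 * Q + (g0 - g2) * Q * s + (`|d0| + `|d1| + `|d2| + `|b|) * Q).
  by field; exact: lt0r_neq0.
have b1 : `|g1 * (u3 + u1) ^+ 2 / 2| <= 4 * ((X + 1) / s ^+ 2 * Q) + 4 * `|b| * Q + 4 * `|d1| * Q.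
  have g1n : 0 <= g1 by lra.
  rewrite (ger0_norm (divr_ge0 (mulr_ge0 g1n (sqr_ge0 _)) (ler0n _ 2))).
  by lra.
have b2 : `|(g2 - g1) / 2 * u3 ^+ 2 + (g0 - g1) / 2 * u1 ^+ 2| <= 4 * ((g0 - g2) * Q * s).
  have gg : 0 <= (g0 - g2) * Q by rewrite mulr_ge0//; lra.
  have h := ler_wpM2l gg s1.
  have h1 : (g1 - g2) * u3 ^+ 2 <= (g1 - g2) * (8 * Q) by rewrite ler_wpM2l//; lra.
  have h2 : (g0 - g1) * u1 ^+ 2 <= (g0 - g1) * Q by rewrite ler_wpM2l//; lra.
  have h3 : 0 <= (g1 - g2) * u3 ^+ 2 by rewrite mulr_ge0 ?sqr_ge0//; lra.
  have h4 : 0 <= (g0 - g1) * u1 ^+ 2 by rewrite mulr_ge0 ?sqr_ge0//; lra.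
  have h5 : 0 <= (g0 - g1) * Q by rewrite mulr_ge0//; lra.
  have h6 : 0 <= (g1 - g2) * Q by rewrite mulr_ge0//; lra.
  by rewrite ler_norml; apply/andP; split; lra.
have b3 : `|d2 / 2 * u3 ^+ 2 + d0 / 2 * u1 ^+ 2| <= 4 * `|d2| * Q + `|d0| * Q.
  have h1 := ler_wpM2l (normr_ge0 d2) q3; have h2 := ler_wpM2l (normr_ge0 d0) u1Q.
  have h3 := mulr_ge0 (normr_ge0 d0) Q0.
  have := sqr_ge0 u3; have := sqr_ge0 u1; move: h1 h2 h3.
  move: (u3 ^+ 2) (u1 ^+ 2) => A B h1 h2 h3 B0 A0.
  apply: (le_trans (ler_normD _ _)).
  rewrite (normrM _ A) (normrM _ B) (ger0_norm A0) (ger0_norm B0) !normrM.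
  by rewrite (@ger0_norm _ 2^-1) ?invr_ge0//; lra.
have b4 : `|d1 * (u3 * u1)| <= 9 / 2 * `|d1| * Q.
  by rewrite normrM; have := ler_wpM2l (normr_ge0 d1) t31; lra.
have b5 : `|b * (u2 * (u3 - u1))| <= 19 / 2 * `|b| * Q.
  by rewrite normrM; have := ler_wpM2l (normr_ge0 b) t2b; lra.
apply: (le_trans (ler_normB _ _)).
apply: (le_trans (lerD (ler_normD _ _) (lexx _))).
apply: (le_trans (lerD (lerD (ler_normD _ _) (lexx _)) (lexx _))).
apply: (le_trans (lerD (lerD (lerD (ler_normD _ _) (lexx _)) (lexx _)) (lexx _))).
apply: (le_trans (lerD (lerD (lerD (lerD b1 b2) b3) b4) b5)).
have p1 := mulr_ge0 (normr_ge0 d0) Q0; have p2 := mulr_ge0 (normr_ge0 d1) Q0.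
have p3 := mulr_ge0 (normr_ge0 d2) Q0; have p4 := mulr_ge0 (normr_ge0 b) Q0.
have p5 : 0 <= (X + 1) / s ^+ 2 * Q.
  apply: mulr_ge0 Q0; apply: divr_ge0 (ltW (exprn_gt0 _ s0)).
  by clear -X0; lra.
have p6 : 0 <= (g0 - g2) * Q * s.
  by apply: mulr_ge0 (ltW s0); apply: mulr_ge0 Q0; clear -g20 g21 g10; lra.
move: p1 p2 p3 p4 p5 p6; set k1 := (X + 1) / s ^+ 2 * Q; set k2 := (g0 - g2) * Q * s.
by clear; lra.
Qed.

End Increment.

(** * Asymptotics of the polynomials *)

Section Asymptotics.
Context {R : realType}.
Variables a b c : nat -> R.
Hypothesis a_gt0 : forall n, 0 < a n.
Hypothesis cE : forall n, c n = a n - Num.sqrt n.+1%:R.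
Hypothesis c_little_o : c =o_\oo (fun n : nat => Num.sqrt n.+1%:R : R).
Hypothesis c_summable : (\sum_(0 <= n <oo)
     (`|c n| / n.+1%:R + (`|c n.+1 - c n| + `|b n|) / Num.sqrt n.+1%:R)%:E
     < +oo)%E.

Let s (n : nat) : R := Num.sqrt n.+1%:R.

Lemma sqrtS_ge1 n : 1 <= s n.
Proof. by rewrite /s -[leLHS]sqrtr1 ler_sqrt// ler1n. Qed.
Lemma sqrtS_gt0 n : 0 < s n. Proof. exact: lt_le_trans (sqrtS_ge1 n). Qed.
Lemma sqr_sqrtS n : s n ^+ 2 = n.+1%:R. Proof. by rewrite sqr_sqrtr. Qed.
Lemma sqrtS_le m n : (m <= n)%N -> s m <= s n.
Proof. by move=> mn; rewrite /s ler_sqrt// ler_nat. Qed.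

Let g (n : nat) : R := s n.+1 - s n.

Lemma sqrt_incrE n : g n = (s n.+1 + s n)^-1.
Proof.
have p0 : s n.+1 + s n != 0 by rewrite lt0r_neq0// addr_gt0 ?sqrtS_gt0.
apply: (mulIf p0); rewrite mulVf//.
have := sqr_sqrtS n.+1; have := sqr_sqrtS n; rewrite -(natr1 n.+1) => h1 h2.
by rewrite /g -subr_sqr h1 h2; ring.
Qed.

Lemma sqrt_incr_ge0 n : 0 <= g n.
Proof. by rewrite sqrt_incrE invr_ge0 addr_ge0// ltW ?sqrtS_gt0. Qed.

Lemma sqrt_incr_noninc n : g n.+1 <= g n.
Proof.
rewrite !sqrt_incrE lef_pV2 ?posrE ?addr_gt0 ?sqrtS_gt0//.
by rewrite lerD ?sqrtS_le.
Qed.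

Lemma sqrt_incr_le n : g n <= (s n)^-1.
Proof.
rewrite sqrt_incrE lef_pV2 ?posrE ?addr_gt0 ?sqrtS_gt0// lerDr.
exact: ltW (sqrtS_gt0 _).
Qed.

Let d (n : nat) : R := c n.+1 - c n.

Let perturb (n : nat) : R := (`|d n| + `|b n|) / s n.

Lemma perturb_ge0 n : 0 <= perturb n.
Proof. by rewrite /perturb divr_ge0 ?addr_ge0 ?normr_ge0// ltW// sqrtS_gt0. Qed.

Lemma cvg_series_perturb : cvgn (series perturb).
Proof.
pose u n : R := `|c n| / n.+1%:R + perturb n.
have u0 n : 0 <= u n by rewrite /u addr_ge0 ?perturb_ge0// divr_ge0.
have : cvgn (series u) by exact: cvg_series_lty.
apply: cvg_series_le => n; rewrite perturb_ge0/= /u lerDr.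
by rewrite divr_ge0.
Qed.

(** Comparison with the telescoping series of 1 / sqrt(n+1) - 1 /
    sqrt(n+2). *)
Lemma cvg_series_sqrtSV3 : cvgn (series (fun n => (s n.+1 ^+ 3)^-1)).
Proof.
have h n : 0 <= (s n.+1 ^+ 3)^-1 <= 2 * ((s n)^-1 - (s n.+1)^-1).
  rewrite invr_ge0 exprn_ge0 ?(ltW (sqrtS_gt0 _))//=.
  have -> : (s n)^-1 - (s n.+1)^-1 = g n / (s n * s n.+1).
    by rewrite /g; field; rewrite !lt0r_neq0 ?sqrtS_gt0.
  have h1 : (2 * s n.+1)^-1 <= g n.
    rewrite sqrt_incrE lef_pV2 ?posrE ?mulr_gt0 ?addr_gt0 ?sqrtS_gt0//.
    by have := @sqrtS_le n n.+1 (leqnSn _); lra.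
  have h2 : (s n.+1 ^+ 2)^-1 <= (s n * s n.+1)^-1.
    rewrite lef_pV2 ?posrE ?mulr_gt0 ?exprn_gt0 ?sqrtS_gt0//.
    by rewrite expr2 ler_wpM2r ?sqrtS_le// ltW// sqrtS_gt0.
  have -> : (s n.+1 ^+ 3)^-1 = 2 * ((2 * s n.+1)^-1 * (s n.+1 ^+ 2)^-1).
    by field; rewrite lt0r_neq0 ?sqrtS_gt0.
  rewrite ler_pM2l//; apply: ler_pM => //; rewrite invr_ge0 ltW//.
    by rewrite mulr_gt0 ?sqrtS_gt0.
  by rewrite exprn_gt0 ?sqrtS_gt0.
apply: (cvg_series_le h).
apply: (@cvg_series_bounded R _ 2) => n; first by have /andP[+ +] := h n; lra.
have -> : series (fun n => 2 * ((s n)^-1 - (s n.+1)^-1)) n = 2 * ((s 0%N)^-1 - (s n)^-1).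
  rewrite /series/=; elim: n => [|n IH]; first by rewrite big_geq// subrr mulr0.
  by rewrite big_nat_recr//= IH; ring.
have := sqrtS_gt0 n; rewrite -invr_gt0 => h1.
have : (s 0%N)^-1 <= 1 by rewrite invf_le1 ?sqrtS_ge1 ?sqrtS_gt0.
by lra.
Qed.

Lemma cvg_series_shift (u : nat -> R) : cvgn (series u) ->
  cvgn (series (fun n => u n.+1)).
Proof.
move=> cu; rewrite (_ : series _ = (fun n => series u (n + 1)%N - cst (u 0%N) n)).
  apply: is_cvgB; last exact: is_cvg_cst.
  by apply/cvg_ex; exists (limn (series u)); rewrite (cvg_shiftn 1 (series u)).
apply/funext => n; rewrite /series/= addn1 big_nat_recl//=.
by rewrite addrC addrA addNr add0r.
Qed.

Lemma cvg_series_sqrt_incr2 : cvgn (series (fun n => g n - g n.+2)).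
Proof.
have h n : 0 <= g n - g n.+2.
  by rewrite subr_ge0 (le_trans (sqrt_incr_noninc _))// sqrt_incr_noninc.
apply: (@cvg_series_bounded R _ (g 0%N + g 1%N)) => // n.
have -> : series (fun n => g n - g n.+2) n = g 0%N + g 1%N - g n - g n.+1.
  rewrite /series/=; elim: n => [|n IH]; first by rewrite big_geq//; ring.
  by rewrite big_nat_recr//= IH; ring.
by have := sqrt_incr_ge0 n; have := sqrt_incr_ge0 n.+1; lra.
Qed.

(** The bound of [increment_bound], with the factor 20 enlarged to 160: a
    factor 4 comes from [jacobi_form_bounds], a factor 2 from changing
    sqrt(n+2) to sqrt(n+3) in the denominators. *)
Definition rel_incr (X : R) (n : nat) : R :=
  160 * ((X + 1) / s n.+1 ^+ 3 + (g n - g n.+2) + (perturb n + perturb n.+1 + perturb n.+2)).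

Lemma rel_incr_ge0 X n : 0 <= X -> 0 <= rel_incr X n.
Proof.
move=> X0; have h1 : 0 <= (X + 1) / s n.+1 ^+ 3.
  by rewrite divr_ge0 ?exprn_ge0 ?(ltW (sqrtS_gt0 _))//; lra.
have h2 : 0 <= g n - g n.+2.
  by rewrite subr_ge0 (le_trans (sqrt_incr_noninc _))// sqrt_incr_noninc.
have := perturb_ge0 n; have := perturb_ge0 n.+1; have := perturb_ge0 n.+2.
by rewrite /rel_incr; lra.
Qed.

Lemma cvg_rel_incr X : cvgn (series (rel_incr X)).
Proof.
have -> : rel_incr X = 160 *: (((X + 1) *: (fun n => (s n.+1 ^+ 3)^-1) +
   (fun n => g n - g n.+2)) + (perturb + (fun n => perturb n.+1) + (fun n => perturb n.+2))).
  by apply/funext => n; rewrite /rel_incr /GRing.scale/= !fctE.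
apply: is_cvg_seriesZ; apply: is_cvg_seriesD.
  apply: is_cvg_seriesD; last exact: cvg_series_sqrt_incr2.
  by apply: is_cvg_seriesZ; exact: cvg_series_sqrtSV3.
have c1 := cvg_series_shift cvg_series_perturb.
apply: is_cvg_seriesD; last exact: cvg_series_shift c1.
by apply: is_cvg_seriesD => //; exact: cvg_series_perturb.
Qed.

Lemma cvg_c_div_sqrtS : (fun n => c n / s n) @ \oo --> (0 : R).
Proof.
apply/cvgr0Pnorm_le => e ep; near=> n.
rewrite normrM normfV (ger0_norm (ltW (sqrtS_gt0 n))) ler_pdivrMr ?sqrtS_gt0//.
rewrite -[X in e * X]ger0_norm ?(ltW (sqrtS_gt0 n))//.
by near: n; move/eqoP : c_little_o; apply.
Unshelve. all: end_near. Qed.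

Lemma sqrtS_cvgy : s @ \oo --> +oo.
Proof.
apply/cvgryPge => A; near=> n.
apply: (le_trans (ler_norm A)).
rewrite -(@ler_pXn2r _ 2) ?nnegrE ?(ltW (sqrtS_gt0 _))// sqr_sqrtS -natr1.
apply: (@le_trans _ _ n%:R); last by rewrite lerDl.
by near: n; exact: nbhs_infty_ger.
Unshelve. all: end_near. Qed.

Lemma eventually_small_perturb X : 0 <= X -> exists N, forall n, (N <= n)%N ->
  [/\ `|c n| <= s n / 8, 8 * X <= s n, `|b n| <= s n / 8 & rel_incr X n <= 2^-1].
Proof.
move=> X0.
suff [N _ NP] : \forall n \near \oo, [/\ `|c n| <= s n / 8, 8 * X <= s n, `|b n| <= s n / 8
    & rel_incr X n <= 2^-1].
  by exists N.
have c0 := cvg_c_div_sqrtS; have e00 := cvg_series_cvg_0 cvg_series_perturb.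
have r0 := cvg_series_cvg_0 (@cvg_rel_incr X).
near=> n; split.
- have : `|c n / s n| <= 8^-1 by near: n; move/cvgr0Pnorm_le : c0; apply; rewrite invr_gt0.
  by rewrite normrM normfV (ger0_norm (ltW (sqrtS_gt0 n))) ler_pdivrMr ?sqrtS_gt0// mulrC.
- by near: n; move/cvgryPge : sqrtS_cvgy; exact.
- have : `|perturb n| <= 8^-1 by near: n; move/cvgr0Pnorm_le : e00; apply; rewrite invr_gt0.
  rewrite ger0_norm ?perturb_ge0// /perturb ler_pdivrMr ?sqrtS_gt0//.
  by have := normr_ge0 (d n); lra.
- have : `|rel_incr X n| <= 2^-1 by near: n; move/cvgr0Pnorm_le : r0; apply; rewrite invr_gt0.
  by rewrite ger0_norm ?rel_incr_ge0.
Unshelve. all: end_near. Qed.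

(** A conserved quantity when a_n is constant and b_n = 0, and almost
    conserved here. The term with x removes x from the formula for the
    increments. *)
Definition jacobi_form (x : R) (n : nat) : R :=
  (a n + a n.+1) / 2 * jacobiP a b n.+1 x ^+ 2
  + (a n.+1 + a n.+2) / 2 * jacobiP a b n.+2 x ^+ 2
  - x * jacobiP a b n.+1 x * jacobiP a b n.+2 x.

Lemma sqrtS_le_double n : s n.+1 <= 2 * s n.
Proof.
rewrite -(@ler_pXn2r _ 2) ?nnegrE ?mulr_ge0 ?(ltW (sqrtS_gt0 _))//.
rewrite exprMn !sqr_sqrtS -[n.+2%:R]natr1.
by have : 1 <= n.+1%:R :> R; [rewrite ler1n|lra].
Qed.

Lemma a_bounds n : `|c n| <= s n / 8 -> 7 / 8 * s n <= a n <= 9 / 8 * s n.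
Proof.
rewrite cE ler_norml -/(s n) => /andP[h1 h2]; apply/andP; split; lra.
Qed.

Lemma jacobi_form_bounds X x n : 0 <= X -> `|x| <= X ->
  (forall k, (n <= k)%N -> `|c k| <= s k / 8) -> 8 * X <= s n ->
  s n.+1 * sqden a b n.+1 x / 4 <= jacobi_form x n <= 4 * (s n.+1 * sqden a b n.+1 x).
Proof.
move=> X0 xX cs Xs.
have aS k : (n <= k)%N -> 7 / 8 * s k <= a k <= 9 / 8 * s k.
  by move=> /cs/a_bounds.
have /andP[l0 r0] := aS n (leqnn _); have /andP[l1 r1] := aS n.+1 (leqnSn _).
have /andP[l2 r2] := aS n.+2 (leqW (leqnSn _)).
have m0 := sqrtS_le (leqnSn n); have m1 := sqrtS_le (leqnSn n.+1).
have D0 := sqrtS_le_double n; have D1 := sqrtS_le_double n.+1.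
have s0 := sqrtS_gt0 n.
rewrite /jacobi_form /sqden; move: (jacobiP a b n.+1 x) (jacobiP a b n.+2 x) => u1 u2.
set Q := u1 ^+ 2 + u2 ^+ 2.
have xu : `|x * u1 * u2| <= X / 2 * Q.
  rewrite -mulrA normrM; apply: le_trans (ler_wpM2r (normr_ge0 _) xX) _.
  rewrite -mulrA ler_wpM2l// ler_norml /Q.
  have := sqr_ge0 (u1 + u2); have := sqr_ge0 (u1 - u2); rewrite !expr2.
  by move=> h1 h2; apply/andP; split; lra.
move: xu; rewrite ler_norml => /andP[x1 x2].
have q1 := sqr_ge0 u1; have q2 := sqr_ge0 u2.
have Q0 : 0 <= Q by rewrite addr_ge0.
have XQ : X / 2 * Q <= s n.+1 / 16 * Q by rewrite ler_wpM2r//; lra.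
have A1 : 7 / 16 * s n.+1 * u1 ^+ 2 <= (a n + a n.+1) / 2 * u1 ^+ 2 by rewrite ler_wpM2r//; lra.
have A2 : 7 / 16 * s n.+1 * u2 ^+ 2 <= (a n.+1 + a n.+2) / 2 * u2 ^+ 2 by rewrite ler_wpM2r//; lra.
have B1 : (a n + a n.+1) / 2 * u1 ^+ 2 <= 2 * s n.+1 * u1 ^+ 2 by rewrite ler_wpM2r//; lra.
have B2 : (a n.+1 + a n.+2) / 2 * u2 ^+ 2 <= 2 * s n.+1 * u2 ^+ 2 by rewrite ler_wpM2r//; lra.
have E : s n.+1 * Q = s n.+1 * u1 ^+ 2 + s n.+1 * u2 ^+ 2 by rewrite /Q mulrDr.
have p1 := mulr_ge0 (ltW (sqrtS_gt0 n.+1)) q1; have p2 := mulr_ge0 (ltW (sqrtS_gt0 n.+1)) q2.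
clear -E x1 x2 XQ A1 A2 B1 B2 p1 p2.
by apply/andP; split; lra.
Qed.

Lemma jacobi_form_incr X x n : 0 <= X -> `|x| <= X ->
  (forall k, (n <= k)%N -> `|c k| <= s k / 8 /\ `|b k| <= s k / 8) -> 8 * X <= s n ->
  `|jacobi_form x n.+1 - jacobi_form x n| <= rel_incr X n * jacobi_form x n.
Proof.
move=> X0 xX cbs Xs.
have /andP[Vl _] := jacobi_form_bounds X0 xX (fun k nk => (cbs k nk).1) Xs.
have aS k : (n <= k)%N -> 7 / 8 * s k <= a k <= 9 / 8 * s k.
  by move=> /cbs[/a_bounds].
have /andP[l1 r1] := aS n.+1 (leqnSn _).
have /andP[l2 r2] := aS n.+2 (leqW (leqnSn _)).
have [_ b2] := cbs n.+2 (leqW (leqnSn _)).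
have m0 := sqrtS_le (leqnSn n); have m1 := sqrtS_le (leqnSn n.+1).
have E := jacobiP_SS b a_gt0 n.+1 x.
have dE k : a k.+1 - a k = g k + d k by rewrite /d !cE /g /s; ring.
have s0 := sqrtS_gt0 n; have s1 := sqrtS_gt0 n.+1; have s2 := sqrtS_gt0 n.+2.
rewrite {1}/jacobi_form (increment_identity (a n) (a n.+3) E) !dE.
have B : `|(g n.+2 + d n.+2) / 2 * jacobiP a b n.+3 x ^+ 2 +
   (g n + d n) / 2 * jacobiP a b n.+1 x ^+ 2 +
   (g n.+1 + d n.+1) * (jacobiP a b n.+3 x * jacobiP a b n.+1 x) -
   b n.+2 * jacobiP a b n.+2 x * (jacobiP a b n.+3 x - jacobiP a b n.+1 x)| <=
   20 * ((X + 1) / s n.+1 ^+ 3 + (g n - g n.+2) +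
     (`|d n| + `|d n.+1| + `|d n.+2| + `|b n.+2|) / s n.+1) * (s n.+1 * sqden a b n.+1 x).
  apply: (@increment_bound R X (s n.+1) (g n) (g n.+1) (g n.+2) (d n) (d n.+1) (d n.+2) (a n.+1) (a n.+2) x) => //.
  - exact: sqrtS_ge1.
  - by rewrite sqrt_incr_ge0 sqrt_incr_noninc.
  - exact: sqrt_incr_noninc.
  - exact: sqrt_incr_le.
  - by lra.
  - by rewrite (ltW (a_gt0 _))/=; lra.
  - by lra.
apply: (le_trans B).
set Q := sqden _ _ _ _ in Vl *.
have Q0 : 0 < Q by exact: sqden_gt0.
have dd : (`|d n| + `|d n.+1| + `|d n.+2| + `|b n.+2|) / s n.+1 <= 2 * (perturb n + perturb n.+1 + perturb n.+2).
  have k0 : `|d n| / s n.+1 <= perturb n.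
    apply: ler_pM => //; first by rewrite invr_ge0 ltW.
      by rewrite lerDl.
    by rewrite lef_pV2.
  have k1 : `|d n.+1| / s n.+1 <= perturb n.+1.
    by apply: ler_wpM2r; [rewrite invr_ge0 ltW|rewrite lerDl].
  have k2 : (`|d n.+2| + `|b n.+2|) / s n.+1 <= 2 * perturb n.+2.
    rewrite /perturb mulrCA; apply: ler_wpM2l; first by rewrite addr_ge0.
    rewrite -[leRHS]invrK lef_pV2 ?posrE ?invr_gt0 ?divr_gt0//.
    by rewrite invfM invrK ler_pdivrMl//; exact: sqrtS_le_double.
  have -> : (`|d n| + `|d n.+1| + `|d n.+2| + `|b n.+2|) / s n.+1 =
    `|d n| / s n.+1 + `|d n.+1| / s n.+1 + (`|d n.+2| + `|b n.+2|) / s n.+1 by ring.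
  have := perturb_ge0 n; have := perturb_ge0 n.+1.
  by lra.
have h1 : 0 <= (X + 1) / s n.+1 ^+ 3.
  by rewrite divr_ge0 ?exprn_ge0 ?(ltW (sqrtS_gt0 _))//; lra.
have h2 : 0 <= g n - g n.+2.
  by rewrite subr_ge0 (le_trans (sqrt_incr_noninc _))// sqrt_incr_noninc.
apply: (@le_trans _ _ (rel_incr X n * (s n.+1 * Q / 4))); last first.
  by rewrite ler_wpM2l ?rel_incr_ge0.
have -> : rel_incr X n * (s n.+1 * Q / 4) = rel_incr X n / 4 * (s n.+1 * Q) by ring.
rewrite ler_wpM2r ?(ltW (mulr_gt0 _ _))// /rel_incr.
have := perturb_ge0 n; have := perturb_ge0 n.+1; have := perturb_ge0 n.+2.
move: dd h1 h2; clear.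
move: ((X + 1) / s n.+1 ^+ 3) (g n - g n.+2) (_ / s n.+1) => p q r; lra.
Qed.

Let w (x : R) (n : nat) : R := (s n * sqden a b n x)^-1.

(** [slow_variation] applied to the quadratic form. The constants N and k
    depend on the bound X for |x| only. *)
Lemma jacobi_form_limit X : 0 <= X -> exists N (k : R), 0 < k /\
  forall x, `|x| <= X -> (exists2 L : R, 0 < L & jacobi_form x @ \oo --> L) /\
  forall n, (N <= n)%N -> k * sqden a b N.+1 x <= jacobi_form x n /\
     jacobi_form x n <= 4 * (s n.+1 * sqden a b n.+1 x).
Proof.
move=> X0; have [N NP] := eventually_small_perturb X0.
pose k := s N.+1 / 4 * expR (- 2 * limn (series (rel_incr X))).
exists N, k; split; first by rewrite /k mulr_gt0 ?expR_gt0// divr_gt0// sqrtS_gt0.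
move=> x xX.
have V1 n : (N <= n)%N -> s n.+1 * sqden a b n.+1 x / 4 <= jacobi_form x n
    <= 4 * (s n.+1 * sqden a b n.+1 x).
  move=> Nn; apply: (jacobi_form_bounds X0 xX) => [j nj|].
    by have [] := NP j (leq_trans Nn nj).
  by have [] := NP n Nn.
have V0 n : (N <= n)%N -> 0 < jacobi_form x n.
  move=> /V1/andP[h _]; apply: lt_le_trans h.
  by rewrite divr_gt0// mulr_gt0 ?sqrtS_gt0// sqden_gt0.
have [|HL HB] := slow_variation V0 (fun n => @rel_incr_ge0 X n X0) (@cvg_rel_incr X).
  move=> n Nn; have [_ h1 _ h2] := NP n Nn; split=> //.
  apply: jacobi_form_incr => // j nj; have [] := NP j (leq_trans Nn nj) => //.
split=> // n Nn; split; last by have /andP[] := V1 n Nn.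
apply: le_trans (HB n Nn); have /andP[h _] := V1 N (leqnn _).
rewrite /k mulrAC ler_wpM2r ?expR_ge0//; apply: le_trans h.
by rewrite mulrAC.
Qed.

(** Since c_n = o(sqrt n), the coefficients of the form are asymptotic to
    sqrt(n+2), and its cross term is of lower order. *)
Lemma jacobi_form_ratio x :
  (fun n => jacobi_form x n / (s n.+1 * sqden a b n.+1 x)) @ \oo --> (1 : R).
Proof.
pose r (n : nat) : R := `|c n / s n| + `|c n.+1 / s n.+1| + 2 * `|c n.+2 / s n.+2|
  + (1 + `|x|) * (s n.+1)^-1.
have key n : `|jacobi_form x n / (s n.+1 * sqden a b n.+1 x) - 1| <= r n.
  have s0 := sqrtS_gt0 n; have s1 := sqrtS_gt0 n.+1; have s2 := sqrtS_gt0 n.+2.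
  have Q0 : 0 < sqden a b n.+1 x by exact: sqden_gt0.
  have sQ0 : 0 < s n.+1 * sqden a b n.+1 x by rewrite mulr_gt0.
  have -> : jacobi_form x n / (s n.+1 * sqden a b n.+1 x) - 1 =
    (jacobi_form x n - s n.+1 * sqden a b n.+1 x) / (s n.+1 * sqden a b n.+1 x).
    by rewrite [RHS]mulrBl (mulfV (lt0r_neq0 sQ0)).
  rewrite normrM normfV (gtr0_norm sQ0) ler_pdivrMr//.
  have aE k : a k = c k + s k by rewrite cE /s; ring.
  have gg : `|g n| <= 1 by rewrite ger0_norm ?sqrt_incr_ge0// (le_trans (sqrt_incr_le _))// invf_le1// sqrtS_ge1.
  have gg1 : `|g n.+1| <= 1 by rewrite ger0_norm ?sqrt_incr_ge0// (le_trans (sqrt_incr_le _))// invf_le1// sqrtS_ge1.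
  have : (a n + a n.+1) / 2 - s n.+1 = (c n + c n.+1) / 2 - g n / 2.
    by rewrite !aE /g; field.
  have : (a n.+1 + a n.+2) / 2 - s n.+1 = (c n.+1 + c n.+2) / 2 + g n.+1 / 2.
    by rewrite !aE /g; field.
  set p2 := _ - s n.+1; move=> p2E; set p1 := _ - s n.+1; move=> p1E.
  have rs : `|c n| + `|c n.+1| + `|c n.+2| + 1 + `|x| <= r n * s n.+1.
    have -> : r n * s n.+1 = `|c n| / s n * s n.+1 + `|c n.+1| +
        2 * (`|c n.+2| / s n.+2) * s n.+1 + (1 + `|x|).
      rewrite /r !(normrM (c _)) !(normfV (s _)) (gtr0_norm s0) (gtr0_norm s1) (gtr0_norm s2).
      by field; rewrite !lt0r_neq0.
    have h1 : `|c n| <= `|c n| / s n * s n.+1.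
      by rewrite mulrAC ler_pdivlMr// ler_wpM2l// sqrtS_le.
    have h2 : `|c n.+2| <= 2 * (`|c n.+2| / s n.+2) * s n.+1.
      rewrite mulrA mulrAC ler_pdivlMr// -[leRHS]mulrA (mulrC 2) -mulrA.
      by rewrite ler_wpM2l// mulrC sqrtS_le_double.
    by lra.
  rewrite mulrA; apply: le_trans (ler_wpM2r (ltW Q0) rs).
  rewrite /jacobi_form /sqden; move: (jacobiP a b n.+1 x) (jacobiP a b n.+2 x) => u1 u2.
  have -> : (a n + a n.+1) / 2 * u1 ^+ 2 + (a n.+1 + a n.+2) / 2 * u2 ^+ 2 - x * u1 * u2 -
    s n.+1 * (u1 ^+ 2 + u2 ^+ 2) = p1 * u1 ^+ 2 + p2 * u2 ^+ 2 - x * (u1 * u2).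
    by rewrite /p1 /p2; ring.
  have q1 := sqr_ge0 u1; have q2 := sqr_ge0 u2.
  have xu : `|x * (u1 * u2)| <= `|x| * (u1 ^+ 2 + u2 ^+ 2).
    rewrite normrM ler_wpM2l// ler_norml.
    have := sqr_ge0 (u1 + u2); have := sqr_ge0 (u1 - u2); move: q1 q2; rewrite !expr2.
    by move=> *; apply/andP; split; lra.
  have b1 : `|p1| <= `|c n| + `|c n.+1| + 1.
    rewrite p1E; apply: le_trans (ler_normB _ _) _; rewrite !normrM.
    have := ler_normD (c n) (c n.+1); rewrite (@ger0_norm _ 2^-1) ?invr_ge0//.
    have := normr_ge0 (c n); have := normr_ge0 (c n.+1); lra.
  have b2 : `|p2| <= `|c n.+1| + `|c n.+2| + 1.
    rewrite p2E; apply: le_trans (ler_normD _ _) _; rewrite !normrM.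
    have := ler_normD (c n.+1) (c n.+2); rewrite (@ger0_norm _ 2^-1) ?invr_ge0//.
    have := normr_ge0 (c n.+1); have := normr_ge0 (c n.+2); lra.
  apply: le_trans (ler_normB _ _) _; apply: le_trans (lerD (ler_normD _ _) (lexx _)) _.
  rewrite (normrM p1) (normrM p2) (ger0_norm q1) (ger0_norm q2).
  have := ler_wpM2r q1 b1; have := ler_wpM2r q2 b2.
  have := mulr_ge0 (normr_ge0 (c n)) q2; have := mulr_ge0 (normr_ge0 (c n.+2)) q1.
  by move: xu; clear -q1 q2; lra.
have r0 : r @ \oo --> (0 : R).
  have c0 : (fun n => `|c n / s n|) @ \oo --> (0 : R).
    by rewrite -(normr0 R); apply: cvg_norm; exact: cvg_c_div_sqrtS.
  have c1 : (fun n => `|c n.+1 / s n.+1|) @ \oo --> (0 : R).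
    by rewrite -(cvg_shiftS (fun n => `|c n / s n|)) in c0.
  have c2 : (fun n => `|c n.+2 / s n.+2|) @ \oo --> (0 : R).
    by rewrite -(cvg_shiftS (fun n => `|c n.+1 / s n.+1|)) in c1.
  have sV : (fun n => (s n.+1)^-1) @ \oo --> (0 : R).
    rewrite (cvg_shiftS (fun n => (s n)^-1)).
    by apply/gtr0_cvgV0; [apply: nearW => n; exact: sqrtS_gt0|exact: sqrtS_cvgy].
  rewrite [X in _ --> X](_ : 0 = 0 + 0 + 2 * 0 + (1 + `|x|) * 0); last first.
    by rewrite !mulr0 !addr0.
  apply: cvgD; last by apply: cvgM => //; exact: cvg_cst.
  by apply: cvgD; [exact: cvgD|apply: cvgM => //; exact: cvg_cst].
apply/cvgrPdist_le => e ep; near=> n.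
rewrite distrC; apply: le_trans (key n) _; apply: le_trans (ler_norm _) _.
by near: n; move/cvgr0Pnorm_le : r0; apply.
Unshelve. all: end_near. Qed.

Lemma weight_cvg x : exists2 W : R, 0 < W & w x @ \oo --> W.
Proof.
have [N [k [k0 H]]] := jacobi_form_limit (normr_ge0 x).
have [[L L0 VL] HN] := H x (lexx _).
exists L^-1; first by rewrite invr_gt0.
rewrite -(cvg_shiftS (w x)).
rewrite -[L^-1]mul1r.
refine (cvg_trans _ (cvgM (jacobi_form_ratio x) (cvgV (lt0r_neq0 L0) VL))).
apply: near_eq_cvg; near=> n.
have Nn : (N <= n)%N by near: n; exact: nbhs_infty_ge.
have V0 : 0 < jacobi_form x n.
  apply: lt_le_trans (HN n Nn).1; rewrite mulr_gt0//; exact: sqden_gt0.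
by rewrite /= /unstable.inv_fun mulrAC mulfV ?lt0r_neq0// mul1r.
Unshelve. all: end_near. Qed.

(** Bounding the form from below by its value at a fixed index N leaves
    P_(N+1)^2 + P_(N+2)^2, a continuous positive function, hence bounded
    below on [-X, X]. *)
Lemma weight_bounded X : 0 <= X -> exists N (C : R), 0 <= C /\
  forall n x, (N <= n)%N -> `|x| <= X -> w x n <= C.
Proof.
move=> X0; have [N [k [k0 H]]] := jacobi_form_limit X0.
have XX : - X <= X by lra.
have cq : {within `[- X, X], continuous (sqden a b N.+1)}.
  by apply: continuous_subspaceT; exact: continuous_sqden.
have [x0 x0X qmin] := EVT_min XX cq.
have q0 : 0 < sqden a b N.+1 x0 by exact: sqden_gt0.
exists N.+1, (4 / (k * sqden a b N.+1 x0)).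
have kq0 : 0 < k * sqden a b N.+1 x0 by rewrite mulr_gt0.
split; first by rewrite divr_ge0// ltW.
case=> // n x; rewrite ltnS => Nn xX.
have [_ /(_ n Nn)[h1 h2]] := H x xX.
have Q0 : 0 < s n.+1 * sqden a b n.+1 x by rewrite mulr_gt0 ?sqrtS_gt0 ?sqden_gt0.
have h3 : k * sqden a b N.+1 x0 <= k * sqden a b N.+1 x.
  by rewrite ler_pM2l// qmin// in_itv/= -ler_norml.
rewrite /w ler_pdivlMr// ler_pdivrMl// [_ * 4]mulrC.
by apply: le_trans h2; exact: le_trans h1.
Qed.

Lemma sqrt_div_a_cvg1 : (fun n => s n / a n) @ \oo --> (1 : R).
Proof.
have h : (fun n => (1 + c n / s n)^-1) @ \oo --> ((1 + 0)^-1 : R).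
  apply: cvgV; first by rewrite addr0 oner_neq0.
  by apply: cvgD; [exact: cvg_cst|exact: cvg_c_div_sqrtS].
move: h; rewrite addr0 invr1; apply: cvg_trans; apply: near_eq_cvg; near=> n.
have s0 := lt0r_neq0 (sqrtS_gt0 n).
have -> : a n = s n * (1 + c n / s n).
  by rewrite mulrDr mulr1 mulrCA mulfV// mulr1 cE /s; ring.
by rewrite invfM mulrA divff// mul1r.
Unshelve. all: end_near. Qed.

(** Comparison with the harmonic series: a_n grows at most linearly. *)
Lemma carleman : (fun n => \sum_(0 <= k < n) (a k)^-1) @ \oo --> +oo.
Proof.
have [N NP] := eventually_small_perturb (lexx 0).
pose M := 2 + \sum_(0 <= k < N) a k.
have M2 : 2 <= M by rewrite lerDl sumr_ge0// => k _; exact: ltW.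
have h k : 0 <= (k.+1%:R^-1 : R) <= M * (a k)^-1.
  rewrite invr_ge0 ler0n/= ler_pdivlMr// mulrC ler_pdivrMr// .
  have [Nk|kN] := leqP N k.
    have [+ _ _ _] := NP k Nk; rewrite cE ler_norml -/(s k) => /andP[_ h1].
    have k1 : 1 <= k.+1%:R :> R by rewrite ler1n.
    have sk : s k <= k.+1%:R.
      rewrite -(sqr_sqrtS k) expr2.
      by have := ler_wpM2l (ltW (sqrtS_gt0 k)) (sqrtS_ge1 k); rewrite mulr1.
    by have := ler_wpM2r (ler0n R k.+1) M2; lra.
  have : a k <= M.
    rewrite /M (bigD1_seq k) ?mem_index_iota ?iota_uniq//=.
    rewrite addrCA lerDl addr_ge0// sumr_ge0// => j _; exact: ltW.
  by move=> /le_trans; apply; rewrite ler_peMr ?ler1n//; lra.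
apply: nondecreasing_dvgn_lt.
  by apply: nondecreasing_series => k _ _; rewrite invr_ge0 ltW.
move=> ca; apply: (@dvg_harmonic R).
apply: (cvg_series_le h).
rewrite -/(M *: (fun k => (a k)^-1)).
exact: is_cvg_seriesZ.
Qed.

End Asymptotics.

(** * The real inner product of square-summable sequences *)

Section Ell2.
Context {R : realType}.
Implicit Types (u v w : l2 R) (z : R[i]).
Local Notation Re := (@complex.Re R).
Local Notation Im := (@complex.Im R).
Local Notation "x %:C" := (real_complex R x).

Definition cdot (x y : R[i]) : R := Re x * Re y + Im x * Im y.

(** Working with the real part of the inner product keeps all computations
    real; the imaginary part is recovered from [l2dotE]. *)
Definition rdot u v : R := Re (l2dot u v).
Definition sqnorm u : R := rdot u u.

Lemma cdotxx x : cdot x x = sqmod x. Proof. by rewrite /cdot /sqmod !expr2. Qed.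

Lemma Re_mulJ (x y : R[i]) : Re (x * conjc y) = cdot x y.
Proof. by case: x y => [p q] [r s]; rewrite /cdot/=; ring. Qed.

Lemma Im_mulJ (x y : R[i]) : Im (x * conjc y) = cdot x ('i%C * y).
Proof. by case: x y => [p q] [r s]; rewrite /cdot/=; ring. Qed.

Lemma norm_cdot_le (x y : R[i]) : `|cdot x y| <= (sqmod x + sqmod y) / 2.
Proof.
case: x y => [p q] [r s]; rewrite /cdot /sqmod/= ler_norml.
have := sqr_ge0 (p - r); have := sqr_ge0 (p + r).
have := sqr_ge0 (q - s); have := sqr_ge0 (q + s).
by rewrite !expr2 => *; apply/andP; split; lra.
Qed.

Lemma cvg_sqmod u : cvgn (series (fun n => sqmod (u n))).
Proof.
apply: cvg_series_lty => [n|]; first exact: sqmod_ge0.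
by have := l2valP u; rewrite inE.
Qed.

Lemma cvg_cdot u v : cvgn (series (fun n => cdot (u n) (v n))).
Proof.
apply: normed_cvg.
apply: (@series_le_cvg _ _ (2^-1 *: ((fun n => sqmod (u n)) + (fun n => sqmod (v n))))) => n.
- exact: normr_ge0.
- by rewrite (_ : (2^-1 *: _) n = 2^-1 * (sqmod (u n) + sqmod (v n)))// mulr_ge0 ?invr_ge0// addr_ge0 ?sqmod_ge0.
- by rewrite (_ : (2^-1 *: _) n = 2^-1 * (sqmod (u n) + sqmod (v n)))// mulrC norm_cdot_le.
- by apply: is_cvg_seriesZ; apply: is_cvg_seriesD; exact: cvg_sqmod.
Qed.

Lemma rdotE u v : rdot u v = limn (series (fun n => cdot (u n) (v n))).
Proof.
by rewrite /rdot /l2dot/=; under [X in series X]eq_fun do rewrite Re_mulJ.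
Qed.

Lemma cvg_rdot u v : series (fun n => cdot (u n) (v n)) @ \oo --> rdot u v.
Proof. by rewrite rdotE; exact: cvg_cdot. Qed.

Lemma rdot_unique u v (l : R) :
  series (fun n => cdot (u n) (v n)) @ \oo --> l -> rdot u v = l.
Proof. by move=> h; rewrite rdotE; exact: cvg_lim. Qed.

Lemma l2valZ z u n : (z *: u) n = z * u n. Proof. by []. Qed.
Lemma Im_l2dot u v : Im (l2dot u v) = rdot u ('i%C *: v).
Proof.
by rewrite rdotE /l2dot/=; under [X in series X]eq_fun do rewrite Im_mulJ.
Qed.

Lemma l2dotE u v : l2dot u v = Complex (rdot u v) (rdot u ('i%C *: v)).
Proof. by rewrite -Im_l2dot /rdot; case: (l2dot u v). Qed.

Lemma rdotC u v : rdot u v = rdot v u.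
Proof.
rewrite !rdotE; congr (limn (series _)); apply/funext => n.
by rewrite /cdot; ring.
Qed.

Lemma rdotDl u v w : rdot (u + v) w = rdot u w + rdot v w.
Proof.
apply: rdot_unique; rewrite (_ : series _ = series (fun n => cdot (u n) (w n))
  + series (fun n => cdot (v n) (w n))).
  by apply: cvgD; exact: cvg_rdot.
apply/funext => n; rewrite /series/= !fctE -big_split; apply: eq_bigr => k _.
rewrite /cdot/=; case: (u k) (v k) => [p q] [r s]/=; ring.
Qed.

Lemma rdotZl (c : R) u v : rdot (c%:C *: u) v = c * rdot u v.
Proof.
apply: rdot_unique; rewrite (_ : series _ = (fun n => c * series (fun n => cdot (u n) (v n)) n)).
  by apply: cvgM; [exact: cvg_cst|exact: cvg_rdot].
apply/funext => n; rewrite /series/= mulr_sumr; apply: eq_bigr => k _.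
change (cdot (c%:C * u k) (v k) = c * cdot (u k) (v k)).
rewrite /cdot; case: (u k) (v k) => [p q] [r s]/=; ring.
Qed.

Lemma rdotii u v : rdot ('i%C *: u) ('i%C *: v) = rdot u v.
Proof.
rewrite !rdotE; congr (limn (series _)); apply/funext => n.
by rewrite !l2valZ /cdot; case: (u n) (v n) => [p q] [r s]/=; ring.
Qed.

Lemma rdotDr u v w : rdot u (v + w) = rdot u v + rdot u w.
Proof. by rewrite rdotC rdotDl !(rdotC u). Qed.
Lemma rdotZr (c : R) u v : rdot u (c%:C *: v) = c * rdot u v.
Proof. by rewrite rdotC rdotZl rdotC. Qed.
Lemma rdotNl u v : rdot (- u) v = - rdot u v.
Proof.
by rewrite -scaleN1r (_ : -1 = (-1)%:C) ?rdotZl ?mulN1r// rmorphN rmorph1.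
Qed.
Lemma rdotNr u v : rdot u (- v) = - rdot u v.
Proof. by rewrite rdotC rdotNl rdotC. Qed.
Lemma rdotBl u v w : rdot (u - v) w = rdot u w - rdot v w.
Proof. by rewrite rdotDl rdotNl. Qed.
Lemma rdotBr u v w : rdot u (v - w) = rdot u v - rdot u w.
Proof. by rewrite rdotDr rdotNr. Qed.

Lemma rdot0r u : rdot u 0 = 0.
Proof. by rewrite -(subrr (0 : l2 R)) rdotBr subrr. Qed.

Lemma i_scale_i u : 'i%C *: ('i%C *: u) = - u.
Proof. by rewrite scalerA -expr2 sqr_i scaleN1r. Qed.

Lemma rdotir u v : rdot u ('i%C *: v) = - rdot ('i%C *: u) v.
Proof. by rewrite -rdotii i_scale_i rdotNr. Qed.

Lemma sqnormE u : sqnorm u = limn (series (fun n => sqmod (u n))).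
Proof. by rewrite /sqnorm rdotE; under [X in series X]eq_fun do rewrite cdotxx. Qed.

Lemma sqnorm_ge0 u : 0 <= sqnorm u. Proof. exact: Re_l2dot_ge0. Qed.

Lemma l2normE u : l2norm u = Num.sqrt (sqnorm u).
Proof. by rewrite /l2norm sqnormE. Qed.

Lemma sqr_l2norm u : l2norm u ^+ 2 = sqnorm u.
Proof. by rewrite l2normE sqr_sqrtr// sqnorm_ge0. Qed.

Lemma l2norm_ge0 u : 0 <= l2norm u. Proof. by rewrite l2normE sqrtr_ge0. Qed.

Lemma sqmod_le_sqnorm u n : sqmod (u n) <= sqnorm u.
Proof.
rewrite sqnormE; apply: (@le_trans _ _ (series (fun n => sqmod (u n)) n.+1)).
  by rewrite /series/= big_nat_recr//= lerDr sumr_ge0// => k _; exact: sqmod_ge0.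
apply: nondecreasing_cvgn_le; last exact: cvg_sqmod.
by apply: nondecreasing_series => k _ _; exact: sqmod_ge0.
Qed.

Lemma sqnorm_eq0 u : sqnorm u = 0 -> u = 0.
Proof.
move=> u0; apply/val_inj/funext => n /=.
have := sqmod_le_sqnorm u n; rewrite u0 => h.
have : sqmod (u n) = 0 by apply/eqP; rewrite eq_le h sqmod_ge0.
case: (u n) => p q; rewrite /sqmod/= => /eqP.
by rewrite paddr_eq0 ?sqr_ge0// !sqrf_eq0 => /andP[/eqP -> /eqP ->].
Qed.

Lemma sqnormD u v : sqnorm (u + v) = sqnorm u + 2 * rdot u v + sqnorm v.
Proof. by rewrite /sqnorm rdotDl !rdotDr (rdotC v u); ring. Qed.
Lemma sqnormB u v : sqnorm (u - v) = sqnorm u - 2 * rdot u v + sqnorm v.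
Proof. by rewrite sqnormD rdotNr /sqnorm rdotNl rdotNr; ring. Qed.
Lemma sqnormZ (c : R) u : sqnorm (c%:C *: u) = c ^+ 2 * sqnorm u.
Proof. by rewrite /sqnorm rdotZl rdotZr; ring. Qed.

Lemma CauchySchwarz u v : rdot u v ^+ 2 <= sqnorm u * sqnorm v.
Proof.
have [v0|v0] := eqVneq (sqnorm v) 0.
  have -> : v = 0 by exact: sqnorm_eq0.
  by rewrite rdot0r expr0n/= mulr_ge0// sqnorm_ge0.
have := sqnorm_ge0 ((sqnorm v)%:C *: u - (rdot u v)%:C *: v).
rewrite sqnormB !sqnormZ rdotZl rdotZr.
have vp : 0 < sqnorm v by rewrite lt0r v0 sqnorm_ge0.
move: vp; move: (sqnorm v) (sqnorm u) (rdot u v) => p q r p0 h.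
rewrite -(ler_pM2l p0) -subr_ge0; apply: le_trans h _.
by rewrite le_eqVlt; apply/orP; left; apply/eqP; ring.
Qed.

Lemma norm_rdot_le u v : `|rdot u v| <= l2norm u * l2norm v.
Proof.
rewrite -(@ler_pXn2r _ 2) ?nnegrE ?mulr_ge0 ?l2norm_ge0//.
by rewrite real_normK ?num_real// exprMn !sqr_l2norm CauchySchwarz.
Qed.

Lemma delta_l2E k n : delta_l2 k n = (n == k)%:R :> R[i]. Proof. by []. Qed.

Lemma rdot_delta u k : rdot u (delta_l2 k) = Re (u k).
Proof.
apply: rdot_unique; apply: cvg_near_cst; exists k.+1 => // n /= kn.
rewrite /series/= (bigD1_seq k) ?mem_index_iota ?iota_uniq//=.
rewrite big1 ?addr0 => [|j jk].
  by rewrite eqxx /cdot/= mulr1 mulr0 addr0.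
by rewrite (negbTE jk) /cdot/= !mulr0 addr0.
Qed.

Lemma rdot_idelta u k : rdot u ('i%C *: delta_l2 k) = Im (u k).
Proof.
rewrite rdotir rdot_delta l2valZ.
by case: (u k) => p q /=; ring.
Qed.

Lemma sqnorm_delta k : sqnorm (delta_l2 k) = 1.
Proof. by rewrite /sqnorm rdot_delta delta_l2E eqxx. Qed.

Lemma in_l2_fin (u : nat -> R[i]) : finitely_supported u -> u \in in_l2.
Proof.
move=> [N uN]; rewrite inE/= (@nneseries_split _ _ 0 N) ?add0n; last first.
  by move=> n _; rewrite lee_fin sqmod_ge0.
rewrite [X in (_ + X)%E]eseries0 ?adde0; last first.
  by move=> n Nn _; rewrite uN// /sqmod/= expr0n/= addr0.
by rewrite sumEFin ltry.
Qed.

Lemma sqnorm_fin u N : (forall n, (N <= n)%N -> u n = 0) ->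
  sqnorm u = \sum_(0 <= n < N) sqmod (u n).
Proof.
move=> uN; rewrite sqnormE; apply/cvg_lim => //; apply: cvg_near_cst.
exists N => // n /= Nn; rewrite /series/= (@big_cat_nat _ _ _ N)//=.
rewrite [X in _ + X]big_nat_cond [X in _ + X]big1 ?addr0// => k /andP[/andP[Nk _] _].
by rewrite uN// /sqmod/= expr0n/= addr0.
Qed.

End Ell2.

(** * The maximal Jacobi operator and self-adjointness *)

Section JacobiOperator.
Context {R : realType}.
Variables a b : nat -> R.
Hypothesis a_gt0 : forall n, 0 < a n.
Local Notation Re := (@complex.Re R).
Local Notation Im := (@complex.Im R).
Local Notation "x %:C" := (real_complex R x).
Implicit Types u v : nat -> R[i].

Definition jacobi_max : set (l2 R * l2 R) :=
  [set p : l2 R * l2 R | forall n, p.2 n = jacobi_expr a b p.1 n].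

Lemma jacobi_exprD u v n : jacobi_expr a b (fun k => u k + v k) n =
  jacobi_expr a b u n + jacobi_expr a b v n.
Proof. by rewrite /jacobi_expr; case: n => [|n]; ring. Qed.

Lemma jacobi_exprZ (z : R[i]) u n : jacobi_expr a b (fun k => z * u k) n =
  z * jacobi_expr a b u n.
Proof. by rewrite /jacobi_expr; case: n => [|n]; ring. Qed.

Lemma jacobi_maxD (u1 v1 u2 v2 : l2 R) : jacobi_max (u1, v1) -> jacobi_max (u2, v2) ->
  jacobi_max (u1 + u2, v1 + v2).
Proof.
move=> h1 h2 n; have := jacobi_exprD u1 u2 n.
by rewrite -(h1 n) -(h2 n) => E; exact: esym E.
Qed.

Lemma jacobi_maxZ (z : R[i]) (u1 v1 : l2 R) : jacobi_max (u1, v1) -> jacobi_max (z *: u1, z *: v1).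
Proof.
move=> h1 n; have := jacobi_exprZ z u1 n.
by rewrite -(h1 n) => E; exact: esym E.
Qed.

Lemma jacobi_maxB (u1 v1 u2 v2 : l2 R) : jacobi_max (u1, v1) -> jacobi_max (u2, v2) ->
  jacobi_max (u1 - u2, v1 - v2).
Proof.
move=> h1 h2; rewrite -(scaleN1r u2) -(scaleN1r v2).
by apply: jacobi_maxD => //; exact: jacobi_maxZ.
Qed.

Lemma cdot_real (c : R) (x y : R[i]) : cdot (c%:C * x) y = c * cdot x y.
Proof. by case: x y => [p q] [r s]; rewrite /cdot/=; ring. Qed.

Lemma cdotC (x y : R[i]) : cdot x y = cdot y x.
Proof. by rewrite /cdot; ring. Qed.

Lemma cdotDl (x y z : R[i]) : cdot (x + y) z = cdot x z + cdot y z.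
Proof. by case: x y z => [p q] [r s] [t w]; rewrite /cdot/=; ring. Qed.

Lemma cdot0 (x : R[i]) : cdot 0 x = 0.
Proof. by rewrite /cdot/= !mul0r addr0. Qed.

Lemma green_cdot u v N :
  \sum_(0 <= n < N.+1) (cdot (jacobi_expr a b u n) (v n) - cdot (u n) (jacobi_expr a b v n))
  = a N * (cdot (u N.+1) (v N) - cdot (u N) (v N.+1)).
Proof.
elim: N => [|N IH].
  rewrite big_nat1 /jacobi_expr !add0r (cdotC (u 0%N)) !cdotDl !cdot_real.
  by rewrite /cdot; ring.
rewrite big_nat_recr//= IH /jacobi_expr (cdotC (u N.+1) (_ + _)) !cdotDl !cdot_real.
by rewrite /cdot; ring.
Qed.

Lemma jacobi_expr_fin u N : (forall n, (N <= n)%N -> u n = 0) ->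
  forall n, (N < n)%N -> jacobi_expr a b u n = 0.
Proof.
move=> uN [|n]// Nn; have h0 := uN n Nn; have h1 := uN n.+1 (leqW Nn).
have h2 := uN n.+2 (leqW (leqW Nn)).
by rewrite /jacobi_expr h0 h1 h2 !mulr0 !addr0.
Qed.

Lemma jacobi_expr_finite u : finitely_supported u ->
  finitely_supported (jacobi_expr a b u).
Proof. by move=> [N uN]; exists N.+1 => n; exact: jacobi_expr_fin. Qed.

Definition l2fin u (uf : finitely_supported u) : l2 R := L2 (in_l2_fin uf).

Lemma jacobi0P u (uf : finitely_supported u) :
  jacobi0 a b (l2fin uf, l2fin (jacobi_expr_finite uf)).
Proof. by split. Qed.

Lemma jacobi0_max : jacobi0 a b `<=` jacobi_max.
Proof. by move=> p []. Qed.

Lemma rdot_jacobi0 (q1 q2 p : l2 R) : jacobi0 a b (q1, q2) ->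
  exists N, rdot q2 p = \sum_(0 <= n < N) cdot (q1 n) (jacobi_expr a b p n) /\
    (forall n, (N <= n)%N -> q1 n = 0).
Proof.
move=> [[N qN] /= qE]; exists N.+1; split; last by move=> n /ltnW; exact: qN.
apply: rdot_unique; apply: cvg_near_cst; exists N.+1 => // -[//|n] /= Nn.
rewrite /series/=.
have -> : \sum_(0 <= k < N.+1) cdot (q1 k) (jacobi_expr a b p k) =
          \sum_(0 <= k < n.+1) cdot (q1 k) (jacobi_expr a b p k).
  rewrite [RHS](@big_cat_nat _ _ _ N.+1)//=.
  rewrite [X in _ + X]big_nat_cond [X in _ + X]big1 ?addr0// => k /andP[/andP[Nk _] _].
  by rewrite qN ?cdot0// ltnW.
apply/eqP; rewrite -subr_eq0 -sumrB; apply/eqP.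
under eq_bigr do rewrite qE.
by rewrite green_cdot (qN n)// (qN n.+1)// ?cdot0 ?subrr ?mulr0// leqW.
Qed.

Lemma rdot_jacobi0_max (q1 q2 p1 p2 : l2 R) : jacobi0 a b (q1, q2) ->
  jacobi_max (p1, p2) -> rdot q2 p1 = rdot q1 p2.
Proof.
move=> q0 pm; have [N [-> qN]] := rdot_jacobi0 p1 q0.
apply/esym/rdot_unique; apply: cvg_near_cst; exists N => // n /= Nn.
rewrite /series/= (@big_cat_nat _ _ _ N)//=.
rewrite [X in _ + X]big_nat_cond [X in _ + X]big1 ?addr0// => [|k /andP[/andP[Nk _] _]].
  by apply: eq_bigr => k _; rewrite (pm k).
by rewrite qN ?cdot0.
Qed.

Lemma sqnorm_le (w : l2 R) (C : R) :
  (forall N, \sum_(0 <= n < N) sqmod (w n) <= C) -> sqnorm w <= C.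
Proof.
move=> h; rewrite sqnormE; apply: limr_le; first exact: cvg_sqmod.
exact: nearW.
Qed.

Lemma sum_sqmod_le (w : l2 R) N : \sum_(0 <= n < N) sqmod (w n) <= sqnorm w.
Proof.
rewrite sqnormE; apply: (@nondecreasing_cvgn_le _ (series (fun n => sqmod (w n)))).
  by apply: nondecreasing_series => k _ _; exact: sqmod_ge0.
exact: cvg_sqmod.
Qed.

Lemma sqmod_tail (w : l2 R) (e : R) : 0 < e -> exists M, forall N,
  (M <= N)%N -> \sum_(M <= n < N) sqmod (w n) <= e.
Proof.
move=> e0; have := @cvg_sqmod R w; rewrite -sqnormE => cw.
have [M _ /(_ M (leqnn _))] := (cvgrPdist_le _ _).1 cw e e0.
rewrite /series/= => h; exists M => N MN.
have := sum_sqmod_le w N; rewrite (@big_cat_nat _ _ _ M)//=.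
move: h; rewrite ler_norml => /andP[_ h].
by lra.
Qed.

Hypothesis carl : (fun n => \sum_(0 <= k < n) (a k)^-1) @ \oo --> +oo.
Let A n : R := \sum_(0 <= k < n) (a k)^-1.

Lemma sum_aV_ge0 n : 0 <= A n.
Proof. by apply: sumr_ge0 => k _; rewrite invr_ge0 ltW. Qed.

Lemma sum_aV_le m n : (m <= n)%N -> A m <= A n.
Proof.
move=> mn; rewrite /A (@big_cat_nat _ _ _ m 0 n)//= lerDl.
by apply: sumr_ge0 => k _; rewrite invr_ge0 ltW.
Qed.

(** Equal to 1 up to terms of order 1/S on every initial segment, and
    finitely supported when the a_n^(-1) have an infinite sum. Its
    increments are at most 1 / (a_n S), so that multiplication by it
    commutes with the Jacobi expression up to an error of norm O(1/S). *)
Definition cutoff (S : R) n : R := Num.max 0 (1 - A n / S).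

Lemma cutoff_bounds S n : 0 < S -> 0 <= cutoff S n <= 1.
Proof.
move=> S0; rewrite /cutoff le_max lexx/= ge_max ler01/=.
by rewrite gerBl divr_ge0 ?sum_aV_ge0// ltW.
Qed.

Lemma cutoff_near1 S n : 0 < S -> 1 - cutoff S n <= A n / S.
Proof.
move=> S0; rewrite /cutoff.
have : 1 - A n / S <= Num.max 0 (1 - A n / S) by rewrite le_max lexx orbT.
by lra.
Qed.

Lemma cutoff_lip S n : 0 < S -> `|cutoff S n.+1 - cutoff S n| <= (a n * S)^-1.
Proof.
move=> S0; have AE : A n.+1 / S = A n / S + (a n * S)^-1.
  by rewrite /A big_nat_recr//= mulrDl invfM.
rewrite /cutoff AE.
have p0 : 0 < (a n * S)^-1 by rewrite invr_gt0 mulr_gt0.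
move: p0; move: (a n * S)^-1 (A n / S) => d x d0.
rewrite /Num.max; case: ifPn; case: ifPn; rewrite -?leNgt => h1 h2;
  rewrite ler_norml; apply/andP; split; lra.
Qed.

Lemma cutoff_finite S u : 0 < S -> finitely_supported (fun n => (cutoff S n)%:C * u n).
Proof.
move=> S0; move/cvgryPge : carl => /(_ S)[N _ NP]; exists N => n Nn.
have AS : S <= A n by exact: NP.
rewrite /cutoff max_l ?rmorph0 ?mul0r//.
by rewrite subr_le0 ler_pdivlMr// mul1r.
Qed.

(** The sum splits at an index M: beyond M the tail of w is small, and
    below M the factor 1 - cutoff is at most A_M / S, where A_M is the sum
    of the first M terms a_k^(-1). *)
Lemma cutoff_tail (w : l2 R) (e : R) : 0 < e -> exists S0 : R, 0 < S0 /\ forall S, S0 <= S ->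
  forall N, \sum_(0 <= n < N) (1 - cutoff S n) ^+ 2 * sqmod (w n) <= e.
Proof.
move=> e0; have e2 : 0 < e / 2 by rewrite divr_gt0.
have [M MP] := sqmod_tail w e2.
pose C := A M ^+ 2 * sqnorm w.
have C0 : 0 <= C by rewrite mulr_ge0 ?sqr_ge0 ?sqnorm_ge0.
exists (1 + 2 * C / e); split.
  by have : 0 <= 2 * C / e := divr_ge0 (mulr_ge0 (ler0n _ 2) C0) (ltW e0); lra.
move=> S S0S N.
have S1 : 1 <= S.
  by have : 0 <= 2 * C / e := divr_ge0 (mulr_ge0 (ler0n _ 2) C0) (ltW e0); lra.
have S0 : 0 < S by exact: lt_le_trans S1.
have CS : C / S ^+ 2 <= e / 2.
  rewrite ler_pdivrMr ?exprn_gt0//.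
  have h : 2 * C / e <= S by lra.
  move: h; rewrite ler_pdivrMr// => h.
  have : S * e <= S * e * S by rewrite ler_peMr// mulr_ge0// ltW.
  by rewrite expr2; lra.
have step n : (1 - cutoff S n) ^+ 2 * sqmod (w n) <= sqmod (w n).
  have /andP[c0 c1] := cutoff_bounds n S0.
  by rewrite ler_piMl ?sqmod_ge0// expr_le1//; lra.
have small n : (n < M)%N -> (1 - cutoff S n) ^+ 2 * sqmod (w n) <= A M ^+ 2 / S ^+ 2 * sqmod (w n).
  move=> nM; rewrite ler_wpM2r ?sqmod_ge0// -expr_div_n lerXn2r ?nnegrE ?divr_ge0 ?sum_aV_ge0 ?(ltW S0)//.
    by have /andP[c0 c1] := cutoff_bounds n S0; lra.
  apply: (le_trans (cutoff_near1 n S0)); rewrite ler_pM2r ?invr_gt0//.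
  by apply: sum_aV_le; exact: ltnW.
have part m : (m <= M)%N -> \sum_(0 <= n < m) (1 - cutoff S n) ^+ 2 * sqmod (w n) <= e / 2.
  move=> mM; apply: le_trans CS.
  apply: (@le_trans _ _ (\sum_(0 <= n < m) A M ^+ 2 / S ^+ 2 * sqmod (w n))).
    rewrite big_nat_cond [leRHS]big_nat_cond; apply: ler_sum => n /andP[/andP[_ nm] _].
    by apply: small; exact: leq_trans nm mM.
  rewrite -mulr_sumr /C mulrAC ler_wpM2r ?sum_sqmod_le// ?invr_ge0 ?sqr_ge0//.
  by rewrite ler_wpM2l ?sqr_ge0// sum_sqmod_le.
have [NM|MN] := leqP N M; first by have := part N NM; lra.
rewrite (@big_cat_nat _ _ _ M)//=; last exact: ltnW.
have := part M (leqnn _); have := MP N (ltnW MN).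
have : \sum_(M <= n < N) (1 - cutoff S n) ^+ 2 * sqmod (w n) <= \sum_(M <= n < N) sqmod (w n).
  by apply: ler_sum => n _; exact: step.
by lra.
Qed.

Lemma sqmodD_le (x y : R[i]) : sqmod (x + y) <= 2 * sqmod x + 2 * sqmod y.
Proof.
case: x y => [p q] [r s]; rewrite /sqmod/=.
by have := sqr_ge0 (p - r); have := sqr_ge0 (q - s); rewrite !expr2; lra.
Qed.

Lemma sqmodB_le (x y : R[i]) : sqmod (x - y) <= 2 * sqmod x + 2 * sqmod y.
Proof.
by apply: le_trans (sqmodD_le _ _) _; case: y => r s; rewrite /sqmod/= !sqrrN.
Qed.

Lemma sqmodZ (c : R) (x : R[i]) : sqmod (c%:C * x) = c ^+ 2 * sqmod x.
Proof. by case: x => p q; rewrite /sqmod/=; ring. Qed.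

(** The approximation is the product of u with [cutoff]. Its image differs
    from the cut-off of v by the commutator r, whose squared norm is at
    most 4 |u|^2 / S^2. *)
Lemma jacobi_max_approx (u v : l2 R) : jacobi_max (u, v) ->
  jacobi a b (u, v).
Proof.
move=> uv e e0.
have e8 : 0 < e ^+ 2 / 8 by rewrite divr_gt0// exprn_gt0.
have [S1 [S10 H1]] := cutoff_tail u e8; have [S2 [S20 H2]] := cutoff_tail v e8.
pose C := sqnorm u; have C0 : 0 <= C by exact: sqnorm_ge0.
pose S := S1 + S2 + 1 + 64 * C / e ^+ 2.
have S'0 : 0 <= 64 * C / e ^+ 2 by apply: divr_ge0; [exact: mulr_ge0|exact: sqr_ge0].
have S0 : 0 < S by rewrite /S; lra.
have {}H1 := H1 S ltac:(rewrite /S; lra).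
have {}H2 := H2 S ltac:(rewrite /S; lra).
pose q := l2fin (cutoff_finite u S0).
pose Jq := l2fin (jacobi_expr_finite (cutoff_finite u S0)).
exists (q, Jq); first exact: jacobi0P.
have norm_lt (w : l2 R) : sqnorm w <= e ^+ 2 / 2 -> l2norm w < e.
  move=> h; rewrite -(@ltr_pXn2r _ 2) ?nnegrE ?l2norm_ge0 ?(ltW e0)// sqr_l2norm.
  by apply: le_lt_trans h _; have := exprn_gt0 2 e0; lra.
have cE n : (u - q) n = (1 - cutoff S n)%:C * u n.
  rewrite (_ : (u - q) n = u n - (cutoff S n)%:C * u n)// rmorphB rmorph1; ring.
split; apply: norm_lt; apply: sqnorm_le => N.
  under eq_bigr do rewrite cE sqmodZ; have := H1 N.
  by have := exprn_gt0 2 e0; lra.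
pose r n : R[i] := (if n is m.+1 then (a m * (cutoff S m - cutoff S m.+1))%:C * u m else 0)
  + (a n * (cutoff S n.+1 - cutoff S n))%:C * u n.+1.
have JE n : (v - Jq) n = (1 - cutoff S n)%:C * v n - r n.
  rewrite (_ : (v - Jq) n = v n - jacobi_expr a b (fun n => (cutoff S n)%:C * u n) n)//.
  rewrite (uv n)/= /jacobi_expr /r; case: n => [|n].
    by rewrite !rmorphB !rmorphM !rmorphB/= rmorph1; ring.
  by rewrite !rmorphB !rmorphM !rmorphB/= rmorph1; ring.
have coef k (x : R) : `|x| <= (a k * S)^-1 -> (a k * x) ^+ 2 <= S ^- 2.
  move=> h; rewrite -real_normK ?num_real// -exprVn lerXn2r ?nnegrE ?invr_ge0 ?(ltW S0)//.
  rewrite normrM (gtr0_norm (a_gt0 k)).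
  by move: h; rewrite invfM ler_pdivlMl.
have rb n : sqmod (r n) <= 2 * S ^- 2 * ((if n is m.+1 then sqmod (u m) else 0) + sqmod (u n.+1)).
  rewrite /r; apply: le_trans (sqmodD_le _ _) _; rewrite [leRHS]mulrDr sqmodZ.
  apply: lerD; last first.
    by rewrite -[leRHS]mulrA ler_pM2l// ler_wpM2r ?sqmod_ge0// coef// cutoff_lip.
  case: n => [|n]; first by rewrite /sqmod/= expr0n/= addr0 !mulr0.
  by rewrite -[leRHS]mulrA sqmodZ ler_pM2l// ler_wpM2r ?sqmod_ge0// coef// distrC cutoff_lip.
have rs : \sum_(0 <= n < N) sqmod (r n) <= e ^+ 2 / 8.
  apply: (@le_trans _ _ (2 * S ^- 2 * (C + C))).
    apply: le_trans (ler_sum _ (fun n _ => rb n)) _.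
    rewrite -mulr_sumr ler_wpM2l ?mulr_ge0 ?invr_ge0 ?sqr_ge0//.
    rewrite big_split/=; apply: lerD.
      case: N => [|N]; first by rewrite big_geq.
      by rewrite big_nat_recl//= add0r sum_sqmod_le.
    apply: le_trans (sum_sqmod_le u N.+1).
    by rewrite big_nat_recl//= lerDr sqmod_ge0.
  have SS : S <= S ^+ 2 by rewrite expr2 ler_peMr ?(ltW S0)// /S; lra.
  have h : 64 * C / e ^+ 2 <= S ^+ 2 by apply: le_trans SS; rewrite /S; lra.
  move: h; rewrite ler_pdivrMr ?exprn_gt0// => h.
  rewrite -(ler_pM2l (exprn_gt0 2 S0)).
  have -> : S ^+ 2 * (2 * S ^- 2 * (C + C)) = 4 * C by field; rewrite lt0r_neq0.
  by lra.
under eq_bigr do rewrite JE.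
apply: le_trans (ler_sum _ (fun n _ => sqmodB_le _ _)) _.
rewrite big_split/= -!mulr_sumr.
under eq_bigr do rewrite sqmodZ.
have := H2 N; have := rs; have := exprn_gt0 2 e0; lra.
Qed.

(** Each entry of J u depends on three entries of u, so the relation
    passes to limits. *)
Lemma jacobi_sub_max : jacobi a b `<=` jacobi_max.
Proof.
move=> [u v] uv n /=.
apply/eqP; rewrite -subr_eq0 -sqmod_eq0 eq_le sqmod_ge0 andbT.
pose am : R := if n is m.+1 then a m else 0.
pose K := 2 * (1 + 4 * (am ^+ 2 + b n ^+ 2 + a n ^+ 2)).
have K0 : 0 < K.
  rewrite /K; have := sqr_ge0 am; have := sqr_ge0 (b n); have := sqr_ge0 (a n); lra.
apply/ler_addgt0Pr => e e0; rewrite add0r.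
have d0 : 0 < Num.sqrt (e / K) by rewrite sqrtr_gt0 divr_gt0.
have [[q1 q2] [_ /= qE] [/= h1 h2]] := uv _ d0.
have small (w : l2 R) k : l2norm w < Num.sqrt (e / K) -> sqmod (w k) <= e / K.
  move=> h; apply: le_trans (sqmod_le_sqnorm w k) _.
  rewrite -sqr_l2norm -[leRHS]sqr_sqrtr ?divr_ge0 ?ltW//.
  by rewrite ltr_pXn2r ?nnegrE ?l2norm_ge0 ?sqrtr_ge0.
have -> : v n - jacobi_expr a b u n = (v - q2) n - jacobi_expr a b (u - q1) n.
  rewrite (_ : (v - q2) n = v n - q2 n)// qE.
  rewrite (_ : (u - q1 : nat -> R[i]) = fun k => u k + (-1) * q1 k); last first.
    by apply/funext => k; rewrite mulN1r.
  by rewrite jacobi_exprD jacobi_exprZ; ring.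
apply: le_trans (sqmodB_le _ _) _.
have s1 := small _ n h2; have s2 k := small _ k h1.
have -> : jacobi_expr a b (u - q1) n = am%:C * (u - q1) n.-1 + (b n)%:C * (u - q1) n
   + (a n)%:C * (u - q1) n.+1.
  by rewrite /jacobi_expr /am; case: (n) => [|m]; rewrite ?rmorph0 ?mul0r.
have := sqmodD_le (am%:C * (u - q1) n.-1 + (b n)%:C * (u - q1) n) ((a n)%:C * (u - q1) n.+1).
have := sqmodD_le (am%:C * (u - q1) n.-1) ((b n)%:C * (u - q1) n).
rewrite !sqmodZ.
have := ler_wpM2l (sqr_ge0 am) (s2 n.-1); have := ler_wpM2l (sqr_ge0 (b n)) (s2 n).
have := ler_wpM2l (sqr_ge0 (a n)) (s2 n.+1).
have eE : e = K * (e / K) by rewrite mulrCA divff ?mulr1// lt0r_neq0.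
rewrite [X in _ -> _ -> _ -> _ -> _ -> _ <= X]eE /K.
have ek : 0 <= e / K by rewrite divr_ge0 ?ltW.
have p1 := mulr_ge0 (sqr_ge0 (a n)) ek; have p2 := mulr_ge0 (sqr_ge0 am) ek.
have p3 := mulr_ge0 (sqr_ge0 (b n)) ek.
move: s1 p1 p2 p3; clear.
move: (sqmod ((v - q2) n)) (e / K) => x y; lra.
Qed.

Lemma jacobiE : jacobi a b = jacobi_max.
Proof.
apply/seteqP; split; first exact: jacobi_sub_max.
by move=> [u v]; exact: jacobi_max_approx.
Qed.

Lemma jacobi_max_symm (u v u' v' : l2 R) : jacobi_max (u, v) -> jacobi_max (u', v') ->
  rdot v u' = rdot u v'.
Proof.
move=> /jacobi_max_approx uv uv'.
apply/eqP; rewrite -subr_eq0 -normr_eq0 eq_le normr_ge0 andbT.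
apply/ler_addgt0Pr => e e0; rewrite add0r.
pose K := l2norm u' + l2norm v' + 1.
have K0 : 0 < K by rewrite /K; have := l2norm_ge0 u'; have := l2norm_ge0 v'; lra.
have [[q1 q2] q0 [/= h1 h2]] := uv _ (divr_gt0 e0 K0).
have E := rdot_jacobi0_max q0 uv'.
have -> : rdot v u' - rdot u v' = rdot (v - q2) u' - rdot (u - q1) v'.
  by rewrite !rdotBl E; ring.
apply: le_trans (ler_normB _ _) _.
have := le_trans (norm_rdot_le (v - q2) u') (ler_wpM2r (l2norm_ge0 u') (ltW h2)).
have := le_trans (norm_rdot_le (u - q1) v') (ler_wpM2r (l2norm_ge0 v') (ltW h1)).
have eE : e = e / K * K by rewrite divfK// lt0r_neq0.
have : 0 <= e / K by rewrite divr_ge0 ?ltW.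
rewrite [X in _ -> _ -> _ -> _ <= X]eE; move: (e / K) => t t0 t1 t2.
by rewrite /K; lra.
Qed.

(** Testing the adjoint relation against the basis vectors and their
    multiples by i shows that the adjoint is contained in the maximal
    operator; the converse is the symmetry of the latter. *)
Lemma jacobi_self_adjoint : self_adjoint (jacobi a b).
Proof.
rewrite /self_adjoint jacobiE; apply/seteqP; split => [[u v] uv [u' v'] uv' /=|[u v] uv k /=].
  rewrite !l2dotE; congr Complex; first exact: jacobi_max_symm.
  by apply: jacobi_max_symm => //; exact: jacobi_maxZ.
have df : finitely_supported (fun n : nat => (n == k)%:R : R[i]).
  by exists k.+1 => n kn; rewrite gtn_eqF.
have idf : finitely_supported (fun n : nat => 'i%C * (n == k)%:R : R[i]).
  by exists k.+1 => n kn; rewrite gtn_eqF// mulr0.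
have key q1 q2 : jacobi0 a b (q1, q2) -> exists2 N, (forall n, (N <= n)%N -> q1 n = 0) &
    \sum_(0 <= n < N) cdot (q1 n) (jacobi_expr a b u n) = rdot q1 v.
  move=> q0; have [N [h1 h2]] := rdot_jacobi0 u q0; exists N => //.
  rewrite -h1; have := uv _ (jacobi0_max q0) => /(congr1 Re).
  by rewrite /rdot.
have sumk (f : nat -> R) N : (k < N)%N -> (forall n, n != k -> f n = 0) ->
    \sum_(0 <= n < N) f n = f k.
  move=> kN fn; rewrite (bigD1_seq k) ?mem_index_iota ?iota_uniq//=.
  by rewrite big1 ?addr0// => j jk; rewrite fn.
have kN (z : R[i]) N : z != 0 -> (forall n, (N <= n)%N -> z * (n == k)%:R = 0 :> R[i]) -> (k < N)%N.
  move=> z0 h; rewrite ltnNge; apply/negP => /h; rewrite eqxx mulr1 => /eqP.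
  by rewrite (negbTE z0).
apply/eqP; rewrite eq_complex; apply/andP; split; apply/eqP.
  have [N qN] := key _ _ (jacobi0P df).
  have {}qN : (k < N)%N by apply: (kN 1); [exact: oner_neq0|move=> n Nn; rewrite mul1r; exact: qN].
  rewrite (sumk (fun n => cdot _ _))//; last by move=> n nk; rewrite /= (negbTE nk) cdot0.
  rewrite rdotC (_ : l2fin df = delta_l2 k); last exact/val_inj.
  rewrite rdot_delta /= eqxx => <-.
  by rewrite /cdot/= mul1r mul0r addr0.
have [N qN] := key _ _ (jacobi0P idf).
have i0 : 'i%C != 0 :> R[i] by rewrite eq_complex/= oner_eq0 andbF.
have {}qN : (k < N)%N by apply: (kN 'i%C) => // n Nn; exact: qN.
rewrite (sumk (fun n => cdot _ _))//; last by move=> n nk; rewrite /= (negbTE nk) mulr0 cdot0.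
have -> : rdot (l2fin idf) v = Im (v k).
  by rewrite rdotC (_ : l2fin idf = 'i%C *: delta_l2 k) ?rdot_idelta//; exact/val_inj.
rewrite /= eqxx => <-.
by rewrite /cdot/=; ring.
Qed.

End JacobiOperator.

(** * Integration against restricted measures, sums and densities *)

Section MeasureLemmas.
Context d (T : measurableType d) (R : realType).
Implicit Types (mu nu : {measure set T -> \bar R}) (f : T -> \bar R).
Local Open Scope ereal_scope.

Lemma ge0_integral_restricted mu nu (B : set T) f : measurable B ->
  (forall A, measurable A -> nu A = mu (A `&` B)) ->
  measurable_fun setT f -> (forall x, 0 <= f x) ->
  \int[nu]_x f x = \int[mu]_(x in B) f x.
Proof.
move=> mB numu mf f0; rewrite -(setUv B) ge0_integral_setU//; last 3 first.
- exact: measurableC.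
- by rewrite setUv.
- by rewrite /disj_set setICr.
rewrite (@eq_measure_integral _ _ _ B mu nu); last first.
  by move=> A mA AB; rewrite numu// setIidl.
rewrite (@eq_measure_integral _ _ _ (~` B) mzero nu); last first.
  by move=> A mA AB; rewrite numu// (_ : A `&` B = set0) ?measure0//; apply/disjoints_subset.
by rewrite integral_measure_zero adde0.
Qed.

Lemma integral_restricted mu nu (B : set T) f : measurable B ->
  (forall A, measurable A -> nu A = mu (A `&` B)) ->
  measurable_fun setT f ->
  \int[nu]_x f x = \int[mu]_(x in B) f x.
Proof.
move=> mB numu mf; rewrite integralE [RHS]integralE.
congr (_ - _); apply: ge0_integral_restricted => //.
- exact: measurable_funepos.
- exact: measurable_funeneg.
Qed.

Lemma ge0_integral_sum_measure mu (m1 m2 : {measure set T -> \bar R}) f :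
  (forall A, measurable A -> mu A = m1 A + m2 A) ->
  measurable_fun setT f -> (forall x, 0 <= f x) ->
  \int[mu]_x f x = \int[m1]_x f x + \int[m2]_x f x.
Proof.
move=> h mf f0.
rewrite (@eq_measure_integral _ _ _ setT (measure_add m1 m2) mu); last first.
  by move=> A mA _; rewrite h//; exact/esym/measure_addE.
exact: ge0_integral_measure_add.
Qed.

Lemma integral_sum_measure mu (m1 m2 : {measure set T -> \bar R}) f :
  (forall A, measurable A -> mu A = m1 A + m2 A) ->
  m1.-integrable setT f -> m2.-integrable setT f ->
  \int[mu]_x f x = \int[m1]_x f x + \int[m2]_x f x.
Proof.
move=> h i1 i2.
rewrite (@eq_measure_integral _ _ _ setT (measure_add m1 m2) mu); last first.
  by move=> A mA _; rewrite h//; exact/esym/measure_addE.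
exact: integral_measure_add.
Qed.

(** The density agrees almost everywhere with the Radon-Nikodym
    derivative, for which the change of variables is known. *)
Lemma ge0_integral_density (mu : {sigma_finite_measure set T -> \bar R})
    (nu : {finite_measure set T -> \bar R}) (h : T -> R) f :
  measurable_fun setT h -> (forall x, 0 <= h x)%R ->
  (forall A, measurable A -> nu A = \int[mu]_(x in A) (h x)%:E) ->
  measurable_fun setT f -> (forall x, 0 <= f x) ->
  \int[nu]_x f x = \int[mu]_x (f x * (h x)%:E).
Proof.
move=> mh h0 hE mf f0.
have numu : nu `<< mu.
  apply/null_content_dominatesP => A mA A0; rewrite hE//.
  by apply: null_set_integral => //; exact/measurable_EFinP/measurable_funTS.
rewrite -(Radon_Nikodym_SigmaFinite.change_of_variables numu f0 measurableT mf).
have mrn : measurable_fun setT (Radon_Nikodym_SigmaFinite.f nu mu).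
  exact: measurable_int (Radon_Nikodym_SigmaFinite.f_integrable numu).
have mhE : measurable_fun setT (EFin \o h) by exact/measurable_EFinP.
apply: ae_eq_integral => //.
- exact: emeasurable_funM.
- exact: emeasurable_funM.
apply: ae_eqe_mul2l; apply: integral_ae_eq => //.
- exact: Radon_Nikodym_SigmaFinite.f_integrable.
- by move=> A _ mA; rewrite -hE// -Radon_Nikodym_SigmaFinite.f_integral.
Qed.

End MeasureLemmas.

(** * Projection-valued measures *)

Section SpectralMeasure.
Context {R : realType}.
Variable E : pvm R.
Implicit Types (u v w : l2 R) (A B : set (measurableTypeR R)).
Local Notation mu := (pvm_measure E).

Lemma pvm_symm B u v : rdot (E B u) v = rdot u (E B v).
Proof. by rewrite /rdot pvm_selfadjoint. Qed.

Lemma pvm_measureE u B : mu u B = (sqnorm (E B u))%:E.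
Proof.
by rewrite /pvm_measure /sqnorm -[RHS]/((rdot _ _)%:E) pvm_symm pvm_idem -/(rdot _ _) rdotC.
Qed.

Lemma pvm_measureT u : mu u setT = (sqnorm u)%:E.
Proof. by rewrite pvm_measureE pvm_setT. Qed.

Lemma pvm_comm A B u : measurable A -> measurable B -> E A (E B u) = E B (E A u).
Proof. by move=> mA mB; rewrite -!pvm_setI// setIC. Qed.

Lemma pvm_measure_restr u A B : measurable A -> measurable B ->
  mu (E B u) A = mu u (A `&` B).
Proof. by move=> mA mB; rewrite !pvm_measureE pvm_setI. Qed.

Lemma pvm_measure_fixed u A B : measurable A -> measurable B -> E B u = u ->
  mu u A = mu u (A `&` B).
Proof. by move=> mA mB Eu; have := pvm_measure_restr u mA mB; rewrite Eu. Qed.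

(** The vectors E(A) E(B) u and E(A) (v - E(B) v) are orthogonal, as E(A)
    and E(B) commute. *)
Lemma pvm_measure_split u v B : measurable B -> forall A, measurable A ->
  mu (E B u + (v - E B v))%R A = (mu (E B u) A + mu (v - E B v)%R A)%E.
Proof.
move=> mB A mA; rewrite !pvm_measureE -EFinD linearD sqnormD.
rewrite (_ : rdot _ _ = 0) ?mulr0 ?addr0//.
by rewrite pvm_comm// pvm_symm linearB/= pvm_comm// linearB/= pvm_idem subrr rdot0r.
Qed.

Lemma measurable_sqr : measurable_fun setT (fun x : measurableTypeR R => (x ^+ 2)%:E).
Proof.
apply/measurable_EFinP.
exact: exprn_measurable.
Qed.

Lemma measurable_EFin_id : measurable_fun setT (fun x : measurableTypeR R => x%:E).
Proof. exact: EFin_measurable. Qed.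

Lemma integrable_id_sqr (m : {finite_measure set (measurableTypeR R) -> \bar R}) :
  (\int[m]_x (x ^+ 2)%:E < +oo)%E ->
  m.-integrable setT (fun x => x%:E) /\ m.-integrable setT (fun x => (x ^+ 2)%:E).
Proof.
move=> h.
have i2 : m.-integrable setT (fun x => (x ^+ 2)%:E).
  apply/integrableP; split; first exact: measurable_sqr.
  by under eq_integral do rewrite gee0_abs ?lee_fin ?sqr_ge0//.
split=> //.
apply: (@le_integrable _ _ _ m _ measurableT (fun x => x%:E) (fun x => (1%:E + (x ^+ 2)%:E)%E)).
- exact: measurable_EFin_id.
- move=> x _; rewrite -EFinD !abse_EFin lee_fin.
  rewrite (@ger0_norm _ (1 + _)) ?addr_ge0 ?sqr_ge0// ler_norml.
  have := sqr_ge0 (x - 1); have := sqr_ge0 (x + 1); have := sqr_ge0 x; rewrite !expr2.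
  by move=> *; apply/andP; split; lra.
- by apply: (integrableD measurableT) => //; exact: finite_measure_integrable_cst.
Qed.

End SpectralMeasure.

(** * The spectral measure of the Jacobi operator *)

Section JacobiSpectralMeasure.
Context {R : realType}.
Variables a b : nat -> R.
Hypothesis a_gt0 : forall n, 0 < a n.
Hypothesis carl : (fun n => \sum_(0 <= k < n) (a k)^-1) @ \oo --> +oo.
Variable E : pvm R.
Hypothesis ET : is_spectral_measure (jacobi a b) E.
Local Notation "x %:C" := (real_complex R x).
Local Notation mu := (pvm_measure E).
Local Notation T := (jacobi_max a b).
Implicit Types (u v w : l2 R) (A B : set (measurableTypeR R)).

Lemma domain_iff u : (exists v, T (u, v)) <-> (\int[mu u]_x (x ^+ 2)%:E < +oo)%E.
Proof. by have [+ _] := ET; rewrite jacobiE//; exact. Qed.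

Lemma rdot_integral u v : T (u, v) -> rdot v u = \int[mu u]_x x.
Proof.
have [_] := ET; rewrite jacobiE// => h /h.
by rewrite l2dotE => -[].
Qed.

(** The measure of E(B) u is dominated by that of u. *)
Lemma domain_proj u v B : measurable B -> T (u, v) -> exists v', T (E B u, v').
Proof.
move=> mB uv; apply/domain_iff; have /domain_iff : exists v, T (u, v) by exists v.
rewrite (@ge0_integral_sum_measure _ _ _ (mu u) (mu (E B u)) (mu (u - E B u))).
- by apply: le_lt_trans; rewrite leeDl// integral_ge0// => x _; rewrite lee_fin sqr_ge0.
- move=> A mA; have := @pvm_measure_split R E u u B mB A mA.
  by rewrite (addrC (E B u)) subrK.
- exact: measurable_sqr.
- by move=> x; rewrite lee_fin sqr_ge0.
Qed.

Lemma domain_integrable u v : T (u, v) ->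
  (mu u).-integrable setT (fun x => x%:E) /\ (mu u).-integrable setT (fun x => (x ^+ 2)%:E).
Proof. by move=> uv; apply: integrable_id_sqr; apply/domain_iff; exists v. Qed.

(** The quadratic form of the operator is additive on the sum of E(B) u
    and u' - E(B) u', because the measure is, by [pvm_measure_split]. So
    the cross terms of the form cancel, and by symmetry each of them is
    zero. *)
Lemma proj_orth u v u' v' B : measurable B -> T (E B u, v) -> T (u' - E B u', v') ->
  rdot v (u' - E B u') = 0.
Proof.
move=> mB h h'.
have H := jacobi_maxD h h'; have F := rdot_integral H.
have [i1 _] := domain_integrable h; have [i2 _] := domain_integrable h'.
move: F; rewrite /Rintegral (@integral_sum_measure _ _ _ _ (mu (E B u)) (mu (u' - E B u')))//; last first.
  by move=> A mA; exact: pvm_measure_split.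
rewrite fineD; [|exact: integrable_fin_num..].
have F1 := rdot_integral h; have F2 := rdot_integral h'.
rewrite /Rintegral in F1 F2; rewrite -F1 -F2 rdotDl (rdotDr v) (rdotDr v').
have S := jacobi_max_symm a_gt0 carl h' h; rewrite (rdotC (u' - E B u')) in S.
by rewrite S; lra.
Qed.

Lemma jacobi_max_delta k : exists v, T (delta_l2 k, v).
Proof.
have df : finitely_supported (fun n : nat => (n == k)%:R : R[i]).
  by exists k.+1 => n kn; rewrite gtn_eqF.
exists (l2fin (jacobi_expr_finite a b df)).
rewrite (_ : delta_l2 k = l2fin df); last exact/val_inj.
exact: (jacobi0_max (jacobi0P a b df)).
Qed.

Lemma l2_ext u v : (forall k, rdot u (delta_l2 k) = rdot v (delta_l2 k)) ->
  (forall k, rdot u ('i%C *: delta_l2 k) = rdot v ('i%C *: delta_l2 k)) -> u = v.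
Proof.
move=> h1 h2; apply/val_inj/funext => k /=.
by apply/eqP; rewrite eq_complex -!rdot_delta -!rdot_idelta h1 h2 !eqxx.
Qed.

(** By [proj_orth] the operator maps the parts E(B) u and u - E(B) u of
    the domain to vectors orthogonal to the other part, hence into the
    range and the kernel of E(B), the domain being dense. *)
Lemma jacobi_max_proj u v B : measurable B -> T (u, v) -> T (E B u, E B v).
Proof.
move=> mB uv; have [v1 h1] := domain_proj mB uv.
have h2 : T (u - E B u, v - v1) by exact: jacobi_maxB.
have e1 : v1 = E B v1.
  have key u' v' : T (u', v') -> rdot v1 u' = rdot (E B v1) u'.
    move=> h'; have [w' hw'] := domain_proj mB h'.
    have := proj_orth mB h1 (jacobi_maxB h' hw'); rewrite rdotBr -pvm_symm => /eqP.
    by rewrite subr_eq0 => /eqP.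
  apply: l2_ext => k; have [w hw] := jacobi_max_delta k; first exact: key hw.
  exact: key (jacobi_maxZ 'i%C hw).
have e2 : E B (v - v1) = 0.
  have key u' v' : T (u', v') -> rdot (E B (v - v1)) u' = rdot 0 u'.
    move=> h'; have [w' hw'] := domain_proj mB h'.
    have := proj_orth mB hw' h2; rewrite (jacobi_max_symm a_gt0 carl hw' h2) pvm_symm rdotC => ->.
    by rewrite rdotC rdot0r.
  apply: l2_ext => k; have [w hw] := jacobi_max_delta k; first exact: key hw.
  exact: key (jacobi_maxZ 'i%C hw).
have -> // : E B v = v1.
by rewrite -(subrK v1 v) linearD/= e2 add0r -e1.
Qed.

Lemma quadratic_integral_ge0 (m : {finite_measure set (measurableTypeR R) -> \bar R}) B
  (c2 c1 c0 : R) : measurable B ->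
  m.-integrable setT (fun x => x%:E) -> m.-integrable setT (fun x => (x ^+ 2)%:E) ->
  (forall x, B x -> 0 <= c2 * x ^+ 2 + c1 * x + c0) ->
  0 <= c2 * (\int[m]_(x in B) (x ^+ 2)) + c1 * (\int[m]_(x in B) x) + c0 * fine (m B).
Proof.
move=> mB i1 i2 h.
have j1 : m.-integrable B (EFin \o (fun x : measurableTypeR R => x)).
  exact: (integrableS measurableT).
have j2 : m.-integrable B (EFin \o (fun x : measurableTypeR R => x ^+ 2)).
  exact: (integrableS measurableT).
have j0 : m.-integrable B (EFin \o cst c0) by exact: finite_measure_integrable_cst.
have k2 : m.-integrable B (EFin \o (fun x : measurableTypeR R => c2 * x ^+ 2)).
  exact: (integrableZl mB c2 j2).
have k1 : m.-integrable B (EFin \o (fun x : measurableTypeR R => c1 * x)).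
  exact: (integrableZl mB c1 j1).
have k21 : m.-integrable B (EFin \o (fun x : measurableTypeR R => c2 * x ^+ 2 + c1 * x)).
  exact: (integrableD mB k2 k1).
have e2 : \int[m]_(x in B) (c2 * x ^+ 2) = c2 * \int[m]_(x in B) (x ^+ 2).
  by rewrite RintegralZl.
have e1 : \int[m]_(x in B) (c1 * x) = c1 * \int[m]_(x in B) x.
  by rewrite RintegralZl.
have e0 : \int[m]_(x in B) c0 = c0 * fine (m B) by rewrite Rintegral_cst.
have e21 : \int[m]_(x in B) (c2 * x ^+ 2 + c1 * x) =
  \int[m]_(x in B) (c2 * x ^+ 2) + \int[m]_(x in B) (c1 * x) by rewrite RintegralD.
rewrite -e2 -e1 -e0 -e21.
rewrite -(RintegralD mB k21 j0).
exact: Rintegral_ge0.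
Qed.

Let itv (p q : R) : set (measurableTypeR R) := `[p, q[%classic.

Lemma measurable_coitv p q : measurable (itv p q). Proof. exact: measurable_itv. Qed.

Lemma range_dom p q w : E (itv p q) w = w -> exists v, T (w, v).
Proof.
move=> Ew; apply/domain_iff.
rewrite (@ge0_integral_restricted _ _ _ (mu w) _ (itv p q)); last 4 first.
- exact: measurable_coitv.
- by move=> A mA; exact: pvm_measure_fixed mA (measurable_coitv p q) Ew.
- exact: measurable_sqr.
- by move=> x; rewrite lee_fin sqr_ge0.
pose C := p ^+ 2 + q ^+ 2.
apply: (@le_lt_trans _ _ (\int[mu w]_(x in itv p q) (cst C%:E) x)%E).
  apply: ge0_le_integral.
  - exact: measurable_coitv.
  - by move=> x _; rewrite lee_fin sqr_ge0.
  - by apply: measurable_funTS; exact: measurable_sqr.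
  - exact: measurable_cst.
  - move=> x; rewrite /itv/= in_itv/= => /andP[px xq]; rewrite lee_fin /C.
    have [x0|x0] := leP 0 x.
      apply: (@le_trans _ _ (q ^+ 2)); last by rewrite lerDr sqr_ge0.
      by rewrite lerXn2r ?nnegrE//; lra.
    apply: (@le_trans _ _ (p ^+ 2)); last by rewrite lerDl sqr_ge0.
    by rewrite -sqrrN -[leRHS]sqrrN lerXn2r ?nnegrE//; lra.
rewrite integral_cst ?pvm_measureE -?EFinM ?ltry//; exact: measurable_coitv.
Qed.

(** The form of the operator is the integral of x, and the measure of w
    lives on the interval. *)
Lemma range_form p q w v : E (itv p q) w = w -> T (w, v) ->
  p * sqnorm w <= rdot v w <= q * sqnorm w.
Proof.
move=> Ew wv; have [i1 i2] := domain_integrable wv.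
have F : rdot v w = \int[mu w]_(x in itv p q) x.
  rewrite (rdot_integral wv) /Rintegral; congr fine.
  apply: integral_restricted; first exact: measurable_coitv.
    by move=> A mA; exact: pvm_measure_fixed mA (measurable_coitv p q) Ew.
  exact: measurable_EFin_id.
have muE : fine (mu w (itv p q)) = sqnorm w by rewrite pvm_measureE Ew.
have h1 := @quadratic_integral_ge0 (mu w) (itv p q) 0 1 (- p) (measurable_coitv p q) i1 i2.
have h2 := @quadratic_integral_ge0 (mu w) (itv p q) 0 (-1) q (measurable_coitv p q) i1 i2.
rewrite F; clear Ew F wv; apply/andP; split.
  have : forall x : R, itv p q x -> 0 <= 0 * x ^+ 2 + 1 * x - p.
    by move=> x; rewrite /itv/= in_itv/= => /andP[h3 h4]; clear h1 h2; lra.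
  by move=> /h1; rewrite muE => h3; clear h1 h2; lra.
have : forall x : R, itv p q x -> 0 <= 0 * x ^+ 2 + -1 * x + q.
  by move=> x; rewrite /itv/= in_itv/= => /andP[h3 h4]; clear h1 h2; lra.
by move=> /h2; rewrite muE => h3; clear h1 h2; lra.
Qed.

(** The lower bound is the positivity of the squared norm of v - p w. The
    upper bound says that (T - p)(q - T) is nonnegative on the range of
    E([p, q[): add [range_form] for the vectors (T - p) w and (q - T) w. *)
Lemma range_sqnorm_bounds p q w v : p < q -> E (itv p q) w = w -> E (itv p q) v = v ->
  T (w, v) ->
  2 * p * rdot v w - p ^+ 2 * sqnorm w <= sqnorm v
   <= (p + q) * rdot v w - p * q * sqnorm w.
Proof.
move=> pq Ew Ev wv.
apply/andP; split.
  have := sqnorm_ge0 (v - p%:C *: w); rewrite sqnormB sqnormZ rdotZr.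
  by lra.
have [z vz] := range_dom Ev.
have Ex : E (itv p q) (v - p%:C *: w) = v - p%:C *: w.
  by rewrite linearB linearZ/= Ew Ev.
have Ey : E (itv p q) (q%:C *: w - v) = q%:C *: w - v.
  by rewrite linearB linearZ/= Ew Ev.
have /andP[_ h1] := range_form Ex (jacobi_maxB vz (jacobi_maxZ p%:C wv)).
have /andP[h2 _] := range_form Ey (jacobi_maxB (jacobi_maxZ q%:C wv) vz).
have zw : rdot z w = sqnorm v by rewrite (jacobi_max_symm a_gt0 carl vz wv).
move: h1 h2.
rewrite !sqnormB !sqnormZ !rdotBl !rdotBr !rdotZl !rdotZr !zw -/(sqnorm v).
rewrite (rdotC w v).
move: (rdot z v) (rdot v w) (sqnorm v) (sqnorm w) => s r n m h1 h2.
have qp : 0 < q - p by rewrite subr_gt0.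
(* The sum of (T - p) (q - T)^2 and (q - T) (T - p)^2 is (q - p) (T - p)
   (q - T). *)
rewrite -(ler_pM2l qp); lra.
Qed.

(** Both terms of the difference satisfy the bounds of
    [range_sqnorm_bounds], which are at most (q - p)^2 times the squared
    norm of E([p, q[) w apart. *)
Lemma second_moment_local p q w v : p < q -> T (w, v) ->
  `|sqnorm (E (itv p q) v) - \int[mu w]_(x in itv p q) (x ^+ 2)| <=
   (q - p) ^+ 2 * sqnorm (E (itv p q) w).
Proof.
move=> pq wv; have mI := measurable_coitv p q; have [i1 i2] := domain_integrable wv.
have := range_sqnorm_bounds pq (pvm_idem E (itv p q) w) (pvm_idem E (itv p q) v) (jacobi_max_proj mI wv).
rewrite (rdot_integral (jacobi_max_proj mI wv)).
rewrite /Rintegral (@integral_restricted _ _ _ (mu w) (mu (E (itv p q) w)) (itv p q))//; last first.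
  by move=> A mA; exact: pvm_measure_restr.
have muE : fine (mu w (itv p q)) = sqnorm (E (itv p q) w) by rewrite pvm_measureE.
have h1 := @quadratic_integral_ge0 (mu w) (itv p q) 1 (- (p + q)) ((q - p) ^+ 2 + p * q) (measurable_coitv p q) i1 i2.
have h2 := @quadratic_integral_ge0 (mu w) (itv p q) (-1) (2 * p) ((q - p) ^+ 2 - p ^+ 2) (measurable_coitv p q) i1 i2.
rewrite muE /Rintegral in h1 h2.
have {}h1 := h1 _; have {}h2 := h2 _.
move=> /andP[l1 l2]; rewrite ler_norml.
have {}h1 : 0 <=
  1 * fine (\int[mu w]_(x in itv p q) (x ^+ 2)%:E)%E + - (p + q) * fine (\int[mu w]_(x in itv p q) x%:E)%E +
  ((q - p) ^+ 2 + p * q) * sqnorm (E (itv p q) w).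
  apply: h1 => x; rewrite /itv/= in_itv/= => /andP[px xq].
  have := sqr_ge0 (x - p); have := sqr_ge0 (q - x); rewrite !expr2.
  have : 0 <= (x - p) * (q - x) by rewrite mulr_ge0//; lra.
  by lra.
have {}h2 : 0 <=
  -1 * fine (\int[mu w]_(x in itv p q) (x ^+ 2)%:E)%E + 2 * p * fine (\int[mu w]_(x in itv p q) x%:E)%E +
  ((q - p) ^+ 2 - p ^+ 2) * sqnorm (E (itv p q) w).
  apply: h2 => x; rewrite /itv/= in_itv/= => /andP[px xq].
  have : (x - p) ^+ 2 <= (q - p) ^+ 2 by rewrite lerXn2r ?nnegrE//; lra.
  by rewrite !expr2; lra.
by apply/andP; split; lra.
Qed.

(** The error is quadratic in the length of the interval, while the
    squared norms for the two halves add up; so each halving divides the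
    error by 4. *)
Lemma second_moment_halving k p q w v : p < q -> T (w, v) ->
  `|sqnorm (E (itv p q) v) - \int[mu w]_(x in itv p q) (x ^+ 2)| <=
   ((q - p) / 2 ^+ k) ^+ 2 * sqnorm (E (itv p q) w).
Proof.
move=> pq wv; have [i1 i2] := domain_integrable wv.
elim: k p q pq => [|k IH] p q pq; first by rewrite expr0 divr1; exact: second_moment_local.
pose c := (p + q) / 2.
have pc : p < c by rewrite /c; lra.
have cq : c < q by rewrite /c; lra.
have U : itv p q = itv p c `|` itv c q.
  rewrite /itv; apply/seteqP; split => x /=; rewrite !in_itv/=.
    by move=> /andP[h1 h2]; case: (ltP x c) => h; [left|right]; apply/andP.
  by case=> /andP[h1 h2]; apply/andP; split => //; lra.
have D : [disjoint itv p c & itv c q].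
  apply/eqP/seteqP; split => x //=; rewrite /itv/= !in_itv/= => -[/andP[_ h1] /andP[h2 _]].
  by move: h1; rewrite ltNge h2.
have add u : sqnorm (E (itv p q) u) = sqnorm (E (itv p c) u) + sqnorm (E (itv c q) u).
  apply: EFin_inj; rewrite EFinD -!pvm_measureE U measureU//; try exact: measurable_coitv.
  exact/eqP.
have -> : \int[mu w]_(x in itv p q) (x ^+ 2) =
    \int[mu w]_(x in itv p c) (x ^+ 2) + \int[mu w]_(x in itv c q) (x ^+ 2).
  rewrite U Rintegral_setU//; try exact: measurable_coitv.
  by apply: (integrableS measurableT) => //; apply: measurableU; exact: measurable_coitv.
rewrite !add.
have := IH p c pc; have := IH c q cq.
have -> : (c - p) / 2 ^+ k = (q - p) / 2 ^+ k.+1.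
  by rewrite /c exprS; field; rewrite expf_neq0.
have -> : (q - c) / 2 ^+ k = (q - p) / 2 ^+ k.+1.
  by rewrite /c exprS; field; rewrite expf_neq0.
rewrite !ler_norml => /andP[h1 h2] /andP[h3 h4].
by apply/andP; split; lra.
Qed.

Lemma second_moment_itv p q w v : p < q -> T (w, v) ->
  sqnorm (E (itv p q) v) = \int[mu w]_(x in itv p q) (x ^+ 2).
Proof.
move=> pq wv; apply/eqP; rewrite -subr_eq0 -normr_eq0 eq_le normr_ge0 andbT.
pose K := (q - p) ^+ 2 * sqnorm (E (itv p q) w).
have h k : `|sqnorm (E (itv p q) v) - \int[mu w]_(x in itv p q) (x ^+ 2)| <= K * (2^-1 ^+ 2) ^+ k.
  apply: le_trans (second_moment_halving k pq wv) _.
  by rewrite /K exprMn -exprVn -!exprM mulnC mulrAC.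
have c0 : (fun k => K * (2^-1 ^+ 2) ^+ k) @ \oo --> (K * 0 : R).
  apply: cvgM; first exact: cvg_cst.
  apply: cvg_expr; rewrite ger0_norm ?sqr_ge0//.
  by rewrite exprVn invf_lt1 ?exprn_gt0// expr2; lra.
have : `|sqnorm (E (itv p q) v) - \int[mu w]_(x in itv p q) (x ^+ 2)| <= K * 0.
  rewrite -(cvg_lim _ c0)//; apply: limr_ge; first by apply/cvg_ex; eexists; exact: c0.
  exact: nearW.
by rewrite mulr0.
Qed.

(** The definition of the spectral measure only tells when the second
    moment is finite; its value follows from the formula for the form, by
    exhausting the line with intervals. *)
Lemma second_moment w v : T (w, v) -> ((sqnorm v)%:E = \int[mu w]_x (x ^+ 2)%:E)%E.
Proof.
move=> wv; have [i1 i2] := domain_integrable wv.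
pose I (k : nat) := itv (- k%:R) k%:R.
have ndI : {homo I : n m / (n <= m)%N >-> (n <= m)%O}.
  move=> n m nm; apply/subsetPset => x; rewrite /I /itv/= !in_itv/= => /andP[h1 h2].
  have : n%:R <= m%:R :> R by rewrite ler_nat.
  by move=> ?; apply/andP; split; lra.
have UI : \bigcup_k I k = setT.
  rewrite -subTset => x _; exists (Num.truncn `|x|).+1 => //.
  rewrite /I /itv/= in_itv/=; have := truncnS_gt `|x|; rewrite ltr_norml => /andP[h1 h2].
  by rewrite h2 ltW.
have mI k : measurable (I k) by exact: measurable_coitv.
have c1 : mu v (I k) @[k --> \oo] --> mu v setT.
  by rewrite -UI; apply: nondecreasing_cvg_mu => //; rewrite UI; exact: measurableT.
have c2 : (\int[mu w]_(x in I k) (x ^+ 2)%:E)%E @[k --> \oo] --> (\int[mu w]_x (x ^+ 2)%:E)%E.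
  rewrite -UI; apply: ge0_nondecreasing_set_cvg_integral => //.
    by move=> k; apply: measurable_funTS; exact: measurable_sqr.
  by move=> k x _; rewrite lee_fin sqr_ge0.
rewrite -(pvm_measureT E); apply: (cvg_unique _ c1); first exact: ereal_hausdorff.
apply: cvg_trans c2; apply: near_eq_cvg; near=> k.
have k0 : (0 < k)%N by near: k; exact: nbhs_infty_gt.
have kk : - k%:R < k%:R :> R by rewrite -subr_gt0 opprK addr_gt0// ltr0n.
rewrite pvm_measureE /I (second_moment_itv kk wv) /Rintegral fineK//.
by apply: integrable_fin_num; [exact: measurable_coitv|apply: (integrableS measurableT) => //; exact: measurable_coitv].
Unshelve. all: end_near. Qed.

(** By [jacobi_max_proj] it suffices to compute the squared norm of (T -
    z) E(B) w, which is the integral of x^2 - 2 t x + t^2 + y^2 against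
    the measure of E(B) w. *)
Lemma resolvent_density (t y : R) w v B : measurable B -> T (w, v) ->
  (mu (v - (Complex t y) *: w)%R B =
   \int[mu w]_(x in B) ((x - t) ^+ 2 + y ^+ 2)%:E)%E.
Proof.
move=> mB wv; have h := jacobi_max_proj mB wv.
set w' := E B w in h; set v' := E B v in h.
have [i1 i2] := domain_integrable h.
have zE : Complex t y *: w' = t%:C *: w' + y%:C *: ('i%C *: w').
  by rewrite scalerA -scalerDl; congr (_ *: _); apply/eqP; rewrite eq_complex/=; apply/andP; split; apply/eqP; ring.
have im0 : rdot v' ('i%C *: w') = 0.
  have := jacobi_max_symm a_gt0 carl h (jacobi_maxZ 'i%C h); rewrite rdotir (rdotC ('i%C *: v')).
  have -> : rdot w' ('i%C *: v') = - rdot ('i%C *: w') v' by exact: rdotir.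
  by rewrite rdotC; lra.
have ii0 : rdot w' ('i%C *: w') = 0.
  by have := rdotir w' w'; rewrite (rdotC _ w'); lra.
have nE : sqnorm (v' - Complex t y *: w') =
    sqnorm v' - 2 * t * rdot v' w' + (t ^+ 2 + y ^+ 2) * sqnorm w'.
  rewrite zE sqnormB sqnormD !sqnormZ !rdotDr !rdotZr rdotZl im0 ii0.
  by rewrite (_ : sqnorm ('i%C *: w') = sqnorm w') /sqnorm ?rdotii//; ring.
rewrite pvm_measureE linearB linearZ/= -/w' -/v' nE.
rewrite -(@ge0_integral_restricted _ _ _ (mu w) (mu w') B)//; last 3 first.
- by move=> A mA; exact: pvm_measure_restr.
- apply/measurable_EFinP; apply: measurable_funD => //.
  by apply: measurable_funX; exact: measurable_funB.
- by move=> x; rewrite lee_fin addr_ge0 ?sqr_ge0.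
have j1 : (mu w').-integrable setT (EFin \o (fun x : measurableTypeR R => x ^+ 2)) by [].
have j2 : (mu w').-integrable setT (EFin \o (fun x : measurableTypeR R => (- (2 * t)) * x)).
  exact: (integrableZl measurableT (- (2 * t)) i1).
have j3 : (mu w').-integrable setT (EFin \o cst (t ^+ 2 + y ^+ 2)).
  exact: finite_measure_integrable_cst.
have -> : (fun x : measurableTypeR R => ((x - t) ^+ 2 + y ^+ 2)%:E) =
   (fun x => (x ^+ 2)%:E + (- (2 * t) * x)%:E + (t ^+ 2 + y ^+ 2)%:E)%E.
  by apply/funext => x; rewrite -!EFinD; congr EFin; ring.
rewrite (integralD measurableT (integrableD measurableT j1 j2) j3).
rewrite (integralD measurableT j1 j2) -(second_moment h).
have e2 : (\int[mu w']_x ((- (2 * t)) * x)%:E = ((- (2 * t)) * rdot v' w')%:E)%E.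
  under eq_integral do rewrite EFinM.
  rewrite integralZl// (rdot_integral h) EFinM /Rintegral fineK//.
  exact: integrable_fin_num.
have e3 : (\int[mu w']_x (t ^+ 2 + y ^+ 2)%:E = ((t ^+ 2 + y ^+ 2) * sqnorm w')%:E)%E.
  by rewrite integral_cst// EFinM -(pvm_measureT E).
rewrite [X in (_ + X + _)%E]e2 [X in (_ + X)%E]e3.
by rewrite -!EFinD; congr EFin; ring.
Qed.

(** The recurrence expresses a_n times the basis vector n + 1 by the image
    of the vector n and by the vectors n and n - 1, and E(B) commutes with
    the operator. *)
Lemma proj_delta_eq0 B : measurable B -> E B (delta_l2 0) = 0 ->
  forall n, E B (delta_l2 n) = 0.
Proof.
move=> mB E0.
have step n : E B (delta_l2 n) = 0 -> (if n is m.+1 then E B (delta_l2 m) else 0) = 0 ->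
   E B (delta_l2 n.+1) = 0.
  move=> En Em; have [v nv] := jacobi_max_delta n.
  have := jacobi_max_proj mB nv; rewrite En => h0.
  have Ev0 : E B v = 0.
    apply/val_inj/funext => k; have /= -> := h0 k; rewrite /jacobi_expr/=.
    by case: k => [|k]; rewrite !mulr0 ?addr0.
  have vE : v = (if n is m.+1 then (a m)%:C *: delta_l2 m else 0) + (b n)%:C *: delta_l2 n
     + (a n)%:C *: delta_l2 n.+1.
    apply/val_inj/funext => k; have /= -> := nv k; rewrite /jacobi_expr/=.
    rewrite -[RHS]/((if n is m.+1 then (a m)%:C *: delta_l2 m else 0 : l2 R) k
      + (b n)%:C * (k == n)%:R + (a n)%:C * (k == n.+1)%:R).
    have e1 : (if k is m.+1 then (a m)%:C * (m == n)%:R else 0) = (a n)%:C * (k == n.+1)%:R :> R[i].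
      case: k => [|m]; first by rewrite mulr0.
      by rewrite eqSS; case: eqVneq => [->|] //; rewrite !mulr0.
    have e2 : (b k)%:C * (k == n)%:R = (b n)%:C * (k == n)%:R :> R[i].
      by case: eqVneq => [->|] //; rewrite !mulr0.
    have e3 : (a k)%:C * (k.+1 == n)%:R = (if n is m.+1 then (a m)%:C *: delta_l2 m else 0 : l2 R) k.
      case: (n) => [|m]; first by rewrite mulr0.
      rewrite eqSS -[RHS]/((a m)%:C * (k == m)%:R).
      by case: eqVneq => [->|] //; rewrite !mulr0.
    by rewrite e1 e2 e3; ring.
  have := Ev0; rewrite vE !linearD !linearZ/= En scaler0 addr0.
  have -> : E B (if n is m.+1 then (a m)%:C *: delta_l2 m else 0) = 0.
    by case: (n) Em => [|m] Em; rewrite ?linear0// linearZ/= Em scaler0.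
  rewrite add0r => /eqP; rewrite scaler_eq0 => /orP[|/eqP//].
  by move=> /eqP/complexI an0; have := a_gt0 n; rewrite an0 ltxx.
suff H n : E B (delta_l2 n) = 0 /\ E B (delta_l2 n.+1) = 0 by move=> n; have [] := H n.
elim: n => [|n [IH1 IH2]]; first by split => //; exact: step.
by split => //; apply: step.
Qed.

Lemma proj_eq0 B : measurable B -> E B (delta_l2 0) = 0 -> forall u, E B u = 0.
Proof.
move=> mB E0 u; have En := proj_delta_eq0 mB E0.
apply: l2_ext => k; rewrite pvm_symm ?linearZ/= En ?scaler0 rdot0r rdotC rdot0r//.
Qed.

End JacobiSpectralMeasure.

(** * Approximate solutions of the resolvent equation *)

Section Christoffel.
Context {R : realType}.
Variables a b : nat -> R.
Hypothesis a_gt0 : forall n, 0 < a n.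
Hypothesis carl : (fun n => \sum_(0 <= k < n) (a k)^-1) @ \oo --> +oo.
Local Notation Re := (@complex.Re R).
Local Notation Im := (@complex.Im R).
Local Notation "x %:C" := (real_complex R x).
Local Notation J := (jacobi_expr a b).

Lemma green_bilinear (u v : nat -> R[i]) N :
  \sum_(k < N.+1) (J u k * v k - u k * J v k)
  = (a N)%:C * (u N.+1 * v N - u N * v N.+1).
Proof.
elim: N => [|N IH].
  by rewrite big_ord1 /jacobi_expr; ring.
by rewrite big_ord_recr/= IH /jacobi_expr; ring.
Qed.

Lemma sum_solution (u v : nat -> R[i]) (z z' : R[i]) N :
  (forall k, J v k = z * v k) -> u N = 0 -> u N.+1 = 0 ->
  \sum_(k < N.+1) (J u k - z' * u k) * v k = (z - z') * \sum_(k < N.+1) u k * v k.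
Proof.
move=> vE uN uN1; have := green_bilinear u v N.
rewrite uN uN1 !mul0r subrr mulr0 => /eqP; rewrite sumrB subr_eq0 => /eqP E.
under eq_bigr do rewrite mulrBl.
rewrite sumrB E mulrBl !mulr_sumr; congr (_ - _); apply: eq_bigr => k _; rewrite ?vE; ring.
Qed.

(** The recurrence is solved downwards from M, one value of f per step;
    what is left at the index 0 is the solvability condition, that the
    right-hand side is orthogonal to the solution v of the homogeneous
    equation. *)
Lemma solve_inhomogeneous (z : R[i]) (v : nat -> R[i]) M (g : nat -> R[i]) :
  v 0%N = 1 -> (forall k, J v k = z * v k) ->
  (forall n, (M < n)%N -> g n = 0) -> \sum_(k < M.+1) g k * v k = 0 ->
  exists f, (forall n, (M <= n)%N -> f n = 0) /\ forall n, J f n - z * f n = g n.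
Proof.
move=> v0 vE; elim: M g => [|M IH] g gM gv.
  exists (fun=> 0); split => // n.
  have g0 : g n = 0.
    case: n => [|n]; last exact: gM.
    by move: gv; rewrite big_ord1 v0 mulr1.
  by rewrite g0 /jacobi_expr; case: n {g0} => [|n]; rewrite !mulr0 ?addr0 subr0.
have an0 : (a M)%:C != 0 by exact: aC_neq0.
(* The value f M is forced by the equation at the index M + 1. *)
pose f1 n : R[i] := if n == M then g M.+1 / (a M)%:C else 0.
have f1M n : (M < n)%N -> f1 n = 0 by rewrite /f1 => /gtn_eqF ->.
pose g1 n := g n - (J f1 n - z * f1 n).
have g1M n : (M < n)%N -> g1 n = 0.
  move=> Mn; rewrite /g1 (f1M n Mn) mulr0 subr0.
  have [->|nM] := eqVneq n M.+1.
    rewrite /jacobi_expr (f1M M.+1)// (f1M M.+2)// !mulr0 !addr0 /f1 eqxx.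
    by rewrite mulrCA divff// mulr1 subrr.
  have Mn1 : (M.+1 < n)%N by rewrite ltn_neqAle eq_sym nM.
  rewrite gM// /jacobi_expr; case: n Mn1 {Mn nM} => // n Mn1.
  by rewrite (f1M n)// (f1M n.+1) ?(f1M n.+2) ?leqW// !mulr0 !addr0 subr0.
have g1v : \sum_(k < M.+1) g1 k * v k = 0.
  have : \sum_(k < M.+2) g1 k * v k = 0.
    rewrite /g1; under eq_bigr do rewrite mulrBl.
    rewrite sumrB gv (sum_solution z vE (f1M M.+1 _) (f1M M.+2 _))//.
    by rewrite subrr mul0r subr0.
  by rewrite big_ord_recr/= g1M// mul0r addr0.
have [f2 [f2M f2E]] := IH g1 g1M g1v.
exists (fun n => f1 n + f2 n); split => n.
  by move=> Mn; rewrite f1M// f2M ?addr0// ltnW.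
rewrite jacobi_exprD mulrDr.
have := f2E n; rewrite /g1 => E.
by rewrite opprD addrACA E addrC subrK.
Qed.

Variables t y : R.
Hypothesis y_gt0 : 0 < y.
Let z : R[i] := Complex t y.
Let pz n : R[i] := (jpolyC a b n).[z].

(** The reciprocal of the Christoffel function at z = t + iy. *)
Definition christoffel M : R := \sum_(k < M.+1) sqmod (pz k).

Lemma jpolyC0_at : pz 0%N = 1. Proof. by rewrite /pz jpolyC0 hornerC. Qed.

Lemma christoffel_ge1 M : 1 <= christoffel M.
Proof.
rewrite /christoffel big_ord_recl/= jpolyC0_at {1}/sqmod/= expr1n expr0n addr0 lerDl.
by apply: sumr_ge0 => k _; exact: sqmod_ge0.
Qed.

(** By [jacobi_wronskian], y K_k = a_k Im (P_(k+1) conj P_k), which is at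
    most a_k (|P_k|^2 + |P_(k+1)|^2) / 2, while K_k >= 1; now divide by
    a_k and sum. *)
Lemma christoffel_lower M : y * \sum_(0 <= k < M) (a k)^-1 <= christoffel M.
Proof.
have step k : y / a k <= (sqmod (pz k) + sqmod (pz k.+1)) / 2.
  rewrite ler_pdivrMr//.
  have := jacobi_wronskian (jacobi_expr_jpolyC b a_gt0 z) k.
  rewrite -/(christoffel k) -/(pz k.+1) -/(pz k) /= => W.
  have h1 : y <= y * christoffel k by rewrite ler_peMr ?christoffel_ge1// ltW.
  apply: (le_trans h1); rewrite W mulrC ler_pM2r//.
  have := norm_cdot_le (pz k.+1) ('i%C * pz k); rewrite -Im_mulJ ler_norml => /andP[_].
  rewrite sqmodM (_ : sqmod 'i%C = 1) ?mul1r; last by rewrite /sqmod/= expr0n expr1n add0r.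
  by rewrite [sqmod (pz k) + _]addrC.
have h : \sum_(0 <= k < M) y / a k <= \sum_(0 <= k < M) (sqmod (pz k) + sqmod (pz k.+1)) / 2.
  by apply: ler_sum => k _; exact: step.
rewrite -mulr_sumr in h; apply: (le_trans h).
rewrite -mulr_suml big_split/= ler_pdivrMr// mulr_natr mulr2n.
apply: lerD.
  rewrite /christoffel -(big_mkord predT (fun k => sqmod (pz k))).
  by rewrite big_nat_recr//= lerDl sqmod_ge0.
rewrite /christoffel -(big_mkord predT (fun k => sqmod (pz k))).
by rewrite [leRHS]big_nat_recl//= lerDr sqmod_ge0.
Qed.

Lemma christoffel_cvgy : christoffel @ \oo --> +oo.
Proof.
apply/cvgryPge => A; near=> M.
apply: le_trans (christoffel_lower M); rewrite -ler_pdivrMl//.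
by near: M; move/cvgryPge : carl; apply.
Unshelve. all: end_near. Qed.

(** The multiple of the conjugate of P_n(z), cut after M, that makes
    delta_0 - [kernel_coef] orthogonal to the homogeneous solution; it is
    the one of smallest norm. *)
Definition kernel_coef M n : R[i] :=
  if (n <= M)%N then conjc (pz n) * (christoffel M)^-1%:C else 0.

Lemma sum_kernel_coef_sqmod M n : (M <= n)%N ->
  \sum_(k < n.+1) sqmod (kernel_coef M k) = (christoffel M)^-1.
Proof.
move=> Mn; have K0 : 0 < christoffel M by exact: lt_le_trans (christoffel_ge1 M).
rewrite -(big_mkord predT (fun k => sqmod (kernel_coef M k))) (@big_cat_nat _ _ _ M.+1)//=.
rewrite [X in _ + X]big_nat_cond [X in _ + X]big1 ?addr0 => [|k /andP[/andP[Mk _] _]]; last first.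
  by rewrite /kernel_coef leqNgt Mk /sqmod/= expr0n/= addr0.
rewrite big_mkord (eq_bigr (fun k : 'I_M.+1 => sqmod (pz k) * (christoffel M)^-1 ^+ 2)).
  rewrite -mulr_suml -/(christoffel M) expr2 mulrA divff ?mul1r// lt0r_neq0//.
move=> k _; rewrite /kernel_coef -ltnS ltn_ord sqmodM sqmodJ; congr (_ * _).
by rewrite /sqmod/= expr0n addr0.
Qed.

Lemma mulcJ_sqmod (x : R[i]) : conjc x * x = (sqmod x)%:C.
Proof. by case: x => p q; apply/eqP; rewrite eq_complex/sqmod/=; apply/andP; split; apply/eqP; ring. Qed.

(** The normalization of [kernel_coef] is the solvability condition of
    [solve_inhomogeneous]. *)
Lemma resolvent_approx M : exists f, (forall n, (M <= n)%N -> f n = 0) /\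
  forall n, J f n - z * f n = (n == 0%N)%:R - kernel_coef M n.
Proof.
apply: (@solve_inhomogeneous z pz).
- exact: jpolyC0_at.
- by move=> k; exact: jacobi_expr_jpolyC.
- by move=> n Mn; rewrite /kernel_coef leqNgt Mn subr0; case: n Mn.
under eq_bigr do rewrite mulrBl.
rewrite sumrB big_ord_recl/= jpolyC0_at mulr1 big1 ?addr0; last by move=> k _; rewrite mul0r.
apply/eqP; rewrite subr_eq0; apply/eqP.
have K0 : 0 < christoffel M by exact: lt_le_trans (christoffel_ge1 M).
rewrite (eq_bigr (fun k : 'I_M.+1 => (sqmod (pz k) / christoffel M)%:C)).
  by rewrite -rmorph_sum -mulr_suml -/(christoffel M) divff ?rmorph1// lt0r_neq0.
move=> k _; rewrite /kernel_coef -ltnS ltn_ord mulrAC mulcJ_sqmod.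
by rewrite -rmorphM.
Qed.

(** The Poisson kernel of the upper half-plane, without its factor y / pi. *)
Definition poisson (x : R) : R := ((x - t) ^+ 2 + y ^+ 2)^-1.

Lemma poisson_den_gt0 x : 0 < (x - t) ^+ 2 + y ^+ 2.
Proof. by rewrite ltr_wpDl ?sqr_ge0// exprn_gt0. Qed.

Lemma poisson_ge0 x : 0 <= poisson x.
Proof. by rewrite invr_ge0 ltW// poisson_den_gt0. Qed.

Lemma poisson_le x : poisson x <= y ^- 2.
Proof. by rewrite lef_pV2 ?posrE ?poisson_den_gt0 ?exprn_gt0// lerDr sqr_ge0. Qed.

(** Young's inequality 2 uv <= e u^2 + v^2 / e. *)
Lemma sqmodD_eps (e : R) (u v : R[i]) : 0 < e ->
  sqmod (u + v) <= (1 + e) * sqmod u + (1 + e^-1) * sqmod v.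
Proof.
move=> e0; case: u v => [p q] [r s]; rewrite /sqmod/= -subr_ge0.
have -> : (1 + e) * (p ^+ 2 + q ^+ 2) + (1 + e^-1) * (r ^+ 2 + s ^+ 2) -
   ((p + r) ^+ 2 + (q + s) ^+ 2) = e^-1 * ((e * p - r) ^+ 2 + (e * q - s) ^+ 2).
  by field; exact: lt0r_neq0.
by rewrite mulr_ge0 ?invr_ge0 ?(ltW e0)// addr_ge0 ?sqr_ge0.
Qed.

Section ApproximateResolvent.
Variables (M : nat) (f : nat -> R[i]).
Hypothesis fM : forall n, (M <= n)%N -> f n = 0.
Hypothesis fE : forall n, J f n - z * f n = (n == 0%N)%:R - kernel_coef M n.

Let comb (n : nat) (u : nat -> R[i]) (x : R) : R[i] :=
  \sum_(k < n.+1) u k * (jacobiP a b k x)%:C.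

Lemma comb_sqmod n u x : sqmod (comb n u x) =
  (\sum_(k < n.+1) Re (u k) * jacobiP a b k x) ^+ 2
  + (\sum_(k < n.+1) Im (u k) * jacobiP a b k x) ^+ 2.
Proof.
have -> : comb n u x = Complex (\sum_(k < n.+1) Re (u k) * jacobiP a b k x)
   (\sum_(k < n.+1) Im (u k) * jacobiP a b k x); last by [].
rewrite /comb; elim/big_ind3 : _ => // [p q r p' q' r' -> ->//|k _].
by case: (u k) => p q; apply/eqP; rewrite eq_complex/=; apply/andP; split; apply/eqP; ring.
Qed.

(** The relation (J - z) f = delta_0 - r, tested against the solution
    P_k(x) of the homogeneous equation at x. *)
Lemma comb_identity n x : (M <= n)%N ->
  comb n (kernel_coef M) x + (x%:C - z) * comb n f x = 1.
Proof.
move=> Mn.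
have vE k : J (fun k => (jacobiP a b k x)%:C) k = x%:C * (jacobiP a b k x)%:C.
  have := jacobi_expr_jpolyC b a_gt0 x%:C k.
  rewrite horner_jpolyC => <-; congr jacobi_expr; apply/funext => j.
  by rewrite horner_jpolyC.
have := sum_solution z vE (fM Mn) (fM (leqW Mn)).
rewrite -/(comb n f x) => <-.
under [X in _ + X]eq_bigr do rewrite fE mulrBl.
rewrite sumrB -/(comb n (kernel_coef M) x) addrC subrK.
rewrite big_ord_recl/= mulr1 big1 ?addr0 ?rmorph1// => k _.
by rewrite mul0r.
Qed.

Lemma sqmod_x_sub_z x : sqmod (x%:C - z) = (x - t) ^+ 2 + y ^+ 2.
Proof. by rewrite /sqmod/z/= add0r sqrrN. Qed.

(** By [comb_identity] the function 1 / (x - z) is a polynomial with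
    coefficients f up to the error [comb] n [kernel_coef] / (x - z). *)
Lemma comb_bounds n x e : (M <= n)%N -> 0 < e ->
  sqmod (comb n f x) <= (1 + e) * poisson x + (1 + e^-1) * y ^- 2 * sqmod (comb n (kernel_coef M) x)
  /\ poisson x <= (1 + e) * sqmod (comb n f x) + (1 + e^-1) * y ^- 2 * sqmod (comb n (kernel_coef M) x).
Proof.
move=> Mn e0; have I := comb_identity x Mn.
have d0 := poisson_den_gt0 x; have g0 := poisson_ge0 x; have gy := poisson_le x.
have ei : 0 <= 1 + e^-1 by rewrite addr_ge0// invr_ge0 ltW.
have k0 := sqmod_ge0 (comb n (kernel_coef M) x).
split.
  have h : sqmod (comb n f x) = poisson x * sqmod (1 + (-1) * comb n (kernel_coef M) x).
    have -> : 1 + (-1) * comb n (kernel_coef M) x = (x%:C - z) * comb n f x by rewrite mulN1r -I; ring.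
    by rewrite sqmodM sqmod_x_sub_z /poisson mulrA mulVf ?mul1r// lt0r_neq0.
  have := sqmodD_eps 1 ((-1) * comb n (kernel_coef M) x) e0; rewrite sqmodM.
  have -> : sqmod (1 : R[i]) = 1 by rewrite /sqmod/= expr1n expr0n addr0.
  have -> : sqmod (-1 : R[i]) = 1 by rewrite /sqmod/= sqrrN expr1n oppr0 expr0n addr0.
  rewrite mul1r mulr1 => h2.
  rewrite h; apply: (le_trans (ler_wpM2l g0 h2)).
  rewrite mulrDr [poisson x * _]mulrC lerD2l mulrCA -mulrA ler_wpM2l//.
  by rewrite ler_wpM2r.
have h : poisson x = poisson x * sqmod ((x%:C - z) * comb n f x + comb n (kernel_coef M) x).
  by rewrite addrC I /sqmod/= expr1n expr0n addr0 mulr1.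
have := sqmodD_eps ((x%:C - z) * comb n f x) (comb n (kernel_coef M) x) e0.
rewrite sqmodM sqmod_x_sub_z => h2.
rewrite {1}h; apply: (le_trans (ler_wpM2l g0 h2)).
rewrite mulrDr; apply: lerD.
  rewrite mulrCA ler_wpM2l//; first by rewrite addr_ge0// ltW.
  by rewrite /poisson mulrA mulVf ?mul1r// lt0r_neq0.
by rewrite mulrCA -mulrA ler_wpM2l// ler_wpM2r.
Qed.

(** Up to the factor sqrt(n+1) / a_n this is 1 / pi times the quantity
    whose limit gives the spectral density. *)
Definition approx_density n (x : R) : R := (pi * a n * sqden a b n x)^-1.

Lemma approx_density_ge0 n x : 0 <= approx_density n x.
Proof.
by rewrite invr_ge0 ltW// !mulr_gt0 ?pi_gt0// sqden_gt0.
Qed.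

Lemma continuous_approx_density n : continuous (approx_density n).
Proof.
move=> x; apply: cvgV; first by rewrite lt0r_neq0// !mulr_gt0 ?pi_gt0// sqden_gt0.
by apply: cvgM; [exact: cvg_cst|exact: continuous_sqden].
Qed.

Lemma measurable_approx_density n :
  measurable_fun setT (approx_density n : measurableTypeR R -> R).
Proof. by apply: continuous_measurable_fun; exact: continuous_approx_density. Qed.

Lemma continuous_poisson : continuous poisson.
Proof.
move=> x; apply: cvgV; first by rewrite lt0r_neq0// poisson_den_gt0.
apply: cvgD; last exact: cvg_cst.
under eq_fun do rewrite expr2.
by apply: cvgM; apply: cvgB => //; exact: cvg_cst.
Qed.

Lemma measurable_poisson : measurable_fun setT (poisson : measurableTypeR R -> R).
Proof. by apply: continuous_measurable_fun; exact: continuous_poisson. Qed.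

Lemma measurable_real_comb n (u : nat -> R) : measurable_fun setT
  ((fun x => (\sum_(k < n.+1) u k * jacobiP a b k x) ^+ 2) : measurableTypeR R -> R).
Proof.
apply: measurable_funX; apply: measurable_sum => k; apply: measurable_funM => //.
by apply: continuous_measurable_fun; exact: continuous_jacobiP.
Qed.

Lemma measurable_comb_sqmod n u :
  measurable_fun setT ((fun x => sqmod (comb n u x)) : measurableTypeR R -> R).
Proof.
rewrite (_ : (fun _ => _) = (fun x => (\sum_(k < n.+1) Re (u k) * jacobiP a b k x) ^+ 2
  + (\sum_(k < n.+1) Im (u k) * jacobiP a b k x) ^+ 2)).
  apply: measurable_funD.
    exact: (measurable_real_comb n (fun k => Re (u k))).
  exact: (measurable_real_comb n (fun k => Im (u k))).
by apply/funext => x; rewrite comb_sqmod.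
Qed.

Lemma integral_comb n u :
  (\int[lebesgue_measure]_x (sqmod (comb n u x) * approx_density n x)%:E
   = (\sum_(k < n.+1) sqmod (u k))%:E)%E.
Proof.
under eq_integral do rewrite comb_sqmod mulrDl EFinD.
have ms (v : nat -> R) : measurable_fun setT
   (fun x : measurableTypeR R => ((\sum_(k < n.+1) v k * jacobiP a b k x) ^+ 2 * approx_density n x)%:E).
  apply/measurable_EFinP; apply: measurable_funM; last exact: measurable_approx_density.
  exact: measurable_real_comb.
rewrite ge0_integralD//; first last.
- exact: (ms (fun k => Im (u k))).
- by move=> x _; rewrite lee_fin mulr_ge0 ?sqr_ge0 ?approx_density_ge0.
- exact: (ms (fun k => Re (u k))).
- by move=> x _; rewrite lee_fin mulr_ge0 ?sqr_ge0 ?approx_density_ge0.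
rewrite (integral_jacobiP_sqr b a_gt0 (fun k : 'I_n.+1 => Re (u k))).
rewrite (integral_jacobiP_sqr b a_gt0 (fun k : 'I_n.+1 => Im (u k))).
by rewrite -EFinD -big_split.
Qed.

Lemma approx_density_mass n :
  (\int[lebesgue_measure]_x (approx_density n x)%:E = 1)%E.
Proof.
have := integral_comb n (fun k => (k == 0%N)%:R).
rewrite big_ord_recl/= big1 ?addr0 => [|k _]; last by rewrite /sqmod/= expr0n addr0.
rewrite {2}/sqmod/= expr1n expr0n addr0 => <-; apply: eq_integral => x _.
rewrite (_ : comb n _ x = 1) /sqmod/= ?expr1n ?expr0n ?addr0 ?mul1r//.
rewrite /comb big_ord_recl/= big1 ?addr0 ?mul1r ?rmorph1// => k _.
by rewrite mul0r.
Qed.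

Definition approx_poisson n := \int[lebesgue_measure]_x (poisson x * approx_density n x).

Lemma measurable_poisson_approx n : measurable_fun setT
  (fun x : measurableTypeR R => (poisson x * approx_density n x)%:E).
Proof.
apply/measurable_EFinP; apply: measurable_funM; first exact: measurable_poisson.
exact: measurable_approx_density.
Qed.

Lemma approx_poisson_le n :
  (\int[lebesgue_measure]_x (poisson x * approx_density n x)%:E <= (y ^- 2)%:E)%E.
Proof.
apply: (@le_trans _ _ (\int[lebesgue_measure]_x ((y ^- 2)%:E * (approx_density n x)%:E))%E).
  apply: ge0_le_integral => //.
  - by move=> x _; rewrite lee_fin mulr_ge0 ?poisson_ge0 ?approx_density_ge0.
  - exact: measurable_poisson_approx.
  - apply: emeasurable_funM => //; apply/measurable_EFinP; exact: measurable_approx_density.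
  - by move=> x _; rewrite -EFinM lee_fin ler_wpM2r ?approx_density_ge0 ?poisson_le.
rewrite ge0_integralZl ?approx_density_mass ?mule1 ?lee_fin//.
- apply/measurable_EFinP; exact: measurable_approx_density.
- by move=> x _; rewrite lee_fin approx_density_ge0.
- by rewrite invr_ge0 sqr_ge0.
Qed.

Lemma approx_poissonE n :
  (\int[lebesgue_measure]_x (poisson x * approx_density n x)%:E = (approx_poisson n)%:E)%E.
Proof.
rewrite /approx_poisson /Rintegral fineK// ge0_fin_numE; last first.
  by apply: integral_ge0 => x _; rewrite lee_fin mulr_ge0 ?poisson_ge0 ?approx_density_ge0.
by apply: le_lt_trans (approx_poisson_le n) _; exact: ltry.
Qed.

(** [comb_bounds] integrated against [approx_density], by orthonormality. *)
Lemma approx_poisson_bounds n e : (M <= n)%N -> 0 < e ->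
  let N := \sum_(k < n.+1) sqmod (f k) in let d := (1 + e^-1) * y ^- 2 / christoffel M in
  N <= (1 + e) * approx_poisson n + d /\ approx_poisson n <= (1 + e) * N + d.
Proof.
move=> Mn e0 N d.
have e1 : 0 <= 1 + e by rewrite addr_ge0// ltW.
have ey : 0 <= (1 + e^-1) * y ^- 2.
  by rewrite mulr_ge0 ?invr_ge0 ?sqr_ge0// addr_ge0// invr_ge0 ltW.
have NE := integral_comb n f; rewrite -/N in NE.
have KE := integral_comb n (kernel_coef M); rewrite sum_kernel_coef_sqmod// in KE.
have PE := approx_poissonE n.
have mk (u : R -> R) : measurable_fun setT (u : measurableTypeR R -> R) ->
   measurable_fun setT (fun x : measurableTypeR R => (u x * approx_density n x)%:E).
  move=> mu; apply/measurable_EFinP; apply: measurable_funM => //.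
  exact: measurable_approx_density.
have key (u v w : R -> R) (c1 c2 : R) (U V W : R) :
  measurable_fun setT (u : measurableTypeR R -> R) ->
  measurable_fun setT (v : measurableTypeR R -> R) ->
  measurable_fun setT (w : measurableTypeR R -> R) ->
  (forall x, 0 <= u x) -> (forall x, 0 <= v x) -> (forall x, 0 <= w x) -> 0 <= c1 -> 0 <= c2 ->
  (forall x, u x <= c1 * v x + c2 * w x) ->
  (\int[lebesgue_measure]_x (u x * approx_density n x)%:E = U%:E)%E ->
  (\int[lebesgue_measure]_x (v x * approx_density n x)%:E = V%:E)%E ->
  (\int[lebesgue_measure]_x (w x * approx_density n x)%:E = W%:E)%E ->
  U <= c1 * V + c2 * W.
  move=> mu mv mw u0 v0 w0 c10 c20 h hU hV hW.
  rewrite -lee_fin EFinD !EFinM -hU -hV -hW.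
  have nn (g : R -> R) x : (forall x, 0 <= g x) -> (0 <= (g x * approx_density n x)%:E)%E.
    by move=> g0; rewrite lee_fin mulr_ge0 ?approx_density_ge0.
  rewrite -!ge0_integralZl//; try by [exact: mk|move=> x _; exact: nn].
  rewrite -ge0_integralD//; first last.
  - by apply: emeasurable_funM => //; exact: mk.
  - by move=> x _; rewrite mule_ge0// nn.
  - by apply: emeasurable_funM => //; exact: mk.
  - by move=> x _; rewrite mule_ge0// nn.
  apply: ge0_le_integral => //.
  - by move=> x _; exact: nn.
  - exact: mk.
  - by apply: emeasurable_funD; apply: emeasurable_funM => //; exact: mk.
  - move=> x _; rewrite -!EFinM -EFinD lee_fin !mulrA -mulrDl ler_wpM2r ?approx_density_ge0//.
have mf := measurable_comb_sqmod n f; have mK := measurable_comb_sqmod n (kernel_coef M).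
split; rewrite /d.
  apply: (key _ _ _ _ _ _ _ _ mf measurable_poisson mK _ _ _ e1 ey _ NE PE KE) => x.
  - exact: sqmod_ge0.
  - exact: poisson_ge0.
  - exact: sqmod_ge0.
  - exact: (comb_bounds x Mn e0).1.
apply: (key _ _ _ _ _ _ _ _ measurable_poisson mf mK _ _ _ e1 ey _ PE NE KE) => x.
- exact: poisson_ge0.
- exact: sqmod_ge0.
- exact: sqmod_ge0.
- exact: (comb_bounds x Mn e0).2.
Qed.

End ApproximateResolvent.

End Christoffel.

(** * The Poisson integral of the spectral measure *)

Section SpectralPoisson.
Context {R : realType}.
Variable E : pvm R.
Local Notation mu := (pvm_measure E).
Implicit Types (u v w : l2 R).
Local Notation "x %:C" := (real_complex R x).

Lemma sqnormD_eps (e : R) u v : 0 < e ->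
  sqnorm (u + v) <= (1 + e) * sqnorm u + (1 + e^-1) * sqnorm v.
Proof.
move=> e0; have := sqnorm_ge0 (e%:C *: u - v).
rewrite sqnormB sqnormZ rdotZl sqnormD => h.
rewrite -subr_ge0.
have -> : (1 + e) * sqnorm u + (1 + e^-1) * sqnorm v
    - (sqnorm u + 2 * rdot u v + sqnorm v) =
   e^-1 * (e ^+ 2 * sqnorm u - 2 * (e * rdot u v) + sqnorm v).
  by field; exact: lt0r_neq0.
by rewrite mulr_ge0// invr_ge0 ltW.
Qed.

(** Young's inequality for the norms E(A)(u + v), integrated. *)
Lemma pvm_integralD_le (e : R) u v (f : measurableTypeR R -> \bar R) : 0 < e ->
  measurable_fun setT f -> (forall x, 0 <= f x)%E ->
  (\int[mu (u + v)%R]_x f x <=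
   (1 + e)%:E * \int[mu u]_x f x + (1 + e^-1)%:E * \int[mu v]_x f x)%E.
Proof.
move=> e0 mf f0.
have e1 : 0 <= 1 + e by rewrite addr_ge0// ltW.
have e2 : 0 <= 1 + e^-1 by rewrite addr_ge0// invr_ge0 ltW.
pose m1 := mscale (NngNum e1) (mu u); pose m2 := mscale (NngNum e2) (mu v).
have -> : ((1 + e)%:E * \int[mu u]_x f x = \int[m1]_x f x)%E.
  by rewrite ge0_integral_mscale.
have -> : ((1 + e^-1)%:E * \int[mu v]_x f x = \int[m2]_x f x)%E.
  by rewrite ge0_integral_mscale.
rewrite -ge0_integral_measure_add//.
apply: ge0_le_measure_integral => // A mA.
rewrite [leRHS](measure_addE m1 m2 A) /m1 /m2 /mscale/=.
rewrite -[leRHS]/((1 + e)%:E * mu u A + (1 + e^-1)%:E * mu v A)%E.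
rewrite !pvm_measureE linearD/=.
by rewrite -!EFinM -EFinD lee_fin sqnormD_eps.
Qed.

Variables t y : R.
Hypothesis y_gt0 : 0 < y.
Local Notation P := (poisson t y).

Let mP : measurable_fun setT (fun x : measurableTypeR R => (P x)%:E).
Proof. by apply/measurable_EFinP; exact: measurable_poisson. Qed.

Let P0 (x : measurableTypeR R) : (0 <= (P x)%:E)%E.
Proof. by rewrite lee_fin poisson_ge0. Qed.

Lemma pvm_poisson_le u : (\int[mu u]_x (P x)%:E <= (y ^- 2 * sqnorm u)%:E)%E.
Proof.
apply: (@le_trans _ _ (\int[mu u]_x (cst (y ^- 2)%:E) x)%E).
  apply: ge0_le_integral => //.
  by move=> x _; rewrite lee_fin poisson_le.
by rewrite integral_cst// EFinM -(pvm_measureT E).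
Qed.

Definition pvm_poisson u : R := \int[mu u]_x P x.

Lemma pvm_poissonE u : (\int[mu u]_x (P x)%:E = (pvm_poisson u)%:E)%E.
Proof.
rewrite /pvm_poisson /Rintegral fineK// ge0_fin_numE ?integral_ge0//.
by apply: le_lt_trans (pvm_poisson_le u) _; exact: ltry.
Qed.

Lemma pvm_poissonD_le (e : R) u v : 0 < e ->
  pvm_poisson (u + v) <= (1 + e) * pvm_poisson u + (1 + e^-1) * (y ^- 2 * sqnorm v).
Proof.
move=> e0; have e2 : 0 <= 1 + e^-1 by rewrite addr_ge0// invr_ge0 ltW.
have h : pvm_poisson v <= y ^- 2 * sqnorm v.
  by rewrite -lee_fin -pvm_poissonE pvm_poisson_le.
apply: le_trans (_ : _ <= (1 + e) * pvm_poisson u + (1 + e^-1) * pvm_poisson v) _.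
  by rewrite -lee_fin EFinD !EFinM -!pvm_poissonE; exact: pvm_integralD_le.
by rewrite lerD2l ler_wpM2l.
Qed.

Variables a b : nat -> R.
Hypothesis a_gt0 : forall n, 0 < a n.
Hypothesis carl : (fun n => \sum_(0 <= k < n) (a k)^-1) @ \oo --> +oo.
Hypothesis ET : is_spectral_measure (jacobi a b) E.

Lemma pvm_poisson_resolvent w v : jacobi_max a b (w, v) ->
  pvm_poisson (v - (Complex t y) *: w) = sqnorm w.
Proof.
move=> wv; apply: EFin_inj; rewrite -pvm_poissonE.
rewrite (@ge0_integral_density _ _ _ (mu w) (mu (v - (Complex t y) *: w))
  (fun x => (x - t) ^+ 2 + y ^+ 2))//.
- under eq_integral.
    move=> x _; rewrite -EFinM /poisson mulVf; last by rewrite lt0r_neq0 ?poisson_den_gt0.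
    over.
  by rewrite integral_cst// mul1e; exact: pvm_measureT.
- apply: measurable_funD => //.
  by apply: measurable_funX; exact: measurable_funB.
- by move=> x; rewrite ltW ?poisson_den_gt0.
- by move=> A mA; exact: (resolvent_density a_gt0 carl ET t y mA wv).
Qed.

(** The counterpart of [approx_poisson_bounds] for the spectral measure:
    the Poisson integral of (J - z) f is the squared norm of f exactly,
    and (J - z) f differs from delta_0 by a small vector. *)
Lemma pvm_poisson_bounds M (f : nat -> R[i]) n e :
  (forall n, (M <= n)%N -> f n = 0) ->
  (forall n, jacobi_expr a b f n - (Complex t y) * f n = (n == 0%N)%:R - kernel_coef a b t y M n) ->
  (M <= n)%N -> 0 < e ->
  let N := \sum_(k < n.+1) sqmod (f k) in
  let d := (1 + e^-1) * y ^- 2 / christoffel a b t y M in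
  let A := pvm_poisson (delta_l2 0) in
  N <= (1 + e) * A + d /\ A <= (1 + e) * N + d.
Proof.
move=> fM fE Mn e0 N d A.
have ff : finitely_supported f by exists M.
pose w := l2fin ff; pose v := l2fin (jacobi_expr_finite a b ff).
have wv : jacobi_max a b (w, v) by apply: jacobi0_max; exact: jacobi0P.
have NE : sqnorm w = N.
  rewrite (@sqnorm_fin _ w n.+1) ?big_mkord// => k nk /=.
  by apply: fM; rewrite (leq_trans Mn)// ltnW.
pose eta := v - Complex t y *: w.
have etaE : pvm_poisson eta = N by rewrite -NE pvm_poisson_resolvent.
pose r := delta_l2 0 - eta.
have rE : sqnorm r = (christoffel a b t y M)^-1.
  have rk k : r k = kernel_coef a b t y M k.
    rewrite -[LHS]/((k == 0%N)%:R - (jacobi_expr a b f k - Complex t y * f k)) fE.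
    by rewrite opprB addrCA subrr addr0.
  rewrite (@sqnorm_fin _ r n.+1) => [|k nk]; last first.
    by rewrite rk /kernel_coef leqNgt (leq_ltn_trans Mn nk).
  rewrite -(sum_kernel_coef_sqmod a b t y Mn) big_mkord.
  by apply: eq_bigr => k _; rewrite rk.
have rN : sqnorm (- r) = sqnorm r.
  by rewrite /sqnorm rdotNl rdotNr opprK.
have := pvm_poissonD_le eta r e0; have := pvm_poissonD_le (delta_l2 0) (- r) e0.
rewrite rN rE etaE.
have -> : delta_l2 0 - r = eta by rewrite /r opprB addrCA subrr addr0.
have -> : eta + r = delta_l2 0 by rewrite /r addrCA subrr addr0.
by rewrite etaE !mulrA.
Qed.

(** Both quantities are within a factor 1 + e and an error d of the same
    squared norm, where e is arbitrary and d tends to 0 with M for fixed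
    e. *)
Lemma approx_poisson_cvg : approx_poisson a b t y @ \oo --> pvm_poisson (delta_l2 0).
Proof.
set A := pvm_poisson _.
have A0 : 0 <= A.
  by rewrite -lee_fin -pvm_poissonE integral_ge0.
pose Y := y ^- 2.
have Y0 : 0 <= Y by rewrite invr_ge0 sqr_ge0.
have AY : A <= Y.
  rewrite -lee_fin -pvm_poissonE; apply: le_trans (pvm_poisson_le _) _.
  by rewrite sqnorm_delta mulr1.
have BY n : approx_poisson a b t y n <= Y.
  by rewrite -lee_fin -approx_poissonE// approx_poisson_le.
have B0 n : 0 <= approx_poisson a b t y n.
  rewrite -lee_fin -approx_poissonE// integral_ge0// => x _.
  by rewrite lee_fin mulr_ge0 ?poisson_ge0 ?approx_density_ge0.
apply/cvgrPdist_lt => eps eps0.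
(* Both quantities are at most Y, so a factor (1 + e)^2 <= 1 + 3 e costs
   at most 3 e Y, and the errors cost at most 3 d; each is below eps / 2. *)
pose e := eps / (6 * Y + eps).
have D0 : 0 < 6 * Y + eps by rewrite ltr_wpDl// mulr_ge0.
have e0 : 0 < e by rewrite divr_gt0.
have e1 : e <= 1 by rewrite ler_pdivrMr// mul1r lerDr mulr_ge0.
have eY : 6 * (e * Y) < eps.
  rewrite /e mulrAC mulrA ltr_pdivrMr// ; have := mulr_gt0 eps0 eps0.
  by rewrite mulrDr mulrCA ltrDl.
pose c := (1 + e^-1) * Y.
have c0 : 0 <= c by rewrite mulr_ge0// addr_ge0// invr_ge0 ltW.
have [M _ hM] := (cvgryPge _).1 (christoffel_cvgy b a_gt0 carl t y_gt0) (6 * c / eps + 1).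
have {}hM := hM M (leqnn M).
have K0 : 0 < christoffel a b t y M by apply: lt_le_trans (christoffel_ge1 a b t y M).
have dE : 6 * (c / christoffel a b t y M) < eps.
  rewrite mulrA ltr_pdivrMr// [eps * _]mulrC -ltr_pdivrMr//.
  by apply: lt_le_trans hM; rewrite ltrDl.
have [f [fM fE]] := resolvent_approx b a_gt0 t y M.
exists M => // n /= Mn.
have [] := pvm_poisson_bounds fM fE Mn e0; rewrite -/A.
have [] := approx_poisson_bounds a_gt0 y_gt0 fM fE Mn e0.
rewrite -/Y -/c; move: (c / christoffel a b t y M) dE => d dE.
have {}B0 := B0 n; have {}BY := BY n.
move: (approx_poisson a b t y n) B0 BY (\sum_(k < n.+1) _) => B B0 BY N.
clear hM fM fE ET carl mP P0 K0 Mn.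
move=> h1 h2 h3 h4.
have s1 (p q : R) : p <= (1 + e) * N + d -> N <= (1 + e) * q + d -> 0 <= q -> q <= Y -> p - q < eps.
  move=> k1 k2 q0 qY.
  have k3 : (1 + e) * N <= (1 + e) * ((1 + e) * q + d) by rewrite ler_wpM2l// addr_ge0// ltW.
  have k4 : e * q <= e * Y by rewrite ler_wpM2l// ltW.
  have k5 : e * (e * q) <= 1 * (e * q) by rewrite ler_wpM2r// mulr_ge0// ltW.
  have dd : 0 <= d \/ d < 0 by case: (ltP d 0); [right|left].
  have k6 : (1 + e) * d <= 2 * Num.max d 0.
    apply: (@le_trans _ _ ((1 + e) * Num.max d 0)).
      by rewrite ler_wpM2l ?le_max ?lexx// addr_ge0// ltW.
    by rewrite ler_wpM2r ?le_max ?lexx ?orbT//; lra.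
  have k7 : 6 * Num.max d 0 < eps by rewrite maxEle; case: ifP => _ //; lra.
  have k8 : d <= Num.max d 0 by rewrite le_max lexx.
  move: (Num.max d 0) k6 k7 k8 => D k6 k7 k8.
  have k9 : (1 + e) * ((1 + e) * q + d) = q + 2 * (e * q) + e * (e * q) + (1 + e) * d by ring.
  rewrite k9 in k3; clear k9.
  by move: ((1 + e) * N) ((1 + e) * d) (e * (e * q)) (e * q) (e * Y) k1 k3 k4 k5 k6 eY => z1 z2 z3 z4 z5 *; lra.
rewrite ltr_norml; apply/andP; split.
  by rewrite ltrNl opprB; apply: s1.
exact: s1.
Qed.

End SpectralPoisson.

(** * A finite measure is determined by its Poisson integral *)

Section PoissonDetermines.
Context {R : realType}.
Implicit Types (m : {finite_measure set (measurableTypeR R) -> \bar R}).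

Lemma poissonC t y (x : R) : poisson t y x = poisson x y t.
Proof. by rewrite /poisson -[(x - t) ^+ 2]sqrrN opprB. Qed.

Lemma integral_poisson_itv (p q x y : R) : p < q -> 0 < y ->
  (\int[lebesgue_measure]_(t in `[p, q]) (poisson t y x)%:E =
   (y^-1 * (atan ((q - x) / y) - atan ((p - x) / y)))%:E)%E.
Proof.
move=> pq y0; pose F t := y^-1 * atan ((t - x) / y).
have dF (t : R) : is_derive t 1 F (poisson x y t).
  rewrite /F; apply: is_derive_eq.
  have yn0 := lt0r_neq0 y0; have qn0 := lt0r_neq0 (poisson_den_gt0 x y0 t).
  rewrite /poisson /GRing.scale/=; field.
  by rewrite qn0 yn0.
have cF : continuous F.
  move=> t; apply/differentiable_continuous/derivable1_diffP.
  by have [] := dF t.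
under eq_integral do rewrite poissonC.
rewrite (@continuous_FTC2 _ (poisson x y) F p q) //.
- by rewrite -EFinB /F -mulrBr.
- by apply: continuous_subspaceT; exact: continuous_poisson.
- split.
  + by move=> t _; have [] := dF t.
  + by apply: cvg_at_right_filter; exact: cF.
  + by apply: cvg_at_left_filter; exact: cF.
- by move=> t _; rewrite derive1E; apply: derive_val; exact: dF.
Qed.

(** Tonelli's theorem, and the primitive of the kernel with respect to its
    centre. *)
Lemma fubini_poisson m (p q y : R) : p < q -> 0 < y ->
  (\int[lebesgue_measure]_(t in `[p, q]) \int[m]_x (poisson t y x)%:E =
   \int[m]_x (y^-1 * (atan ((q - x) / y) - atan ((p - x) / y)))%:E)%E.
Proof.
move=> pq y0.
pose I : set (measurableTypeR R) := `[p, q]%classic.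
have mI : measurable I by exact: measurable_itv.
pose f (u : measurableTypeR R * measurableTypeR R) := (poisson u.1 y u.2 * \1_I u.1)%:E.
have mf : measurable_fun setT f.
  apply/measurable_EFinP; apply: measurable_funM; last first.
    by apply: measurableT_comp => //; exact: measurable_indic.
  rewrite (_ : (fun u => _) = (fun u : measurableTypeR R * measurableTypeR R => poisson 0 y (u.2 - u.1))).
    apply: (measurableT_comp (measurable_poisson 0 y0)).
    exact: measurable_funB.
  by apply/funext => u; rewrite /poisson subr0.
have f0 u : (0 <= f u)%E by rewrite lee_fin mulr_ge0// poisson_ge0.
rewrite integral_mkcond.
have -> : ((fun t : R => \int[m]_x (poisson t y x)%:E) \_ `[p, q])%E
   = (fun t => \int[m]_x f (t, x))%E.
  apply/funext => t; rewrite patchE /f/= indicE /I; case: ifP => _.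
    by apply: eq_integral => x _; rewrite mulr1.
  by under eq_integral do rewrite mulr0; rewrite integral0.
rewrite fubini_tonelli//; apply: eq_integral => x _.
rewrite -integral_poisson_itv// [RHS]integral_mkcond; apply: eq_integral => t _.
by rewrite patchE /f/= indicE /I; case: ifP => _; rewrite ?mulr1 ?mulr0.
Qed.

Section agreement.
Variables m1 m2 : {finite_measure set (measurableTypeR R) -> \bar R}.

(** The bounded functions on which both measures have the same integral;
    they are closed under linear combinations and bounded pointwise
    limits. *)
Definition agree (f : measurableTypeR R -> R) := [/\ measurable_fun setT f,
  exists C, forall x, `|f x| <= C & (\int[m1]_x (f x)%:E = \int[m2]_x (f x)%:E)%E].

Lemma bounded_integrable m (f : measurableTypeR R -> R) : measurable_fun setT f ->
  (exists C, forall x, `|f x| <= C) -> m.-integrable setT (EFin \o f).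
Proof.
move=> mf [C fC].
apply: (@le_integrable _ _ _ _ _ measurableT _ (EFin \o cst C)).
- exact/measurable_EFinP.
- by move=> x _; rewrite lee_fin/= (le_trans (fC x))// ler_norm.
- exact: finite_measure_integrable_cst.
Qed.

Lemma agreeD f g : agree f -> agree g -> agree (fun x => f x + g x).
Proof.
move=> [mf [C fC] fE] [mg [D gD] gE]; split; first exact: measurable_funD.
  by exists (C + D) => x; rewrite (le_trans (ler_normD _ _))// lerD.
under eq_integral do rewrite EFinD.
under [RHS]eq_integral do rewrite EFinD.
rewrite !integralD//; [by congr (_ + _)%E| | | | ]; apply: bounded_integrable => //;
  by [exists C|exists D].
Qed.

Lemma agreeZ c f : agree f -> agree (fun x => c * f x).
Proof.
move=> [mf [C fC] fE]; split; first exact: measurable_funM.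
  by exists (`|c| * C) => x; rewrite normrM ler_wpM2l.
under eq_integral do rewrite EFinM.
under [RHS]eq_integral do rewrite EFinM.
by rewrite !integralZl ?fE//; apply: bounded_integrable => //; exists C.
Qed.

Lemma agree_lim (f_ : nat -> measurableTypeR R -> R) (f : measurableTypeR R -> R) C :
  (forall n, agree (f_ n)) -> (forall n x, `|f_ n x| <= C) ->
  (forall x, f_ ^~ x @ \oo --> f x) -> agree f.
Proof.
move=> fA fC ff.
have mf_ n : measurable_fun setT (f_ n) by case: (fA n).
have mf : measurable_fun setT f by exact: (measurable_fun_cvg mf_ (fun x _ => ff x)).
split=> //.
  exists C => x.
  have cn : (fun n => `|f_ n x|) @ \oo --> `|f x| by apply: cvg_norm; exact: ff.
  rewrite -(cvg_lim _ cn)//; apply: limr_le; first by apply/cvg_ex; eexists; exact: cn.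
  exact: nearW.
have key (m : {finite_measure set (measurableTypeR R) -> \bar R}) :
    (fun n => \int[m]_x (f_ n x)%:E)%E @ \oo --> (\int[m]_x (f x)%:E)%E.
  have [] := @dominated_convergence _ _ _ m setT measurableT
    (fun n x => (f_ n x)%:E) (EFin \o f) (EFin \o cst C).
  - by move=> n; exact/measurable_EFinP.
  - exact/measurable_EFinP.
  - by apply: aeW => x _; apply: cvg_EFin; [exact: nearW|exact: ff].
  - exact: finite_measure_integrable_cst.
  - by apply: aeW => x /= n _; rewrite lee_fin.
  - by [].
have h1 := key m1; have h2 := key m2.
rewrite (_ : (fun n => \int[m2]_x (f_ n x)%:E)%E = (fun n => \int[m1]_x (f_ n x)%:E)%E) in h2.
  by apply: (cvg_unique _ h1 h2); exact: ereal_hausdorff.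
by apply/funext => n; case: (fA n).
Qed.

Hypothesis m12 : forall t y : R, 0 < y ->
  (\int[m1]_x (poisson t y x)%:E = \int[m2]_x (poisson t y x)%:E)%E.

Lemma agree_poisson t y : 0 < y -> agree (poisson t y).
Proof.
move=> y0; split; [exact: measurable_poisson| |exact: m12].
by exists (y ^- 2) => x; rewrite ger0_norm ?poisson_ge0// poisson_le.
Qed.

Let y_ (k : nat) : R := k.+1%:R^-1.

Let y_gt0 k : 0 < y_ k. Proof. by rewrite invr_gt0. Qed.

Let y_cvg0 : y_ @ \oo --> 0.
Proof. exact: cvg_harmonic. Qed.

(** The kernel times y^2 is at most 1 and tends to the indicator of its
    centre. *)
Lemma agree_atom t : agree \1_[set t].
Proof.
apply: (@agree_lim (fun k x => y_ k ^+ 2 * poisson t (y_ k) x) _ 1).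
- by move=> n; apply: agreeZ; exact: agree_poisson.
- move=> n x; rewrite ger0_norm; last by rewrite mulr_ge0 ?sqr_ge0// poisson_ge0.
  apply: le_trans (ler_wpM2l (sqr_ge0 _) (poisson_le t (y_gt0 n) x)) _.
  by rewrite divff// expf_neq0// lt0r_neq0.
move=> x; rewrite indicE in_set1; case: eqVneq => [->|xt].
  rewrite (_ : (fun _ => _) = cst 1); first exact: cvg_cst.
  by apply/funext => k; rewrite /poisson subrr expr0n add0r divff// expf_neq0// lt0r_neq0.
have xt0 : (x - t) ^+ 2 != 0 by rewrite sqrf_eq0 subr_eq0.
have -> : false%:R = 0 * 0 * ((x - t) ^+ 2 + 0 * 0)^-1 :> R by rewrite !mul0r.
have yy : (fun k => y_ k ^+ 2) @ \oo --> (0 * 0 : R).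
  by under eq_fun do rewrite expr2; exact: cvgM.
apply: cvgM => //; apply: cvgV; first by rewrite mul0r addr0.
by apply: cvgD => //; exact: cvg_cst.
Qed.

Lemma norm_atan_le (x : R) : `|atan x| <= pi / 2.
Proof. by rewrite ler_norml ltW ?atan_gtNpi2// ltW ?atan_ltpi2. Qed.

Lemma agree_atan p q y : p < q -> 0 < y ->
  agree (fun x => atan ((q - x) / y) - atan ((p - x) / y)).
Proof.
move=> pq y0.
have matan c : measurable_fun setT (fun x : measurableTypeR R => atan ((c - x) / y)).
  apply: continuous_measurable_fun => x.
  apply: (@continuous_comp _ _ _ (fun x => (c - x) / y)); last exact: continuous_atan.
  by apply: cvgM; [apply: cvgB => //; exact: cvg_cst|exact: cvg_cst].
have h : agree (fun x => y^-1 * (atan ((q - x) / y) - atan ((p - x) / y))).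
  split.
  - apply: measurable_funM => //; exact: measurable_funB.
  - exists (`|y^-1| * (pi / 2 + pi / 2)) => x; rewrite normrM ler_wpM2l//.
    by rewrite (le_trans (ler_normB _ _))// lerD ?norm_atan_le.
  - rewrite -!fubini_poisson//; apply: eq_integral => t _; exact: m12.
have := agreeZ y h; congr agree; apply/funext => x.
by rewrite mulrA divff ?mul1r// lt0r_neq0.
Qed.

(** As y tends to 0, the integrated kernel of [agree_atan] tends to pi on
    ]p, q[, to pi / 2 at the two ends and to 0 elsewhere; atoms correct
    the ends. *)
Lemma agree_itv p q : p < q -> agree \1_`]p, q].
Proof.
move=> pq.
have cvg_atan_div (s : R) : 0 < s -> (fun k => atan (s / y_ k)) @ \oo --> pi / 2.
  move=> s0; refine (cvgr_eqfun _ (cvg_atan_aff 1 s0)) => k.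
  by rewrite /y_ invrK natr1 [s * _]mulrC.
have cvg_atan_sg (s : R) : (fun k => atan (s / y_ k)) @ \oo --> Num.sg s * (pi / 2).
  have [s0|s0|->] := ltrgt0P s.
  - by rewrite gtr0_sg// mul1r; exact: cvg_atan_div.
  - rewrite ltr0_sg// mulN1r.
    refine (cvgr_eqfun _ (cvgN (cvg_atan_div (- s) _))); last by rewrite oppr_gt0.
    by move=> k; rewrite !fctE/= mulNr atanN opprK.
  - rewrite sgr0 mul0r; under eq_fun do rewrite mul0r atan0; exact: cvg_cst.
have H : agree (fun x => Num.sg (q - x) * (pi / 2) - Num.sg (p - x) * (pi / 2)).
  apply: (@agree_lim (fun k x => atan ((q - x) / y_ k) - atan ((p - x) / y_ k)) _ (pi / 2 + pi / 2)).
  - by move=> k; exact: agree_atan.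
  - by move=> k x; rewrite (le_trans (ler_normB _ _))// lerD ?norm_atan_le.
  - by move=> x; apply: cvgB; exact: cvg_atan_sg.
have := agreeD (agreeZ pi^-1 H) (agreeD (agreeZ 2^-1 (agree_atom q)) (agreeZ (- 2^-1) (agree_atom p))).
congr agree; apply/funext => x.
have pi0 : pi != 0 :> R by rewrite lt0r_neq0// pi_gt0.
rewrite !indicE !in_set1 mem_setE in_itv/=.
have [xp|xp|->] := ltgtP x p.
- have xq : x < q by exact: lt_trans pq.
  by rewrite !gtr0_sg ?subr_gt0// lt_eqF//= !mulr0 addr0 subrr mulr0 addr0.
- rewrite [Num.sg (p - x)]ltr0_sg ?subr_lt0//.
  have [xq|xq|->] := ltgtP x q.
  + by rewrite gtr0_sg ?subr_gt0// mul1r mulN1r opprK -splitr mulVf// !mulr0 !addr0.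
  + by rewrite ltr0_sg ?subr_lt0// subrr !mulr0 !addr0.
  + rewrite subrr sgr0 mul0r mulN1r opprK add0r mulKf// !mulr1 mulr0 addr0.
    by rewrite [RHS]splitr mul1r.
- rewrite subrr sgr0 gtr0_sg ?subr_gt0// lt_eqF// mul1r mul0r subr0 mulKf//.
  by rewrite mulr0 add0r mulr1 subrr.
Qed.

Lemma poisson_unique (A : set (measurableTypeR R)) : measurable A -> m1 A = m2 A.
Proof.
move=> mA; apply: (@measure_unique _ R (measurableTypeR R) (@ocitv R) (fun k : nat => `](- k%:R), k%:R]%classic)) => //.
- exact: ocitvI.
- by move=> k; exact: is_ocitv.
- rewrite -subTset => x _; exists (Num.truncn `|x|).+1 => //=.
  rewrite in_itv/=; have := truncnS_gt `|x|; rewrite ltr_norml => /andP[-> h].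
  exact: ltW.
- move=> X /ocitvP[->|[[p q] /= pq ->]]; first by rewrite !measure0.
  have [_ _] := agree_itv pq.
  have mi : measurable (`]p, q]%classic : set (measurableTypeR R)) by exact: measurable_itv.
  by rewrite !integral_indic// !setIT.
- by move=> k; rewrite ltey_eq fin_num_measure//; exact: measurable_itv.
Qed.

End agreement.
End PoissonDetermines.

(** * Measures with a density *)

Section DensityMeasure.
Context d (T : measurableType d) (R : realType).
Variables (mu : {measure set T -> \bar R}) (h : T -> R).
Hypothesis mh : measurable_fun setT h.
Hypothesis h_ge0 : forall x, 0 <= h x.
Hypothesis h_fin : (\int[mu]_x (h x)%:E < +oo)%E.
Local Open Scope ereal_scope.

(** The hypotheses on h are arguments so that the structure of a finite
    measure can be attached to this constant. *)
Definition density_measure & measurable_fun setT h & (forall x, 0 <= h x)%R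
  & (\int[mu]_x (h x)%:E < +oo)%E := fun A : set T => \int[mu]_(x in A) (h x)%:E.

Local Notation nu := (density_measure mh h_ge0 h_fin).

Let nu0 : nu set0 = 0. Proof. by rewrite /density_measure integral_set0. Qed.

Let nu_ge0 A : 0 <= nu A.
Proof. by apply: integral_ge0 => x _; rewrite lee_fin. Qed.

Let nu_sigma_additive : semi_sigma_additive nu.
Proof.
move=> F mF tF mUF; rewrite /density_measure ge0_integral_bigcup//.
- by apply: is_cvg_ereal_nneg_natsum_cond => n _ _; exact: nu_ge0.
- by apply/measurable_EFinP; exact: measurable_funTS.
- by move=> x _; rewrite lee_fin.
Qed.

HB.instance Definition _ := isMeasure.Build _ _ _ nu nu0 nu_ge0 nu_sigma_additive.

Let nu_fin : fin_num_fun nu.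
Proof.
move=> A mA; rewrite ge0_fin_numE//; apply: le_lt_trans h_fin.
by apply: ge0_subset_integral => //; [exact/measurable_EFinP|move=> x _; rewrite lee_fin].
Qed.

HB.instance Definition _ := Measure_isFinite.Build _ _ _ nu nu_fin.

End DensityMeasure.

(** * Limits of probability densities *)

Section DensityLimit.
Context {R : realType}.
Local Notation lam := (@lebesgue_measure R).
Variables (f_ : nat -> R -> R) (f : R -> R).
Hypothesis mf_ : forall n, measurable_fun setT (f_ n : measurableTypeR R -> R).
Hypothesis f_ge0 : forall n x, 0 <= f_ n x.
Hypothesis f_mass : forall n, (\int[lam]_x (f_ n x)%:E = 1)%E.
Hypothesis f_f : forall x, f_ ^~ x @ \oo --> f x.
Hypothesis f_bounded : forall X : R, 0 <= X -> exists N C, forall n x,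
  (N <= n)%N -> `|x| <= X -> f_ n x <= C.

Lemma limit_ge0 x : 0 <= f x.
Proof.
have fx : f_ ^~ x @ \oo --> f x by exact: f_f.
rewrite -(cvg_lim _ fx)//; apply: limr_ge; last exact: nearW.
by apply/cvg_ex; exists (f x).
Qed.

Lemma measurable_limit : measurable_fun setT (f : measurableTypeR R -> R).
Proof. by apply: (@measurable_fun_cvg _ (measurableTypeR R) _ setT f_ f mf_) => x _; exact: f_f. Qed.

Lemma limit_mass : (\int[lam]_x (f x)%:E <= 1)%E.
Proof.
have mE n : measurable_fun setT (fun x : measurableTypeR R => (f_ n x)%:E).
  exact/measurable_EFinP.
have h := @fatou _ _ _ lam setT measurableT (fun n x => (f_ n x)%:E) mE
  (fun n x _ => f_ge0 n x).
have e1 : limn_einf (fun n => \int[lam]_x (f_ n x)%:E)%E = 1%E.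
  have -> : (fun n => \int[lam]_x (f_ n x)%:E)%E = cst 1%E by apply/funext => n.
  by rewrite (cvg_limn_einf_sup (cvg_cst _)).1.
rewrite e1 in h; apply: le_trans h; rewrite le_eqVlt; apply/orP; left; apply/eqP.
apply: eq_integral => x _; apply/esym; apply: (cvg_limn_einf_sup _).1.
by apply: cvg_EFin; [exact: nearW|exact: f_f].
Qed.

Variables t y : R.
Hypothesis y_gt0 : 0 < y.
Local Notation P := (poisson t y).

(** Outside I the kernel is at most s^(-2). *)
Lemma truncated_poisson (g : R -> R) (s : R) : 0 < s ->
  measurable_fun setT (g : measurableTypeR R -> R) -> (forall x, 0 <= g x) ->
  (\int[lam]_x (g x)%:E <= 1)%E ->
  let I := `[- (`|t| + s), `|t| + s]%classic in
  (\int[lam]_(x in I) (P x * g x)%:E <= \int[lam]_x (P x * g x)%:E)%E /\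
  (\int[lam]_x (P x * g x)%:E <= \int[lam]_(x in I) (P x * g x)%:E + (s ^- 2)%:E)%E.
Proof.
move=> s0 mg g0 g1 I.
have mI : measurable (I : set (measurableTypeR R)) by exact: measurable_itv.
have mPg : measurable_fun setT (fun x : measurableTypeR R => (P x * g x)%:E).
  by apply/measurable_EFinP; apply: measurable_funM => //; exact: measurable_poisson.
have Pg0 x : (0 <= (P x * g x)%:E)%E by rewrite lee_fin mulr_ge0// poisson_ge0.
split; first exact: ge0_subset_integral.
rewrite -{1}(setUv I) ge0_integral_setU//; last 3 first.
- exact: measurableC.
- by rewrite setUv.
- by rewrite /disj_set setICr.
apply: leeD => //.
apply: (@le_trans _ _ (\int[lam]_(x in ~` I) ((s ^- 2)%:E * (g x)%:E))%E).
  apply: ge0_le_integral => //.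
  - exact: measurableC.
  - by apply: measurable_funTS.
  - by apply: measurable_funTS; apply: emeasurable_funM => //; exact/measurable_EFinP.
  - move=> x; rewrite /I/= in_itv/= => /negP; rewrite -ler_norml -ltNge => xs.
    rewrite -EFinM lee_fin ler_wpM2r// /poisson lef_pV2 ?posrE ?poisson_den_gt0 ?exprn_gt0//.
    apply: (@le_trans _ _ ((x - t) ^+ 2)); last by rewrite lerDl sqr_ge0.
    have h : s <= `|x - t|.
      by have := lerB_dist x t; move: (`|x - t|) (`|x|) (`|t|) xs => p q r *; lra.
    by rewrite -[leRHS]real_normK ?num_real// lerXn2r ?nnegrE// ltW.
have mC : measurable (~` I : set (measurableTypeR R)) by exact: measurableC.
have mgE : measurable_fun setT (fun x : measurableTypeR R => (g x)%:E) by exact/measurable_EFinP.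
rewrite (ge0_integralZl lam mC (measurable_funTS mgE)); last 2 first.
- by move=> x _; rewrite lee_fin.
- by rewrite lee_fin invr_ge0 sqr_ge0.
rewrite -[leRHS]mule1; apply: lee_wpmul2l.
  by rewrite lee_fin invr_ge0 sqr_ge0.
apply: le_trans g1; apply: ge0_subset_integral => //.
by move=> x _; rewrite lee_fin.
Qed.

Lemma truncated_poisson_cvg (X : R) : 0 <= X ->
  (fun n => \int[lam]_(x in `[(- X)%R, X]) (P x * f_ n x)%:E)%E @ \oo -->
  (\int[lam]_(x in `[(- X)%R, X]) (P x * f x)%:E)%E.
Proof.
move=> X0; have [N [C fC]] := f_bounded X0.
have mP : measurable_fun setT (P : measurableTypeR R -> R) by exact: measurable_poisson.
have mI : measurable (`[- X, X]%classic : set (measurableTypeR R)) by exact: measurable_itv.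
rewrite -(cvg_shiftn N).
have [] := @dominated_convergence _ _ _ lam (`[- X, X]%classic : set (measurableTypeR R)) mI
    (fun n x => (P x * f_ (n + N)%N x)%:E) (fun x => (P x * f x)%:E) (EFin \o cst (y ^- 2 * C)).
- move=> n; apply: measurable_funTS; apply/measurable_EFinP.
  exact: measurable_funM.
- by apply: measurable_funTS; apply/measurable_EFinP; apply: measurable_funM => //; exact: measurable_limit.
- apply: aeW => x /= _; apply: cvg_EFin; first exact: nearW.
  apply: cvgM; first exact: cvg_cst.
  have h : f_ ^~ x @ \oo --> f x by exact: f_f.
  by move: h; rewrite -(cvg_shiftn N); exact.
- apply/integrableP; split; first exact/measurable_EFinP.
  apply: (@le_lt_trans _ _ (`|(y ^- 2 * C)%:E| * lam `[(- X)%R, X])%E).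
    by rewrite -(integral_cst lam mI).
  by rewrite lebesgue_measure_itv/=; case: ifP => _; rewrite ?mule0 ?ltry.
- apply: aeW => x /= n; rewrite in_itv/= -ler_norml => xX.
  rewrite lee_fin ger0_norm; last by rewrite mulr_ge0 ?poisson_ge0.
  by rewrite ler_pM ?poisson_ge0 ?poisson_le//; apply: fC; rewrite ?leq_addl.
by [].
Qed.

(** Mass may escape to infinity along the sequence, but the kernel
    vanishes there: dominated convergence on bounded intervals and the
    uniform bound of [truncated_poisson] for the rest. *)
Lemma poisson_limit (A : R) :
  (fun n => \int[lam]_x (P x * f_ n x)%:E)%E @ \oo --> A%:E ->
  (\int[lam]_x (P x * f x)%:E = A%:E)%E.
Proof.
move=> cA; set B := (\int[lam]_x _)%E.
have bounds s : 0 < s -> (A%:E <= B + (s ^- 2)%:E)%E /\ (B <= A%:E + (s ^- 2)%:E)%E.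
  move=> s0; have X0 : 0 <= `|t| + s by rewrite addr_ge0 ?normr_ge0// ltW.
  have cT := truncated_poisson_cvg X0.
  have m1 n : (\int[lam]_x (f_ n x)%:E <= 1)%E by rewrite f_mass.
  have tn n := truncated_poisson s0 (@mf_ n) (f_ge0 n) (m1 n).
  have [l1 l2] := truncated_poisson s0 measurable_limit limit_ge0 limit_mass.
  set TB := (\int[lam]_(x in _) _)%E in cT l1 l2.
  have cT2 : (fun n => \int[lam]_(x in `[(- (`|t| + s))%R, (`|t| + s)%R]) (P x * f_ n x)%:E
      + (s ^- 2)%:E)%E @ \oo --> (TB + (s ^- 2)%:E)%E.
    by apply: cvgeD => //; [exact: fin_num_adde_defl|exact: cvg_cst].
  have e1 := cvg_lim (@ereal_hausdorff R) cA.
  have e2 := cvg_lim (@ereal_hausdorff R) cT.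
  have e3 := cvg_lim (@ereal_hausdorff R) cT2.
  split.
    apply: (@le_trans _ _ (TB + (s ^- 2)%:E)%E); last exact: leeD2r.
    rewrite -e1 -e3; apply: lee_lim.
    - by apply/cvg_ex; exists A%:E.
    - by apply/cvg_ex; eexists; exact: cT2.
    - by apply: nearW => n; case: (tn n).
  apply: (le_trans l2); apply: leeD2r.
  rewrite -e1 -e2; apply: lee_lim.
  - by apply/cvg_ex; eexists; exact: cT.
  - by apply/cvg_ex; exists A%:E.
  - by apply: nearW => n; case: (tn n).
have sq (e : R) : 0 < e -> (Num.sqrt e)^-1 ^- 2 = e.
  by move=> e0; rewrite exprVn invrK sqr_sqrtr// ltW.
have sq_gt0 (e : R) : 0 < e -> 0 < (Num.sqrt e)^-1 by rewrite invr_gt0 sqrtr_gt0.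
apply/eqP; rewrite eq_le; apply/andP; split; apply/lee_addgt0Pr => e e0.
  by have := (bounds _ (sq_gt0 _ e0)).2; rewrite sq.
by have := (bounds _ (sq_gt0 _ e0)).1; rewrite sq.
Qed.

End DensityLimit.

(** * The spectral density *)

Section SpectralDensity.
Context {R : realType}.
Variables a b c : nat -> R.
Hypothesis a_gt0 : forall n, 0 < a n.
Hypothesis cE : forall n, c n = a n - Num.sqrt n.+1%:R.
Hypothesis c_little_o : c =o_\oo (fun n : nat => Num.sqrt n.+1%:R : R).
Hypothesis c_summable : (\sum_(0 <= n <oo)
     (`|c n| / n.+1%:R + (`|c n.+1 - c n| + `|b n|) / Num.sqrt n.+1%:R)%:E
     < +oo)%E.
Local Notation lam := (@lebesgue_measure R).

Let w x := fun n : nat => (Num.sqrt n.+1%:R * sqden a b n x)^-1.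

Lemma weight_lim_gt0 x : w x @ \oo --> limn (w x) /\ 0 < limn (w x).
Proof.
have [W W0 wW] := weight_cvg a_gt0 cE c_little_o c_summable x.
by have -> : limn (w x) = W by exact: cvg_lim.
Qed.

Let rho' (x : R) : R := pi^-1 * limn (w x).

Lemma approx_densityE n x :
  approx_density a b n x = pi^-1 * (Num.sqrt n.+1%:R / a n * w x n).
Proof.
rewrite /approx_density /w; move: (pi : R) (lt0r_neq0 (pi_gt0 R)) => p p0; field.
by rewrite p0 !lt0r_neq0 ?sqden_gt0 ?sqrtr_gt0.
Qed.

Lemma approx_density_cvg x : (approx_density a b ^~ x) @ \oo --> rho' x.
Proof.
have [wx _] := weight_lim_gt0 x.
have -> : rho' x = pi^-1 * (1 * limn (w x)) by rewrite mul1r.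
under eq_fun do rewrite approx_densityE.
apply: cvgM; first exact: cvg_cst.
by apply: cvgM wx; exact: sqrt_div_a_cvg1 cE c_little_o.
Qed.

Lemma approx_density_bounded (X : R) : 0 <= X -> exists N C, forall n x,
  (N <= n)%N -> `|x| <= X -> approx_density a b n x <= C.
Proof.
move=> X0.
have [N1 [C1 [C10 h1]]] := weight_bounded a_gt0 cE c_little_o c_summable X0.
have /cvgrPdist_le/(_ 1 ltr01)[N2 _ h2] := sqrt_div_a_cvg1 cE c_little_o.
exists (maxn N1 N2), (pi^-1 * (2 * C1)) => n x; rewrite geq_max => /andP[n1 n2] xX.
rewrite approx_densityE ler_pM2l ?invr_gt0 ?pi_gt0//.
have s0 : 0 <= Num.sqrt n.+1%:R / a n by rewrite divr_ge0 ?sqrtr_ge0// ltW.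
rewrite ler_pM//; last exact: h1.
  by rewrite /w invr_ge0 mulr_ge0 ?sqrtr_ge0// ltW// sqden_gt0.
by have := h2 n n2; rewrite /= ler_norml => /andP[+ _]; lra.
Qed.

Variable E : pvm R.
Hypothesis ET : is_spectral_measure (jacobi a b) E.

Let carl := carleman a_gt0 cE c_little_o c_summable.

Let mf n : measurable_fun setT (approx_density a b n : measurableTypeR R -> R) :=
  measurable_approx_density b a_gt0 n.

Let mrho' : measurable_fun setT (rho' : measurableTypeR R -> R).
Proof. exact: measurable_limit mf approx_density_cvg. Qed.

Let rho'_ge0 (x : measurableTypeR R) : 0 <= rho' x.
Proof. by rewrite mulr_ge0 ?invr_ge0 ?pi_ge0// ltW// (weight_lim_gt0 x).2. Qed.

Let rho'_fin : (\int[lam]_x (rho' x)%:E < +oo)%E.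
Proof.
apply: le_lt_trans (ltry 1).
exact: (limit_mass mf (approx_density_ge0 b a_gt0) (approx_density_mass b a_gt0) approx_density_cvg).
Qed.

(** Both measures have the same Poisson integrals, the limits of those of
    [approx_density]. *)
Lemma spectral_rhoE (A : set (measurableTypeR R)) : measurable A ->
  pvm_measure E (delta_l2 0) A = (\int[lam]_(x in A) (rho' x)%:E)%E.
Proof.
move=> mA; pose nu := density_measure mrho' rho'_ge0 rho'_fin.
rewrite -[RHS]/(nu A).
apply: (poisson_unique (m1 := pvm_measure E (delta_l2 0)) (m2 := nu)) => // t y y0.
rewrite pvm_poissonE// (@ge0_integral_density _ _ _ lam nu rho')//; last 2 first.
- by apply/measurable_EFinP; exact: measurable_poisson.
- by move=> x; rewrite lee_fin poisson_ge0.
under eq_integral do rewrite -EFinM.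
apply/esym.
apply: (poisson_limit mf (approx_density_ge0 b a_gt0) (approx_density_mass b a_gt0)
  approx_density_cvg approx_density_bounded y0).
under eq_fun do rewrite approx_poissonE//.
by apply: cvg_EFin; [exact: nearW|exact: approx_poisson_cvg].
Qed.

(** A Lebesgue-null set B is null for the spectral measure of delta_0, so
    E(B) kills delta_0, and then everything. *)
Lemma spectral_measure_ac : purely_absolutely_continuous E.
Proof.
move=> u; apply/null_content_dominatesP => A mA A0.
suff E0 : E A (delta_l2 0) = 0.
  by rewrite pvm_measureE (proj_eq0 a_gt0 carl ET mA E0) /sqnorm rdot0r.
apply: sqnorm_eq0; apply: EFin_inj; rewrite -pvm_measureE spectral_rhoE//.
by apply: null_set_integral => //; exact/measurable_EFinP/measurable_funTS.
Qed.

Lemma spectral_densityE :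
  {ae lam, forall x, spectral_density E x = (pi^-1 * limn (w x))%:E}.
Proof.
have rho_lam : charge_of_finite_measure (spectral_rho E) `<< lam.
  exact: spectral_measure_ac.
have : ae_eq lam setT (spectral_density E) (EFin \o rho').
  apply: integral_ae_eq => //.
  - exact: Radon_Nikodym_integrable.
  - exact/measurable_EFinP.
  - move=> A _ mA; rewrite -Radon_Nikodym_integral//.
    exact: spectral_rhoE.
by apply: filterS => x; exact.
Qed.

End SpectralDensity.

Theorem corollary1 (R : realType) (a b c : nat -> R)
  (a_gt0 : forall n, 0 < a n)
  (cE : forall n, c n = a n - Num.sqrt n.+1%:R)
  (c_little_o : c =o_\oo (fun n : nat => Num.sqrt n.+1%:R : R))
  (c_summable : (\sum_(0 <= n <oo)
     (`|c n| / n.+1%:R + (`|c n.+1 - c n| + `|b n|) / Num.sqrt n.+1%:R)%:E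
     < +oo)%E) :
  let w x := fun n : nat => (Num.sqrt n.+1%:R *
    (jacobiP a b n x ^+ 2 + jacobiP a b n.+1 x ^+ 2))^-1 in
  [/\ self_adjoint (jacobi a b),
      forall E : pvm R, is_spectral_measure (jacobi a b) E ->
        purely_absolutely_continuous E /\
        {ae @lebesgue_measure R, forall x,
          spectral_density E x = (pi^-1 * limn (w x))%:E} &
      forall x : R, cvgn (w x) /\ limn (w x) != 0].
Proof.
move=> w; split.
- exact: jacobi_self_adjoint b a_gt0 (carleman a_gt0 cE c_little_o c_summable).
- move=> E ET; split.
    exact: (@spectral_measure_ac _ _ _ _ a_gt0 cE c_little_o c_summable E ET).

  exact: (@spectral_densityE _ _ _ _ a_gt0 cE c_little_o c_summable E ET).
move=> x; have [wx wx0] := weight_lim_gt0 a_gt0 cE c_little_o c_summable x.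
by split; [apply/cvg_ex; eexists; exact: wx|rewrite gt_eqF].
Qed.
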